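(* For every even integer $k\ge 6$ and every integer $d$ with $k/2\le d\le k-1$, there exist $\epsilon>0$ and $n_2\in \mathbb N$ such that for every $k$-graph $\mathcal{H}$ on $n\ge n_2$ vertices with $n\in \frac k2\mathbb N$ the following holds. If $\delta_d(\mathcal{H})>\overline\delta(n,k,d)$ and $\mathcal{H}$ is $\epsilon$-close to a $\mathcal{B}_{n,k}$ or a $\overline \mathcal{B}_{n,k}$, then $\mathcal{H}$ contains a Hamilton $(k/2)$-cycle.
   Context: A $k$-graph has vertex set $V$ and edge set $E\subseteq\binom{V}{k}$; $\delta_d$ is the minimum number of edges containing a $d$-set, over all $d$-sets. A Hamilton $\ell$-cycle is a spanning subhypergraph whose vertices can be ordered cyclically so that each edge consists of $k$ consecutive vertices and consecutive edges share exactly $\ell$ vertices. Given an $n$-element vertex set $V$ with partition $V=A\,\dot\cup\,B$, a set $S$ is odd (resp. even) if $|S\cap A|$ is odd (resp. even); $\mathcal{B}_{n,k}(A,B)$ has as edges all odd $k$-sets and $\overline{\mathcal{B}}_{n,k}(A,B)$ all even $k$-sets; $\mathcal{B}'_{n,k}(A,B)$ is $\mathcal{B}_{n,k}(A,B)$ plus all $k$-subsets of $A$ containing a fixed vertex of $A$. We write $\mathcal{B}_{n,k}$, $\overline{\mathcal{B}}_{n,k}$ for these hypergraphs with respect to some partition with $|A|,|B|$ differing by at most one (equal sizes). $\mathcal{H}$ is $\epsilon$-close to $\mathcal{H}'$ (both on $n$ vertices) if $\mathcal{H}$ can be made a copy of $\mathcal{H}'$ by adding and deleting at most $\epsilon n^k$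 edges. The family $\mathcal{H}_{\mathrm{ext}}(n,k)$ (over all partitions $A\cup B$) is: if $n\in k\mathbb{N}$, all $\mathcal{B}_{n,k}(A,B)$ with $n/k-|A|$ odd and all $\overline{\mathcal{B}}_{n,k}(A,B)$ with $|A|$ odd; if $n\in\frac k2\mathbb{N}\setminus k\mathbb{N}$, all $\mathcal{B}_{n,k}(A,B)$, together with all $\mathcal{B}'_{n,k}(A,B)$ with $\lfloor n/k\rfloor-|A|$ odd when $k\in 4\mathbb{N}$, and all $\mathcal{B}'_{n,k}(A,B)$ with $\lfloor n/k\rfloor-|A|$ even when $k\in 2\mathbb{N}\setminus 4\mathbb{N}$. $\overline\delta(n,k,d)$ is the maximum of $\delta_d(\mathcal{F})$ over $\mathcal{F}\in\mathcal{H}_{\mathrm{ext}}(n,k)$. *)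

(* Defs.v *)
From mathcomp Require Import all_boot all_order all_algebra all_fingroup.

Set Implicit Arguments.
Unset Strict Implicit.
Unset Printing Implicit Defensive.

(* A hypergraph on the vertex type T is given by its edge set. *)
Definition kgraph (T : finType) (k : nat) (H : {set {set T}}) : Prop :=
  forall e, e \in H -> #|e| = k.

Definition degree (T : finType) (H : {set {set T}}) (S : {set T}) : nat :=
  #|[set e in H | S \subset e]|.

(* No degree exceeds #|H|, so the initial value of the iterated minimum does
   not matter as soon as T has a d-subset. *)
Definition min_degree (T : finType) (d : nat) (H : {set {set T}}) : nat :=
  \big[minn/#|H|]_(S : {set T} | #|S| == d) degree H S.

(* A partition of T into A and B is represented by A alone; B is ~: A. *)
Definition Bodd (T : finType) (k : nat) (A : {set T}) : {set {set T}} :=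
  [set e : {set T} | (#|e| == k) && odd #|e :&: A|].

Definition Beven (T : finType) (k : nat) (A : {set T}) : {set {set T}} :=
  [set e : {set T} | (#|e| == k) && ~~ odd #|e :&: A|].

Definition Bprime (T : finType) (k : nat) (A : {set T}) (v : T) :
    {set {set T}} :=
  Bodd k A :|: [set e : {set T} | [&& #|e| == k, e \subset A & v \in e]].

Definition balanced (T : finType) (A : {set T}) : bool :=
  (#|A| <= #|~: A|.+1) && (#|~: A| <= #|A|.+1).

(* Parity of the integer a - b (subtraction on nat is truncated). *)
Definition odd_diff (a b : nat) : bool := odd a (+) odd b.

Definition Hext (T : finType) (k : nat) : {set {set {set T}}} :=
  let n := #|T| in
  if k %| n then
    [set Bodd k A | A : {set T} & odd_diff (n %/ k) #|A|]
    :|: [set Beven k A | A : {set T} & odd #|A|]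
  else if k./2 %| n then
    [set Bodd k A | A : {set T}]
    :|: [set F | [exists A : {set T}, exists v : T,
          [&& v \in A, F == Bprime k A v &
              ((4 %| k) && odd_diff (n %/ k) #|A|)
              || [&& 2 %| k, ~~ (4 %| k) & ~~ odd_diff (n %/ k) #|A|]]]]
  else set0.

(* Hext is invariant under relabelling vertices, so 'I_n stands for any
   n-element vertex set. Trivial partitions are allowed in Hext: for even k and
   0 < d < k <= n their members have min_degree 0. *)
Definition bar_delta (n k d : nat) : nat :=
  \max_(F in Hext 'I_n k) min_degree d F.

(* The permutation s turns H' into an arbitrary copy of H' on T; the edges to
   delete from H and to add to H form the symmetric difference. *)
Definition eps_close (R : realFieldType) (T : finType) (k : nat) (eps : R)
    (H H' : {set {set T}}) : Prop :=
  exists s : {perm T},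
    let H'' := [set s @: (e : {set T}) | e in H'] in
    ((#|(H :\: H'') :|: (H'' :\: H)|)%:R <= eps * #|T|%:R ^+ k)%R.

(* The k cyclically consecutive entries of s starting at position i. *)
Definition window (T : finType) (k : nat) (s : seq T) (i : nat) : {set T} :=
  [set x in take k (rot i s)].

(* C is the edge set of a Hamilton l-cycle on T: consecutive edges share l
   vertices, so the edges are the windows starting at the multiples of k - l,
   and k - l divides #|T|. For #|T| < 2 * k - l the overlaps can exceed l, so
   the definition is only meaningful for larger vertex sets. *)
Definition hamilton_cycle (T : finType) (k l : nat) (C : {set {set T}}) : Prop :=
  [/\ l < k, k - l %| #|T| &
   exists s : seq T, perm_eq s (enum T) /\
     C = [set window k s (j * (k - l)) | j : 'I_(#|T| %/ (k - l))]].

Definition has_hamilton_cycle (T : finType) (k l : nat) (H : {set {set T}}) :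
    Prop :=
  exists2 C : {set {set T}}, hamilton_cycle k l C & C \subset H.

(* Main.v *)
(* Write k = 2r and n = rm. A Hamilton r-cycle is a cyclic sequence of m blocks of
   size r such that any two consecutive blocks form an edge. Since H is close to
   the hypergraph of all k-sets of one parity with respect to A, almost all
   "right" edges of that parity are present, and a short path of blocks extends
   to a Hamilton cycle as soon as the parities of the blocks can be chosen
   consistently: exceptional vertices are absorbed first, and the rest is filled
   by gadgets with slots, chosen by an exponential potential so that each leftover
   vertex fits into most slots. When right edges alone are ruled out by parity,
   the extremal hypergraphs in Hext show that H has wrong edges in every relevant
   place. Either three of them are disjoint, or all meet a bounded set and a
   vertex has a large link, in which the Frankl-Furedi theorem on forbidden
   intersections finds two edges sharing exactly r vertices. Such configurations
   start the path and correct the parity. *)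
Require Import Defs.
From HB Require Import structures.
From mathcomp Require Import all_boot all_order all_algebra all_fingroup zify ring lra.

Set Implicit Arguments.
Unset Strict Implicit.
Unset Printing Implicit Defensive.

Import Order.TTheory GRing.Theory Num.Theory.

(** * Uniform families without two members meeting in l points *)

(** Right edges dictate the block parities: constant along the cycle when [pi] is false, alternating
    when [pi] is true. The parity problem thus depends only on [pi], on [m] modulo 4 and on the
    parity of [A], and each wrong edge shifts the pattern once. A wrong edge helps only if right
    edges continue the path from its halves ([rok]). If every r-set is [rok], any configuration of
    wrong edges can be used; an r-set that is not [rok] has a positive density of wrong edges by the
    degree condition, and these replace the extremal argument. That argument needs d >= k/2: wrong
    edges covering a positive proportion of the d-sets of one type number at least order n^r, and a
    link of order n^r exceeds the bound of order n^(r-1) on families of (2r-1)-sets without two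
    members meeting in r-1 points. Gadgets are disjoint, hence not independent, and each rejects a
    given vertex with a probability bounded only by a constant. The potential controls the
    rejections of all vertices together while the gadgets are chosen one at a time. *)

(** Double counting finds [i0] and [y] in [Y :&: S i0] such that more sets contain [y] than
    [Y :&: S i0] has points. Induction applies to [Y :&: S i0] without [y] and to the other indices
    whose sets contain [y]; adding [i0] to the resulting [K] raises both sides by one, since [y]
    lies in all sets involved. *)
Lemma frankl_katona (I X : finType) (S : I -> {set X}) (N : nat) :
  forall (J : {set I}) (Y : {set X}), #|Y| <= N -> #|Y| < #|J| ->
  exists K : {set I}, [/\ K != set0, K \subset J &
    #|Y :&: \bigcap_(i in K) S i|.+1 = #|K| ].
Proof.
elim: N => [|N IH] J Y leY ltYJ.
  have /card_gt0P[i iJ] : 0 < #|J| by apply: leq_ltn_trans ltYJ.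
  exists [set i]; split; rewrite ?sub1set //.
    by apply/set0Pn; exists i; rewrite inE.
  move: leY; rewrite leqn0 cards_eq0 => /eqP ->.
  by rewrite set0I cards0 cards1.
pose deg y := #|[set i in J | y \in S i]|.
have [/exists_inP[i iJ /eqP Si0]|/exists_inPn SN0] :=
  boolP [exists i in J, Y :&: S i == set0].
  exists [set i]; split; rewrite ?sub1set //.
    by apply/set0Pn; exists i; rewrite inE.
  by rewrite big_set1 Si0 cards0 cards1.
have /exists_inP[i0 iJ /existsP[y /and3P[yY yS degy]]] :
  [exists i0 in J, exists y, [&& y \in Y, y \in S i0 & #|Y :&: S i0| < deg y]].
  apply/contraT => /exists_inPn H.
  have {}H i y : i \in J -> y \in Y -> y \in S i -> deg y <= #|Y :&: S i|.
    move=> iJ yY yS; rewrite leqNgt; apply/negP => lt.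
    by have /existsP[] := H i iJ; exists y; rewrite yY yS.
  (* Count each i in J as the sum over y in Y :&: S i of 1 / #|Y :&: S i| <= 1 / deg y. *)
  have : (#|J|%:R <= #|Y|%:R :> rat)%R.
    rewrite -sum1_card natr_sum.
    rewrite (eq_bigr (fun i => \sum_(y in Y :&: S i) (#|Y :&: S i|%:R^-1 : rat))%R); last first.
      move=> i iJ; rewrite sumr_const -[RHS]mulr_natl mulfV //.
      by rewrite pnatr_eq0 cards_eq0 (SN0 i iJ).
    apply: (@le_trans _ _
      (\sum_(i in J) \sum_(y in Y :&: S i) ((deg y)%:R^-1 : rat))%R).
      apply: ler_sum => i iJ; apply: ler_sum => y.
      rewrite inE => /andP[yY yS]; rewrite lef_pV2 ?ler_nat ?H //;
        rewrite posrE ltr0n; apply/card_gt0P.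
        by exists y; rewrite inE yY.
      by exists i; rewrite inE iJ.
    rewrite (exchange_big_dep (fun y => y \in Y)) /=; last by move=> i y _; rewrite inE => /andP[].
    rewrite -[#|Y|]sum1_card natr_sum; apply: ler_sum => y yY.
    rewrite (eq_bigl (fun i => i \in [set i in J | y \in S i])); last first.
      by move=> i; rewrite !inE yY.
    rewrite sumr_const -[X in (X <= _)%R]mulr_natl -/(deg y).
    have [->|dn0] := eqVneq (deg y) 0; first by rewrite mul0r.
    by rewrite mulfV // pnatr_eq0.
  by rewrite ler_nat leqNgt ltYJ.
have cY : #|(Y :&: S i0) :\ y|.+1 = #|Y :&: S i0|.
  by rewrite (cardsD1 y (Y :&: S i0)) inE yY yS.
have cJ : #|[set i in J | y \in S i] :\ i0|.+1 = deg y.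
  by rewrite /deg (cardsD1 i0 [set i in J | y \in S i]) inE iJ yS.
have [|//|K [K0 KJ Kc]] := IH ([set i in J | y \in S i] :\ i0) ((Y :&: S i0) :\ y).
  rewrite -ltnS cY; apply: leq_trans leY; exact/subset_leq_card/subsetIl.
  by rewrite -ltnS cY cJ.
have i0K : i0 \notin K by apply/negP => /(subsetP KJ); rewrite !inE eqxx.
exists (i0 |: K); split.
- by apply/set0Pn; exists i0; rewrite !inE eqxx.
- apply/subsetP => i; rewrite !inE => /orP[/eqP->//|/(subsetP KJ)].
  by rewrite !inE => /and3P[].
rewrite cardsU1 i0K -Kc add1n; congr _.+1.
rewrite big_setU1 //= setIA.
rewrite (cardsD1 y) [y \in _]inE inE yY yS /=.
have -> : y \in \bigcap_(i in K) S i.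
  by apply/bigcapP => i /(subsetP KJ); rewrite !inE => /and3P[].
rewrite add1n; congr _.+1; apply: eq_card => z; rewrite !inE.
by rewrite andbA.
Qed.

Section ForbiddenIntersection.
Variables (l : nat) (T : finType).
Let q := l.*2.+1.
Let s := q.*2.+1.

Definition sunflower (Q : {set T}) (Z : {set {set T}}) :=
  [forall e in Z, forall e' in Z, (e != e') ==> (e :&: e' == Q)].

(** As [s] exceeds 2q, some petal of such a sunflower avoids any given set of at most 2q points. *)
Definition kernel (F : {set {set T}}) (Q : {set T}) :=
  [exists Z : {set {set T}}, [&& Z \subset F, s <= #|Z| & sunflower Q Z]].

(** A maximal sunflower with kernel [Q] in [G] has fewer than [s] members. By maximality every
    member of [G] meets the union of its petals, which has at most s * q points, so one of these
    points is popular. *)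
Lemma non_kernel_popular (F G : {set {set T}}) (Q : {set T}) :
  ~~ kernel F Q -> G \subset F -> G != set0 ->
  (forall e, e \in G -> #|e| = q /\ Q \proper e) ->
  exists2 x, x \notin Q & #|G| <= s * q * #|[set e in G | x \in e]|.
Proof.
move=> nk GF G0 GQ.
pose P (Z : {set {set T}}) := (Z \subset G) && sunflower Q Z.
have P0 : P set0 by rewrite /P sub0set; apply/forall_inP => e; rewrite inE.
have [Z /maxsetP[/andP[ZG Zs] Zmax] _] := maxset_exists P0.
have ltZ : #|Z| < s.
  rewrite ltnNge; apply: contra nk => ge; apply/existsP; exists Z.
  by rewrite ge Zs (subset_trans ZG GF).
pose U := (\bigcup_(e in Z) e) :\: Q.
have leU : #|U| <= s * q.
  apply: leq_trans (subset_leq_card (subsetDl _ _)) _.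
  apply: (@leq_trans (\sum_(e in Z) #|e|)).
    rewrite -sum1_card; apply: leq_trans (_ : \sum_(x in \bigcup_(e in Z) e) \sum_(e in Z | x \in e) 1 <= _).
      apply: leq_sum => x /bigcupP[e eZ xe].
      by rewrite (bigD1 e) /= ?eZ.
    rewrite (exchange_big_dep (fun e => e \in Z)) /=; last by move=> x e _ /andP[].
    apply: leq_sum => e eZ; rewrite -[#|e|]sum1_card.
    by apply/eq_leq/eq_bigl => x; rewrite eZ /=; apply: andb_idl => xe; apply/bigcupP; exists e.
  rewrite (eq_bigr (fun=> q)); last by move=> e /(subsetP ZG)/GQ[].
  by rewrite sum_nat_const leq_mul2r ltnW ?orbT.
have hitU e : e \in G -> exists2 x, x \in U & x \in e.
  move=> eG; have [_ Qe] := GQ e eG.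
  have [eZ|eZ] := boolP (e \in Z).
    have /properP[_ [x xe xQ]] := Qe.
    by exists x => //; rewrite inE xQ; apply/bigcupP; exists e.
  have : ~~ P (e |: Z).
    by apply: contra eZ => /Zmax <-; rewrite ?subsetUr ?setU11.
  rewrite negb_and subUset sub1set eG ZG /= => /forall_inPn[e1 e1Z].
  case/forall_inPn => e2 e2Z; rewrite negb_imply => /andP[n12 I12].
  have [e' e'Z [ne' I']] : exists2 e', e' \in Z & e != e' /\ e :&: e' != Q.
    move: e1Z e2Z; rewrite !inE => /orP[/eqP e1e|e1Z] /orP[/eqP e2e|e2Z].
    - by rewrite e1e e2e eqxx in n12.
    - by exists e2 => //; rewrite -e1e.
    - by exists e1 => //; rewrite -e2e eq_sym n12 setIC.
    - have /forall_inP/(_ e1 e1Z)/forall_inP/(_ e2 e2Z) := Zs.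
      by rewrite n12 (negbTE I12).
  have [_ Qe'] := GQ e' (subsetP ZG _ e'Z).
  have /subsetPn[x] : ~~ (e :&: e' \subset Q).
    apply: contra I' => sub; rewrite eqEsubset sub subsetI.
    by rewrite (proper_sub Qe) (proper_sub Qe').
  rewrite inE => /andP[xe xe'] xQ.
  by exists x => //; rewrite inE xQ; apply/bigcupP; exists e'.
have /set0Pn[e0 e0G] := G0.
have [x0 x0U _] := hitU e0 e0G.
pose x1 := [arg max_(x > x0 in U) #|[set e in G | x \in e]|].
have [x1U x1max] : x1 \in U /\ forall x, x \in U ->
    #|[set e in G | x \in e]| <= #|[set e in G | x1 \in e]|.
  by rewrite /x1; case: arg_maxnP => //= i iU im; split=> // x xU; apply: im.
exists x1; first by move: x1U; rewrite inE => /andP[].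
apply: leq_trans (_ : \sum_(x in U) #|[set e in G | x \in e]| <= _).
  rewrite -sum1_card.
  apply: leq_trans (_ : \sum_(e in G) \sum_(x in U | x \in e) 1 <= _).
    apply: leq_sum => e /hitU[x xU xe]; by rewrite (bigD1 x) /= ?xU.
  rewrite (exchange_big_dep (fun x => x \in U)) /=; last by move=> e x _ /andP[].
  apply: leq_sum => x xU; rewrite -sum1_card.
  by apply/eq_leq/eq_bigl => e; rewrite inE xU.
apply: leq_trans (leq_mul leU (leqnn _)).
by rewrite -sum_nat_const; apply: leq_sum => x /x1max.
Qed.

(** Averaging over all colourings: fixing one rainbow pattern on a q-set leaves the other vertices
    free, so at least a fraction q^-q of the colourings are rainbow on it. *)
Lemma exists_rainbow (L : {set {set T}}) :
  (forall e, e \in L -> #|e| = q) ->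
  exists c : {ffun T -> 'I_q},
    #|L| <= q ^ q * #|[set e in L | [forall x in e, forall y in e, (c x == c y) ==> (x == y)]]|.
Proof.
move=> Lq.
pose rb (c : {ffun T -> 'I_q}) (e : {set T}) :=
  [forall x in e, forall y in e, (c x == c y) ==> (x == y)].
apply/existsP; apply: contraT; rewrite negb_exists => /forallP H.
have {}H c : q ^ q * #|[set e in L | rb c e]| < #|L|.
  by rewrite ltnNge; exact: H.
have lb e : e \in L -> q ^ #|T| <= q ^ q * #|[set c | rb c e]|.
  move=> eL; have eq := Lq e eL.
  pose F (x : T) : pred 'I_q := if x \in e then pred1 (inord (index x (enum e))) else predT.
  have sub : #|family F| <= #|[set c | rb c e]|.
    apply/subset_leq_card/subsetP => c /familyP Fc; rewrite inE.
    apply/forall_inP => x xe; apply/forall_inP => y ye; apply/implyP => /eqP cxy.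
    have := Fc x; have := Fc y; rewrite /F xe ye !inE cxy => /eqP -> /eqP /(congr1 val).
    have ix z : z \in e -> index z (enum e) < q.
      by move=> ze; rewrite -eq cardE index_mem mem_enum.
    rewrite /= !inordK ?ix // => E; apply/eqP.
    by rewrite -(nth_index x (s := enum e) (x := x)) ?mem_enum // -E nth_index ?mem_enum.
  apply: leq_trans (leq_mul (leqnn _) sub).
  rewrite card_family foldrE big_map big_enum /=.
  rewrite (bigID (mem e)) /=.
  rewrite big1 ?mul1n; last by move=> x xe; rewrite /F xe card1.
  rewrite (eq_bigr (fun=> q)); last by move=> x /negbTE xe; rewrite /F xe card_ord.
  rewrite prod_nat_const -expnD leq_pexp2l //.
  rewrite -{1}eq -[#|[predC _]|]/(#|[predC e]|).
  by rewrite -(cardC e).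
have : \sum_c q ^ q * #|[set e in L | rb c e]| < \sum_(c : {ffun T -> 'I_q}) #|L|.
  have c0 : {ffun T -> 'I_q} by exact: [ffun=> ord0].
  rewrite [X in X < _](bigD1 c0) //= [X in _ < X](bigD1 c0) //= -addSn.
  by apply: leq_add => //; apply: leq_sum => c _; exact/ltnW.
rewrite sum_nat_const card_ffun card_ord ltnNge => /negP[].
apply: leq_trans (_ : \sum_(e in L) q ^ q * #|[set c | rb c e]| <= _).
  by rewrite mulnC -sum_nat_const; exact: leq_sum.
rewrite -!big_distrr /= leq_mul2l; apply/orP; right.
rewrite (eq_bigr (fun e => \sum_(c | rb c e) 1)); last first.
  by move=> e _; rewrite -sum1_card; apply: eq_bigl => c; rewrite inE.
rewrite (exchange_big_dep predT) //=; apply: leq_sum => c _.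
by rewrite -sum1_card; apply/eq_leq/eq_bigl => e; rewrite inE.
Qed.

End ForbiddenIntersection.

Lemma exists_subset (T : finType) (A : {set T}) j : j <= #|A| ->
  exists2 B : {set T}, B \subset A & #|B| = j.
Proof.
move=> leA; exists [set x in take j (enum A)].
  by apply/subsetP => x; rewrite inE => /mem_take; rewrite mem_enum.
rewrite cardsE (card_uniqP _) ?take_uniq ?enum_uniq // size_take -cardE.
by case: ltngtP leA.
Qed.

Lemma expn_le_bin a j : (a - j) ^ j <= 'C(a, j) * j`!.
Proof.
rewrite bin_ffact; elim: j => [|j IH]; first by rewrite expn0.
rewrite expnSr ffactnSr; apply: leq_mul; last by apply: leq_sub2l.
by apply: leq_trans IH; case: (j) => // i; rewrite leq_exp2r //; apply: leq_sub2l.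
Qed.

Lemma bin_le_expn a j : 'C(a, j) <= a ^ j.
Proof.
apply: (@leq_trans ('C(a, j) * j`!)); first by rewrite leq_pmulr ?fact_gt0.
by rewrite bin_ffact; elim: j => [|j IH] //; rewrite expnSr ffactnSr leq_mul ?leq_subr.
Qed.

(* After Frankl and Furedi. Among the subfamilies F of a rainbow subfamily of L
   take one maximizing #|F| divided by a large power of La indexed by the number
   of types of its pairwise intersections. In some member of F all these types
   are then traces of sunflower kernels, hence the set of types is closed under
   intersection. If no type had size l, the Frankl-Katona lemma applied to a
   minimal set covered by no type would produce a type of size l. *)
Lemma forbidden_intersection (l : nat) : exists K : nat,
  forall (T : finType) (L : {set {set T}}),
    (forall e, e \in L -> #|e| = l.*2.+1) -> K * #|T| ^ l < #|L| ->
    exists e e', [/\ e \in L, e' \in L & #|e :&: e'| = l].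
Proof.
pose q := l.*2.+1; pose s := q.*2.+1; pose N0 := #|{set 'I_q}|.
(* More than N0 * s * q, so that the exceptional families [R I], one for each type, do not exhaust
   [F]. *)
pose La := (s * q * (N0.*2)).+1.
exists (q ^ q * La ^ N0) => T L Lq big.
pose P := [exists e in L, exists e' in L, #|e :&: e'| == l].
have [/exists_inP[e eL /exists_inP[e' e'L /eqP h]]|noP] := boolP P; first by exists e, e'.
have {noP} noP e e' : e \in L -> e' \in L -> #|e :&: e'| != l.
  move=> eL e'L; apply: contra noP => h; apply/exists_inP; exists e => //.
  by apply/exists_inP; exists e'.
exfalso.
have [c leL] := exists_rainbow Lq.
pose L1 : {set {set T}} := [set e in L | [forall x in e, forall y in e, (c x == c y) ==> (x == y)]].
have {}leL : #|L| <= q ^ q * #|L1| by [].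
have L1L : L1 \subset L by apply/subsetP => e; rewrite inE => /andP[].
have cinj e : e \in L1 -> {in e &, injective c}.
  rewrite inE => /andP[_ /forall_inP h] x y xe ye cxy.
  by have /forall_inP/(_ y ye)/implyP/(_ (introT eqP cxy))/eqP := h x xe.
pose NN (F : {set {set T}}) : {set {set 'I_q}} :=
  [set I | [exists e in F, exists e' in F, (e != e') && (c @: (e :&: e') == I)]].
(* Maximality of [w F] means that a subfamily with fewer types has at most #|F| / La members. *)
pose w (F : {set {set T}}) := #|F| * La ^ (N0 - #|NN F|).
have [F FL1 Fmax] : exists2 F : {set {set T}}, F \subset L1 & forall F' : {set {set T}}, F' \subset L1 -> w F' <= w F.
  exists [arg max_(F > L1 | F \subset L1) w F]; first by case: arg_maxnP.
  by case: arg_maxnP => //.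
have wF : #|L1| <= #|F| * La ^ N0.
  apply: leq_trans (_ : w L1 <= _); first by rewrite /w leq_pmulr // expn_gt0.
  apply: leq_trans (Fmax L1 (subxx _)) _.
  by rewrite /w leq_mul2l leq_pexp2l ?orbT // leq_subr.
have F0 : 0 < #|F|.
  rewrite lt0n; apply: contraTneq big => h; rewrite -leqNgt.
  by apply: leq_trans leL _; move: wF; rewrite h mul0n leqn0 => /eqP ->; rewrite muln0.
have Fq e : e \in F -> #|e| = q by move=> /(subsetP FL1)/(subsetP L1L)/Lq.
have Fc e : e \in F -> {in e &, injective c} by move=> /(subsetP FL1)/cinj.
pose pr (e : {set T}) (I : {set 'I_q}) := [set x in e | c x \in I].
have prI e e' I : e \in F -> c @: (e :&: e') = I -> pr e I = e :&: e'.
  move=> eF <-; apply/setP => x; rewrite !inE; have [xe|//] := boolP (x \in e).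
  apply/imsetP/idP => [[y] |xe']; last by exists x; rewrite // inE xe.
  by rewrite inE => /andP[ye ye'] /(Fc e eF _ _ xe ye) ->.
have cE e : e \in F -> c @: e = setT.
  move=> eF; apply/eqP; rewrite eqEcard subsetT cardsT card_ord.
  by rewrite (card_in_imset (Fc e eF)) Fq ?leqnn.
have cpr e I : e \in F -> c @: pr e I = I.
  move=> eF; apply/setP => i; apply/imsetP/idP => [[x]|iI].
    by rewrite inE => /andP[_ h] ->.
  have : i \in c @: e by rewrite cE.
  by case/imsetP => x xe h; exists x; rewrite // inE xe -h.
have NNproper I : I \in NN F -> #|I| < q.
  rewrite inE => /exists_inP[e eF /exists_inP[e' e'F /andP[ne /eqP <-]]].
  apply: leq_ltn_trans (leq_imset_card _ _) _.
  rewrite -(Fq e eF) proper_card // properEneq subsetIl andbT.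
  by apply: contra ne => /eqP/setIidPl sub; rewrite eqEcard sub (Fq e) ?(Fq e') ?leqnn.
pose R I : {set {set T}} := [set e in F | ~~ kernel l F (pr e I)].
(* Among the members of [R I] with the same trace [Q], keep those through a popular point outside
   [Q]. Two kept members cannot intersect exactly in a common trace, so the type [I] disappears, and
   maximality of [F] bounds the kept family. *)
have leR I : I \in NN F -> #|R I| * La <= s * q * #|F|.
  move=> INN; have ltI := NNproper I INN.
  pose G (Q : {set T}) : {set {set T}} := [set e in R I | pr e I == Q].
  pose xx (Q : {set T}) := [pick x | (x \notin Q) && (#|G Q| <= s * q * #|[set e in G Q | x \in e]|)].
  pose F' : {set {set T}} := [set e in R I | if xx (pr e I) is Some x then x \in e else false].
  have xxS Q x : xx Q = Some x -> (x \notin Q) && (#|G Q| <= s * q * #|[set e in G Q | x \in e]|).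
    by rewrite /xx; case: pickP => // y h [<-].
  have xxP Q : #|G Q| <= s * q * #|[set e in G Q | e \in F']|.
    have [->|/set0Pn[e0 e0G]] := eqVneq (G Q) set0; first by rewrite cards0.
    have nk : ~~ kernel l F Q by move: e0G; rewrite !inE => /andP[/andP[_ h] /eqP <-].
    have [|||x xQ hx] := @non_kernel_popular l T F (G Q) Q nk.
    - by apply/subsetP => e; rewrite !inE => /andP[/andP[]].
    - by apply/set0Pn; exists e0.
    - move=> e; rewrite !inE => /andP[/andP[eF _] /eqP <-]; split; first exact: Fq.
      rewrite properEcard; apply/andP; split; first by apply/subsetP => x; rewrite inE => /andP[].
      rewrite (Fq e eF) -(card_in_imset (f := c)) ?cpr // => x y.
      by rewrite !inE => /andP[xe _] /andP[ye _]; apply: (Fc e eF).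
    have [y Ey] : exists y, xx Q = Some y.
      by rewrite /xx; case: pickP => [y _|/(_ x)]; [exists y|rewrite xQ hx].
    have /andP[yQ hy] := xxS Q y Ey.
    apply: leq_trans hy _; rewrite leq_mul2l; apply/orP; right.
    apply/subset_leq_card/subsetP => e; rewrite !inE => /andP[/andP[/andP[eF k] /eqP E] ye].
    by rewrite eF k E eqxx Ey.
  have F'F : F' \subset F by apply/subsetP => e; rewrite !inE => /andP[/andP[]].
  have leRF' : #|R I| <= s * q * #|F'|.
    have part (Z : {set {set T}}) : #|Z| = \sum_Q \sum_(e in Z | pr e I == Q) 1.
      by rewrite -sum1_card (partition_big (fun e => pr e I) predT).
    rewrite (part (R I)) (part F') big_distrr /=.
    apply: leq_sum => Q _.
    have := xxP Q; rewrite -!sum1_card.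
    rewrite (eq_bigl (fun e => (e \in R I) && (pr e I == Q))); last by move=> e; rewrite inE.
    move/leq_trans; apply; rewrite leq_mul2l; apply/orP; right.
    apply/eq_leq/eq_bigl => e; rewrite !inE; case: (pr e I == Q); rewrite ?andbF //= andbT.
    by rewrite andbT andbA andbb.
  have INF' : I \notin NN F'.
    apply/negP; rewrite inE => /exists_inP[e eF' /exists_inP[e' e'F' /andP[ne /eqP E]]].
    have eF := subsetP F'F _ eF'; have e'F := subsetP F'F _ e'F'.
    have Ee := prI e e' I eF E.
    have Ee' : pr e' I = e :&: e' by rewrite setIC; apply: prI => //; rewrite setIC.
    move: eF' e'F'; rewrite !inE Ee Ee'; case Ex : (xx _) => [x|]; last by rewrite andbF.
    by have := xxS _ _ Ex; rewrite inE => /andP[/negP xn _] /andP[_ xe] /andP[_ xe']; apply: xn; rewrite xe.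
  have ltNN : #|NN F'| < #|NN F|.
    apply: proper_card; apply/properP; split; last by exists I.
    apply/subsetP => J; rewrite !inE => /exists_inP[e eF /exists_inP[e' e'F h]].
    apply/exists_inP; exists e; first exact: (subsetP F'F).
    by apply/exists_inP; exists e'; first exact: (subsetP F'F).
  have := Fmax F' (subset_trans F'F FL1); rewrite /w.
  have leN : #|NN F| <= N0 by apply: max_card.
  have -> : N0 - #|NN F'| = (#|NN F| - #|NN F'|).-1 + (N0 - #|NN F|).+1 by lia.
  rewrite expnD expnS => hw.
  have {}hw : #|F'| * La <= #|F|.
    rewrite -(leq_pmul2r (m := La ^ (N0 - #|NN F|))) ?expn_gt0 //.
    by apply: leq_trans hw; rewrite -mulnA leq_mul2l leq_pmull ?orbT // expn_gt0.
  rewrite -/s -/q in leRF'.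
  apply: leq_trans (leq_mul leRF' (leqnn La)) _.
  by rewrite -mulnA leq_mul2l hw orbT.
have [e eF ker] : exists2 e : {set T}, e \in F & forall I, I \in NN F -> kernel l F (pr e I).
  have : #|\bigcup_(I in NN F) R I| < #|F|.
    have leU : #|\bigcup_(I in NN F) R I| <= \sum_(I in NN F) #|R I|.
      elim/big_rec2: _ => [|I m A _ IH]; first by rewrite cards0.
      by apply: leq_trans (leq_card_setU _ _).1 _; rewrite leq_add2l.
    apply: leq_ltn_trans leU _; rewrite -(ltn_pmul2r (m := La)) //.
    rewrite big_distrl /=; apply: leq_ltn_trans (_ : N0 * (s * q * #|F|) < _).
      apply: (@leq_trans (\sum_(i in NN F) s * q * #|F|)); first by apply: leq_sum => I; exact: leR.
      by rewrite sum_nat_const leq_mul2r; apply/orP; right; apply: max_card.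
    have aux x f m : 0 < f -> m * (x * f) < f * (x * m.*2).+1 by nia.
    exact: aux.
  move=> lt; have /subsetPn[e eF eN] : ~~ (F \subset \bigcup_(I in NN F) R I).
    by apply/negP => /subset_leq_card; rewrite leqNgt lt.
  exists e => // I INN; apply: contraR eN => nk; apply/bigcupP; exists I => //.
  by rewrite inE eF.
have kpick (M U : {set T}) : kernel l F M -> #|U| <= q.*2 ->
    exists2 e' : {set T}, e' \in F & M \subset e' /\ [disjoint e' :\: M & U].
  move=> /existsP[Z /and3P[ZF leZ /forall_inP sf]] leU.
  have disj e1 e2 : e1 \in Z -> e2 \in Z -> e1 != e2 -> e1 :&: e2 = M.
    by move=> h1 h2 ne; have /forall_inP/(_ e2 h2) := sf e1 h1; rewrite ne => /eqP.
  have MZ e1 : e1 \in Z -> M \subset e1.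
    move=> h1; have /set0Pn[e2] : Z :\ e1 != set0.
      by rewrite -card_gt0; move: leZ; rewrite (cardsD1 e1 Z) h1 /s; lia.
    by rewrite !inE => /andP[ne h2]; rewrite -(disj e1 e2) ?subsetIl // eq_sym.
  have [/exists_inP[e' e'Z d]|/exists_inPn none] :=
    boolP [exists e' in Z, [disjoint e' :\: M & U]].
    by exists e'; [exact: (subsetP ZF)|split; [exact: MZ|]].
  suff : #|Z| <= #|U| by move: leZ leU; rewrite /s; lia.
  pose f (e' : {set T}) := if [pick x in (e' :\: M) :&: U] is Some x then Some x else None.
  have fP e' : e' \in Z -> exists2 x, f e' = Some x & (x \in e' :\: M) && (x \in U).
    move=> h; rewrite /f; case: pickP => [x|no]; first by rewrite inE; exists x.
    by have /negP[] := none e' h; rewrite -setI_eq0; apply/eqP/setP => x; rewrite [RHS]inE no.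
  have finj : {in Z &, injective f}.
    move=> e1 e2 h1 h2; have [x1 -> /andP[x1e _]] := fP e1 h1; have [x2 -> /andP[x2e _]] := fP e2 h2.
    move=> [E]; apply/eqP; apply: contraTT isT => ne; subst x2.
    move: x1e x2e; rewrite !inE => /andP[xM y1] /andP[_ y2].
    by rewrite -(disj e1 e2) // inE y1 y2 in xM.
  have Sinj : injective (@Some T) by move=> x y [].
  rewrite -(card_in_imset finj) -(card_imset (mem U) Sinj).
  apply/subset_leq_card/subsetP => o /imsetP[e' h ->]; have [x -> /andP[_ xU]] := fP e' h.
  exact: imset_f.
(* Extend the traces of [e] on [I] and [J] to members [e1] and [e2] whose petals avoid [e] and
   [e :|: e1] respectively; then [e1 :&: e2] is the trace of [e] on [I :&: J]. *)
have NNI I J : I \in NN F -> J \in NN F -> I :&: J \in NN F.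
  move=> IN JN.
  have [|e1 e1F [s1 d1]] := kpick _ e (ker I IN); first by rewrite (Fq e eF) -addnn leq_addr.
  have [|e2 e2F [s2 d2]] := kpick _ (e :|: e1) (ker J JN).
    by apply: leq_trans (leq_card_setU _ _).1 _; rewrite (Fq e eF) (Fq e1 e1F) addnn.
  have E : e1 :&: e2 = pr e (I :&: J).
    apply/setP => x; rewrite !inE; apply/andP/and3P => [[x1 x2]|[xe xI xJ]]; last first.
      by rewrite (subsetP s1) ?(subsetP s2) // inE xe.
    have x2' : x \in pr e J.
      apply: contraTT isT => n; have : x \in e2 :\: pr e J by rewrite inE n.
      by move=> /(disjointFr d2); rewrite inE x1 orbT.
    have xe : x \in e by move: x2'; rewrite inE => /andP[].
    have x1' : x \in pr e I.
      apply: contraTT isT => n; have : x \in e1 :\: pr e I by rewrite inE n.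
      by move=> /(disjointFr d1); rewrite xe.
    by move: x1' x2'; rewrite !inE => /andP[_ ->] /andP[_ ->].
  rewrite inE; apply/exists_inP; exists e1 => //; apply/exists_inP; exists e2 => //.
  rewrite E cpr // eqxx andbT; apply/eqP => h.
  have : #|e1 :&: e2| < q.
    rewrite E -(card_in_imset (f := c)); last first.
      by move=> x y; rewrite !inE => /andP[xe _] /andP[ye _]; apply: (Fc e eF).
    by rewrite cpr //; apply: leq_ltn_trans (NNproper I IN); apply/subset_leq_card/subsetIl.
  by rewrite -h setIid Fq ?ltnn.
(* If no type contains [I0], members of [F] are determined by their traces on [I0], so there are at
   most n^l of them, against [big]. *)
have cover (I0 : {set 'I_q}) : #|I0| <= l -> exists2 I, I \in NN F & I0 \subset I.
  move=> leI0; have [/exists_inP//|/exists_inPn none] := boolP [exists I in NN F, I0 \subset I].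
  suff : #|F| <= #|T| ^ l.
    move=> leF; move: big; rewrite ltnNge => /negP[].
    apply: leq_trans leL _; rewrite -mulnA leq_mul2l; apply/orP; right.
    by apply: leq_trans wF _; rewrite mulnC leq_mul2l leF orbT.
  have inj : {in F &, injective (fun e => pr e I0)}.
    move=> e1 e2 h1 h2 E; apply/eqP; apply: contraT => ne.
    have := none (c @: (e1 :&: e2)); rewrite inE => /(_ _)/negP[].
      apply/exists_inP; exists e1 => //; apply/exists_inP; exists e2 => //.
      by rewrite ne eqxx.
    rewrite -(cpr e1 I0 h1); apply/imsetS/subsetP => x xp; rewrite inE.
    by move: (xp); rewrite E; move: xp; rewrite !inE => /andP[-> _] /andP[-> _].
  rewrite -(card_in_imset inj).
  apply: leq_trans (_ : #|[set Q : {set T} | #|Q| == #|I0|]| <= _).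
    apply/subset_leq_card/subsetP => Q /imsetP[e1 h1 ->]; rewrite inE.
    rewrite -(cpr e1 I0 h1) card_in_imset // ?cpr // => x y.
    by rewrite !inE => /andP[xe _] /andP[ye _]; apply: (Fc e1 h1).
  rewrite card_draws.
  have [n0|n0] := posnP #|T|.
    have : q <= #|T| by rewrite -(Fq e eF) max_card.
    by rewrite n0.
  by apply: leq_trans (bin_le_expn _ _) _; rewrite leq_pexp2l.
have NNl I : I \in NN F -> #|I| != l.
  rewrite inE => /exists_inP[e1 h1 /exists_inP[e2 h2 /andP[_ /eqP <-]]].
  rewrite card_in_imset; first by apply: noP; apply/(subsetP L1L)/(subsetP FL1).
  by move=> x y; rewrite !inE => /andP[xe _] /andP[ye _]; apply: (Fc e1 h1).
pose unc (I0 : {set 'I_q}) := [forall I in NN F, ~~ (I0 \subset I)].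
have uncT : unc setT.
  apply/forall_inP => I /NNproper; rewrite ltnNge; apply: contra => /subset_leq_card.
  by rewrite cardsT card_ord.
have [Pm /minsetP[/forall_inP Punc Pmin] _] := minset_exists uncT.
have ltlP : l < #|Pm|.
  by rewrite ltnNge; apply/negP => /cover[I /Punc/negP].
pose Ip p := odflt set0 [pick I in NN F | Pm :\ p \subset I].
have IpP p : p \in Pm -> Ip p \in NN F /\ Pm :\ p \subset Ip p.
  move=> pP; rewrite /Ip; case: pickP => [I /andP[]//|none].
  have /Pmin/(_ (subsetDl _ _))/setP/(_ p) : unc (Pm :\ p).
    by apply/forall_inP => I IN; apply/negP => sub; have := none I; rewrite IN sub.
  by rewrite !inE eqxx pP.
have pIp p : p \in Pm -> p \notin Ip p.
  move=> pP; have [/Punc/negP h sub] := IpP p pP; apply/negP => pI; apply: h.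
  by rewrite -(setD1K pP) subUset sub1set pI.
have [P1 P1P cP1] := exists_subset ltlP.
(* [X0] has at most q - (l + 1) = l points and [P1] has l + 1, as [frankl_katona] requires. The type
   [W] will meet [Pm] in [P1 :\: K] and have #|K| - 1 points outside [Pm], hence l points in all. *)
pose X0 := ~: Pm :&: \bigcap_(p in Pm :\: P1) Ip p.
have [|K [K0 KP1 Kc]] := @frankl_katona _ _ Ip #|X0| P1 X0 (leqnn _).
  rewrite cP1 ltnS; apply: leq_trans (subset_leq_card (subsetIl _ _)) _.
  have Eq : q = l.+1 + l by rewrite /q -addnn.
  by rewrite -(leq_add2l #|Pm|) cardsC card_ord [X in X <= _]Eq leq_add2r ltlP.
pose J := (Pm :\: P1) :|: K.
have JP : J \subset Pm by rewrite subUset subsetDl (subset_trans KP1).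
have J0 : J != set0 by apply: contraNneq K0 => h; rewrite -subset0 -h subsetUr.
pose W := \bigcap_(p in J) Ip p.
have WN : W \in NN F.
  have /set0Pn[p0 p0J] := J0.
  have aux : forall sq : seq 'I_q, {subset sq <= J} ->
      Ip p0 :&: \bigcap_(p <- sq) Ip p \in NN F.
    elim=> [|p sq IH] sub; first by rewrite big_nil setIT; have [] := IpP p0 (subsetP JP _ p0J).
    rewrite big_cons setICA; apply: NNI; last by apply: IH => x xs; apply: sub; rewrite inE xs orbT.
    by have [] := IpP p (subsetP JP _ (sub _ (mem_head _ _))).
  have -> : W = Ip p0 :&: \bigcap_(p <- enum J) Ip p.
    rewrite big_enum /=; apply/esym/setIidPr/subsetP => x /bigcapP; exact.
  by apply: aux => x; rewrite mem_enum.
have /eqP[] := NNl W WN.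
have -> : #|W| = #|W :&: Pm| + #|W :\: Pm| by rewrite cardsID.
have -> : W :\: Pm = X0 :&: \bigcap_(i in K) Ip i.
  by rewrite /W /X0 /J bigcap_setU setDE setIC setIA.
have -> : W :&: Pm = P1 :\: K.
  apply/setP => x; rewrite !inE; apply/andP/andP => [[/bigcapP xW xP]|[xK xP1]].
    have xJ : x \notin J by apply/negP => /xW; apply/negP/pIp.
    by move: xJ; rewrite !inE xP andbT negb_or negbK => /andP[-> ->].
  have xP := subsetP P1P _ xP1; split=> //; apply/bigcapP => p pJ.
  have [_ /subsetP] := IpP p (subsetP JP _ pJ); apply; rewrite !inE xP andbT.
  by apply: contraTneq pJ => <-; rewrite !inE xP1 negb_or.
rewrite cardsD (setIidPr KP1) cP1 -Kc.
by have := subset_leq_card KP1; rewrite cP1 -Kc; clear; set a := #|_|; lia.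
Qed.

Local Open Scope ring_scope.

(** * Densities of predicates on tuples *)

Lemma ler_bool (R : realFieldType) (b1 b2 : bool) : (b1 -> b2) -> b1%:R <= b2%:R :> R.
Proof. by case: b1 => [->|_]; rewrite ?ler0n. Qed.

(** Tuples may repeat entries, so averages factor over concatenation; repetitions have density of
    order 1 / #|T|. *)
HB.lock Definition EE (R : realFieldType) (T : finType) (j : nat) (f : seq T -> R) : R :=
  (\sum_(t : j.-tuple T) f t) / #|T|%:R ^+ j.

Definition prob (R : realFieldType) (T : finType) (j : nat) (P : pred (seq T)) : R :=
  EE j (fun t => (P t)%:R).

HB.lock Definition nearly_half (R : realFieldType) (T : finType) (A : {set T}) (e : R) : bool :=
  1/2 - e <= #|A|%:R / #|T|%:R <= 1/2 + e.

Section Density.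
Variables (R : realFieldType) (T : finType).
Local Notation Pr := (@prob R T).
Implicit Types (f g : seq T -> R) (P Q : pred (seq T)).
Hypothesis T_gt0 : (0 < #|T|)%N.

Let n0 : (0 : R) < #|T|%:R. Proof. by rewrite ltr0n. Qed.
Let nj0 j : (0 : R) < #|T|%:R ^+ j. Proof. exact: exprn_gt0. Qed.

Lemma EE_eq j f g : (forall t, size t = j -> f t = g t) -> EE j f = EE j g.
Proof. by move=> h; rewrite EE.unlock; congr (_ / _); apply: eq_bigr => t _; rewrite h ?size_tuple. Qed.

Lemma EE_le j f g : (forall t, size t = j -> f t <= g t) -> EE j f <= EE j g.
Proof.
move=> h; rewrite EE.unlock ler_pM2r ?invr_gt0 //.
by apply: ler_sum => t _; rewrite h ?size_tuple.
Qed.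

Lemma EED j f g : EE j (fun t => f t + g t) = EE j f + EE j g.
Proof. by rewrite EE.unlock big_split mulrDl. Qed.

Lemma EEZ j a f : EE j (fun t => a * f t) = a * EE j f.
Proof. by rewrite EE.unlock -mulr_sumr mulrA. Qed.

Lemma EE_cst j (a : R) : EE j (fun _ : seq T => a) = a.
Proof.
rewrite EE.unlock sumr_const card_tuple -[a *+ _]mulr_natr natrX mulfK //.
exact: lt0r_neq0.
Qed.

Lemma EE_ge0 j f : (forall t, size t = j -> 0 <= f t) -> 0 <= EE j f.
Proof. by move=> h; rewrite -(EE_cst j 0); apply: EE_le. Qed.

Lemma EE_leC j f a : (forall t, size t = j -> f t <= a) -> EE j f <= a.
Proof. by move=> h; rewrite -[X in _ <= X](EE_cst j a); apply: EE_le. Qed.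

Lemma EE_geC j f a : (forall t, size t = j -> a <= f t) -> a <= EE j f.
Proof. by move=> h; rewrite -[X in X <= _](EE_cst j a); apply: EE_le. Qed.

Lemma EE_cat i j f : EE (i + j) f = EE i (fun s => EE j (fun t => f (s ++ t))).
Proof.
rewrite EE.unlock -mulr_suml -mulrA -invfM -exprD addnC; congr (_ / _).
rewrite pair_big /= addnC.
pose h (p : i.-tuple T * j.-tuple T) : (i + j).-tuple T := [tuple of p.1 ++ p.2].
have hinj : injective h.
  move=> [s t] [s' t'] /(congr1 val) /= /eqP.
  by rewrite eqseq_cat ?size_tuple // => /andP[/eqP/val_inj -> /eqP/val_inj ->].
have hbij : bijective h.
  by apply: inj_card_bij => //; rewrite card_prod !card_tuple expnD.
by rewrite (reindex h) /=; last exact: onW_bij.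
Qed.

Lemma EE_exch i j (f : seq T -> seq T -> R) :
  EE i (fun s => EE j (fun t => f s t)) = EE j (fun t => EE i (fun s => f s t)).
Proof.
rewrite EE.unlock -!mulr_suml exchange_big /= -!mulrA; congr (_ * _).
by rewrite mulrC.
Qed.

Lemma EE0 f : EE 0 f = f [::].
Proof.
rewrite EE.unlock expr0 divr1 (bigD1 [tuple]) //= big1 ?addr0 // => t.
by case/negP; apply/eqP; rewrite [t]tuple0 [RHS]tuple0.
Qed.

Lemma EE1 f : EE 1 f = (\sum_x f [:: x]) / #|T|%:R.
Proof.
rewrite EE.unlock expr1; congr (_ / _).
rewrite (reindex (fun x : T => [tuple x])) //=.
exists (fun t : 1.-tuple T => thead t) => [x _|t _]; first by rewrite theadE.
by case/tupleP: t => x t; apply: val_inj; rewrite /= (tuple0 t) theadE.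
Qed.

Lemma EES j f : EE j.+1 f = (\sum_x EE j (fun t => f (x :: t))) / #|T|%:R.
Proof. by rewrite -add1n EE_cat EE1. Qed.

Lemma EESr j f : EE j.+1 f = EE j (fun s => (\sum_x f (rcons s x)) / #|T|%:R).
Proof.
rewrite -addn1 EE_cat; apply: EE_eq => s _; rewrite EE1.
by congr (_ / _); apply: eq_bigr => x _; rewrite cats1.
Qed.

Lemma Pr_sub j P Q : (forall t, size t = j -> P t -> Q t) -> Pr j P <= Pr j Q.
Proof.
move=> h; apply: EE_le => t /h {}h.
by rewrite ler_nat; case: (P t) h => // ->.
Qed.

Lemma Pr_eq j P Q : (forall t, size t = j -> P t = Q t) -> Pr j P = Pr j Q.
Proof. by move=> h; apply: EE_eq => t /h ->. Qed.

Lemma Pr_ge0 j P : 0 <= Pr j P.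
Proof. by apply: EE_ge0 => t _; rewrite ler0n. Qed.

Lemma Pr_le1 j P : Pr j P <= 1.
Proof. by apply: EE_leC => t _; case: (P t). Qed.

Lemma Pr_or j P Q1 Q2 : (forall t, size t = j -> P t -> Q1 t || Q2 t) ->
  Pr j P <= Pr j Q1 + Pr j Q2.
Proof.
move=> h; rewrite -EED; apply: EE_le => t /h {}h.
by rewrite -natrD ler_nat; case: (P t) h => [/(_ isT)|_]; case: (Q1 t); case: (Q2 t).
Qed.

Lemma Pr_or3 j P Q1 Q2 Q3 : (forall t, size t = j -> P t -> [|| Q1 t, Q2 t | Q3 t]) ->
  Pr j P <= Pr j Q1 + Pr j Q2 + Pr j Q3.
Proof.
move=> h; rewrite -addrA; apply: le_trans (Pr_or (Q2 := fun t => Q2 t || Q3 t) h) _.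
by rewrite lerD2l; apply: Pr_or.
Qed.

Lemma Pr_ex j P : 0 < Pr j P -> exists t, size t = j /\ P t.
Proof.
move=> h; suff /existsP[t Pt] : [exists t : j.-tuple T, P t] by exists t; rewrite size_tuple.
apply: contraLR h; rewrite negb_exists -leNgt => /forallP none.
by apply: EE_leC => t ht; rewrite (negbTE (none (Tuple (introT eqP ht)))).
Qed.

Lemma Pr_cat i j P : Pr (i + j) P = EE i (fun s => Pr j (fun t => P (s ++ t))).
Proof. exact: EE_cat. Qed.

Lemma markov i g a : 0 <= a -> (forall s, size s = i -> 0 <= g s) ->
  a * Pr i (fun s => a <= g s) <= EE i g.
Proof.
move=> a0 g0; rewrite -EEZ; apply: EE_le => s /g0 {}g0.
by have [h|h] := boolP (a <= g s); rewrite ?mulr1 ?mulr0.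
Qed.

Lemma Pr_perm j P (s : 'S_j) :
  \sum_(t : j.-tuple T) (P [tuple tnth t (s i) | i < j])%:R = \sum_(t : j.-tuple T) (P t)%:R :> R.
Proof.
pose h (t : j.-tuple T) := [tuple tnth t (s i) | i < j].
rewrite [RHS](reindex h) //=; apply: onW_bij; apply: injF_bij => t u E.
apply: eq_from_tnth => i; have := congr1 (fun t => tnth t (s^-1%g i)) E.
by rewrite !tnth_mktuple permKV.
Qed.

(** Permuting the positions preserves the density of [Q], and each tuple in [P] has at least one of
    its j! rearrangements in [Q]. *)
Lemma Pr_symm j P Q :
  (forall t, size t = j -> P t -> exists2 t', perm_eq t' t & Q t') ->
  Pr j P <= j`!%:R * Pr j Q.
Proof.
move=> h; rewrite /prob EE.unlock mulrA ler_pM2r ?invr_gt0 //.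
apply: (@le_trans _ _ (\sum_(t : j.-tuple T) \sum_(s : 'S_j) (Q [tuple tnth t (s i) | i < j])%:R)).
  apply: ler_sum => t _; have [Pt|_] := boolP (P t); last by rewrite sumr_ge0 // => s _; rewrite ler0n.
  have [t' pt Qt'] := h t (size_tuple t) Pt.
  have /tuple_permP[s Es] : perm_eq t' t by [].
  rewrite (bigD1 s) //= -Es Qt' lerDl; exact: sumr_ge0.
rewrite exchange_big /= (eq_bigr (fun=> \sum_(t : j.-tuple T) (Q t)%:R)) ?sumr_const.
  by rewrite -[X in X <= _]mulr_natl card_Sn.
by move=> s _; rewrite Pr_perm.
Qed.

Lemma Pr_in (Z : {set T}) : (\sum_x (x \in Z)%:R) / #|T|%:R = #|Z|%:R / #|T|%:R :> R.
Proof.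
congr (_ / _); rewrite -sum1_card natr_sum [RHS]big_mkcond /=.
by apply: eq_bigr => x _; case: (x \in Z).
Qed.

Lemma Pr_hit (Z : {set T}) j : Pr j (has (mem Z)) <= j%:R * (#|Z|%:R / #|T|%:R).
Proof.
elim: j => [|j IH]; first by rewrite /prob EE0 mul0r.
rewrite -[j.+1]add1n Pr_cat.
apply: (@le_trans _ _ (EE 1 (fun s => (has (mem Z) s)%:R + Pr j (has (mem Z))))).
  apply: EE_le => s _; have [h|h] := boolP (has (mem Z) s).
    by apply: le_trans (Pr_le1 _ _) _; rewrite lerDl Pr_ge0.
  by rewrite add0r; apply: Pr_sub => t _; rewrite has_cat (negbTE h).
rewrite EED EE_cst EE1 natrD mulrDl mul1r lerD //.
rewrite -Pr_in le_eqVlt; apply/orP; left; apply/eqP; congr (_ / _); by apply: eq_bigr => x _; rewrite /= orbF.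
Qed.

Lemma Pr_nuniq j : Pr j (fun t : seq T => ~~ uniq t) <= j%:R * j%:R / #|T|%:R.
Proof.
elim: j => [|j IH]; first by rewrite /prob EE0 !mul0r.
rewrite -addn1 Pr_cat.
apply: (@le_trans _ _ (EE j (fun s => (~~ uniq s)%:R + j%:R / #|T|%:R))).
  apply: EE_le => s hs; have [h|h] := boolP (uniq s); last first.
    by apply: le_trans (Pr_le1 _ _) _; rewrite lerDl divr_ge0.
  rewrite add0r; apply: (@le_trans _ _ (Pr 1 (has (mem [set x in s])))).
    apply: Pr_sub => [[|x [|y t]]] //= _; rewrite cat_uniq h /= !orbF andbT negbK inE.
    done.
  apply: le_trans (Pr_hit _ _) _; rewrite mul1r ler_pM2r ?invr_gt0 // ler_nat cardsE -hs.
  exact: card_size.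
rewrite EED EE_cst; apply: le_trans (lerD IH (lexx _)) _.
rewrite -mulrDl ler_pM2r ?invr_gt0 // -!natrM -!natrD ler_nat; nia.
Qed.

(** Choosing entry by entry, at least eta * #|T| vertices of the wanted side are still available
    each time, because at most [size w] are lost to earlier entries. *)
Lemma Pr_typed (A : {set T}) (w : seq bool) (Z : {set T}) (eta : R) : 0 <= eta ->
  eta * #|T|%:R + (size w)%:R <= #|A :\: Z|%:R ->
  eta * #|T|%:R + (size w)%:R <= #|~: A :\: Z|%:R ->
  eta ^+ size w <=
  Pr (size w) (fun t => [&& uniq t, ~~ has (mem Z) t & map (mem A) t == w]).
Proof.
move=> eta0; elim: w Z => [|b w IH] Z; first by move=> _ _; rewrite expr0 /prob EE0.
move=> /= hA hB; rewrite /prob EES exprS.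
pose Ab := (if b then A else ~: A) :\: Z.
have hAb : eta <= #|Ab|%:R / #|T|%:R.
  rewrite ler_pdivlMr //; rewrite /Ab; case: (b).
    by apply: le_trans hA; rewrite lerDl.
  by apply: le_trans hB; rewrite lerDl.
apply: (@le_trans _ _ ((\sum_(x in Ab) eta ^+ size w) / #|T|%:R)).
  rewrite sumr_const -[_ *+ _]mulr_natl mulrAC; apply: ler_wpM2r => //.
  exact: exprn_ge0.
rewrite ler_pM2r ?invr_gt0 // big_mkcond /=; apply: ler_sum => x _.
have [xA|_] := boolP (x \in Ab); last by apply: EE_ge0 => t _; exact: ler0n.
have [xZ xb] : x \notin Z /\ (x \in A) = b.
  by move: xA; rewrite /Ab; case: (b); rewrite !inE => /andP[-> h]; split=> //; exact: negbTE.
apply: (@le_trans _ _ (Pr (size w) (fun t => [&& uniq t, ~~ has (mem (x |: Z)) t & map (mem A) t == w]))).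
  apply: IH.
  - apply: le_trans (_ : #|A :\: Z|%:R - 1 <= _); first by move: hA; rewrite -natr1; lra.
    rewrite lerBlDr natr1 ler_nat.
    have -> : A :\: (x |: Z) = (A :\: Z) :\ x by apply/setP => y; rewrite !inE negb_or andbA.
    by rewrite (cardsD1 x (A :\: Z)) -add1n leq_add2r leq_b1.
  - apply: le_trans (_ : #|~: A :\: Z|%:R - 1 <= _); first by move: hB; rewrite -natr1; lra.
    rewrite lerBlDr natr1 ler_nat.
    have -> : ~: A :\: (x |: Z) = (~: A :\: Z) :\ x by apply/setP => y; rewrite !inE negb_or andbA.
    by rewrite (cardsD1 x (~: A :\: Z)) -add1n leq_add2r leq_b1.
apply: EE_le => t _; apply: ler_bool => /and3P[ut hZ /eqP tw].
rewrite /= ut andbT negb_or xZ xb tw eqxx andbT andTb /=.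
apply/andP; split.
  by apply: contra hZ => xt; apply/hasP; exists x; rewrite // !inE eqxx.
by apply: contra hZ => /hasP[y yt yZ]; apply/hasP; exists y; rewrite //= !inE; apply/orP; right.
Qed.

Definition par (A : {set T}) (t : seq T) := odd (count (mem A) t).

Lemma par_cat A s t : par A (s ++ t) = par A s (+) par A t.
Proof. by rewrite /par count_cat oddD. Qed.

Lemma par_perm A s t : perm_eq s t -> par A s = par A t.
Proof. by rewrite /par => /seq.permP ->. Qed.

(** Whatever the first j entries are, the last one has to lie on a determined side of the
    partition. *)
Lemma Pr_par (A : {set T}) (e : R) j (p : bool) :
  nearly_half A e ->
  1/2 - e <= Pr j.+1 (fun t => par A t == p) <= 1/2 + e.
Proof.
rewrite nearly_half.unlock => hA.
have hB : 1/2 - e <= #|~: A|%:R / #|T|%:R <= 1/2 + e.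
  have -> : #|~: A|%:R / #|T|%:R = 1 - #|A|%:R / #|T|%:R :> R.
    rewrite -[X in X - _](divff (lt0r_neq0 n0)) -mulrBl -(cardsC A) natrD.
    by rewrite addrAC subrr add0r.
  by move: hA => /andP[h1 h2]; apply/andP; split; lra.
have key s : 1/2 - e <= (\sum_x (par A (rcons s x) == p)%:R) / #|T|%:R <= 1/2 + e.
  have [E|E] := eqVneq (par A s) p.
    rewrite (eq_bigr (fun x => (x \in ~: A)%:R)) ?Pr_in // => x _.
    rewrite -cats1 par_cat E /par /= addn0 inE.
    by case: (x \in A); case: (p).
  rewrite (eq_bigr (fun x => (x \in A)%:R)) ?Pr_in // => x _.
  rewrite -cats1 par_cat /par /= addn0 -/(par A s).
  by move: E; case: (x \in A); case: (par A s); case: (p).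
rewrite /prob EESr; apply/andP; split.
  by apply: EE_geC => s _; case/andP: (key s).
by apply: EE_leC => s _; case/andP: (key s).
Qed.

Lemma Pr_all (A : {set T}) a j : #|A|%:R / #|T|%:R <= a -> Pr j (all (mem A)) <= a ^+ j.
Proof.
move=> hA; have a0 : 0 <= a by apply: le_trans hA; rewrite divr_ge0.
elim: j => [|j IH]; first by rewrite /prob EE0 expr0.
rewrite /prob EES exprS.
apply: (@le_trans _ _ ((\sum_(x in A) a ^+ j) / #|T|%:R)).
  rewrite ler_pM2r ?invr_gt0 // [X in _ <= X]big_mkcond /=; apply: ler_sum => x _.
  have [xA|xA] := boolP (x \in A); last first.
    by apply: EE_leC => t _.
  by apply: le_trans IH; apply: Pr_sub => t _; rewrite /= .
rewrite sumr_const -[_ *+ _]mulr_natl mulrAC; apply: ler_wpM2r => //.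
exact: exprn_ge0.
Qed.

End Density.

Local Close Scope ring_scope.

(** * Hamilton cycles as cyclic sequences of blocks *)

Lemma hamilton_of_blocks (T : finType) (H : {set {set T}}) (r : nat) (bs : seq (seq T)) :
  0 < r -> 1 < size bs -> all (fun b => size b == r) bs -> uniq (flatten bs) ->
  size (flatten bs) = #|T| ->
  path.cycle (fun S U => [set x in S ++ U] \in H) bs ->
  has_hamilton_cycle (r + r) r H.
Proof.
move=> r0 sz2 szb ub szT cyc.
have szf (cs : seq (seq T)) : all (fun b => size b == r) cs -> size (flatten cs) = size cs * r.
  elim: cs => //= b cs IH /andP[/eqP sb /IH {}IH].
  by rewrite size_cat sb IH mulSn.
have nE : #|T| = size bs * r by rewrite -szT szf.
have kr : r + r - r = r by rewrite addnK.
exists [set window (r + r) (flatten bs) (j * (r + r - r)) | j : 'I_(#|T| %/ (r + r - r))].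
  split; first by rewrite -{1}(add0n r) ltn_add2r.
    by rewrite kr nE dvdn_mull.
  exists (flatten bs); split=> //; apply: uniq_perm (enum_uniq _) _ => // x.
  have full : [set y in flatten bs] = setT.
    by apply/eqP; rewrite eqEcard subsetT cardsT cardsE (card_uniqP ub) szT leqnn.
  by have := in_setT x; rewrite -full inE mem_enum => ->.
apply/subsetP => W /imsetP[[j /= ltj] _ ->].
rewrite /window kr.
have {}ltj : j < size bs by move: ltj; rewrite kr nE mulnK.
(* Rotating by j * r vertices is rotating by j blocks, so a window is the union of the first two
   blocks of a rotation. *)
have -> : rot (j * r) (flatten bs) = flatten (rot j bs).
  rewrite /rot; rewrite -{1 2}(cat_take_drop j bs) flatten_cat.
  have -> : j * r = size (flatten (take j bs)).
    by rewrite szf ?size_takel ?(ltnW ltj) //; apply/allP => b /mem_take; exact: (allP szb).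
  by rewrite drop_size_cat // take_size_cat // flatten_cat.
have : path.cycle (fun S U => [set x in S ++ U] \in H) (rot j bs) by rewrite rot_cycle.
have : all (fun b => size b == r) (rot j bs).
  by apply/allP => b; rewrite mem_rot; exact: (allP szb).
have : 1 < size (rot j bs) by rewrite size_rot.
case: (rot j bs) => [|S [|U rest]] //= _ /and3P[/eqP sS /eqP sU _] /andP[SU _].
by rewrite catA take_size_cat // size_cat sS sU.
Qed.

(** Local exchange: take a type-preserving injection into [L] with the most acceptable slots. For an
    unacceptable slot [i0], at most D1 + D2 slots of its type are unsuitable partners; swapping with
    any other makes both slots acceptable. *)
Lemma slot_assignment (T : finType) (A L : {set T}) (N D1 D2 : nat)
    (typ : 'I_N -> bool) (ok : 'I_N -> T -> bool) :
  #|L :&: A| = #|[set i | typ i]| -> #|L :\: A| = #|[set i | ~~ typ i]| ->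
  (forall i, #|[set v in L | ~~ ok i v]| <= D1) ->
  (forall v, v \in L -> #|[set i | (typ i == (v \in A)) && ~~ ok i v]| <= D2) ->
  (forall b, D1 + D2 < #|[set i | typ i == b]|) ->
  exists f : 'I_N -> T, [/\ injective f, forall i, f i \in L,
    forall i, (f i \in A) = typ i & forall i, ok i (f i)].
Proof.
move=> cA cB d1 d2 dD.
pose P (f : {ffun 'I_N -> T}) := injectiveb f &&
  [forall i, (f i \in L) && ((f i \in A) == typ i)].
have [f0 Pf0] : exists f0, P f0.
  have ix (B : {set 'I_N}) i : i \in B -> index i (enum B) < #|B|.
    by rewrite cardE index_mem mem_enum.
  have T0 : 'I_N -> T.
    move=> i; have [ti|ti] := boolP (typ i).
      by have /card_gt0P/sigW[x _] : 0 < #|L :&: A|; [rewrite cA; apply/card_gt0P; exists i; rewrite inE|].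
    by have /card_gt0P/sigW[x _] : 0 < #|L :\: A|; [rewrite cB; apply/card_gt0P; exists i; rewrite inE|].
  pose f0 := [ffun i => if typ i then nth (T0 i) (enum (L :&: A)) (index i (enum [set i | typ i]))
                        else nth (T0 i) (enum (L :\: A)) (index i (enum [set i | ~~ typ i]))].
  have f0A i : typ i -> f0 i \in L :&: A.
    by move=> ti; rewrite ffunE ti -mem_enum mem_nth // -cardE cA ix // inE.
  have f0B i : ~~ typ i -> f0 i \in L :\: A.
    by move=> ti; rewrite ffunE (negbTE ti) -mem_enum mem_nth // -cardE cB ix // inE.
  have tf i : (f0 i \in A) = typ i.
    have [ti|ti] := boolP (typ i); first by have := f0A i ti; rewrite inE => /andP[].
    by have := f0B i ti; rewrite inE => /andP[/negbTE].
  exists f0; apply/andP; split; last first.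
    apply/forallP => i; rewrite tf eqxx andbT.
    have [ti|ti] := boolP (typ i); first by have := f0A i ti; rewrite inE => /andP[].
    by have := f0B i ti; rewrite inE => /andP[].
  apply/injectiveP => i j E; have : typ i = typ j by rewrite -!tf E.
  have [ti|ti] := boolP (typ i) => /esym tj.
    move: E; rewrite !ffunE ti tj.
    rewrite (set_nth_default (T0 j)) -?cardE ?cA ?ix ?inE // => /eqP.
    rewrite nth_uniq ?enum_uniq -?cardE ?cA ?ix ?inE // => /eqP E.
    by rewrite -(nth_index i (s := enum [set i | typ i]) (x := i)) ?mem_enum ?inE // E nth_index ?mem_enum ?inE.
  move: E; rewrite !ffunE (negbTE ti) tj.
  rewrite (set_nth_default (T0 j)) -?cardE ?cB ?ix ?inE ?tj // => /eqP.
  rewrite nth_uniq ?enum_uniq -?cardE ?cB ?ix ?inE ?tj // => /eqP E.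
  by rewrite -(nth_index i (s := enum [set i | ~~ typ i]) (x := i)) ?mem_enum ?inE // E nth_index ?mem_enum ?inE ?tj.
pose w (f : {ffun 'I_N -> T}) := #|[set i | ok i (f i)]|.
have [f Pf fmax] : exists2 f, P f & forall f', P f' -> w f' <= w f.
  by exists [arg max_(f > f0 | P f) w f]; case: arg_maxnP.
have /andP[/injectiveP finj /forallP ft] := Pf.
have fL i : f i \in L by case/andP: (ft i).
have fA i : (f i \in A) = typ i by case/andP: (ft i) => _ /eqP.
exists f; split=> // i0; apply/negPn/negP => nok.
pose b1 := [set j | ~~ ok i0 (f j)].
pose b2 := [set j | (typ j == (f i0 \in A)) && ~~ ok j (f i0)].
have [j tj jb] : exists2 j, typ j == typ i0 & j \notin b1 :|: b2.
  have : ~~ ([set j | typ j == typ i0] \subset b1 :|: b2).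
    apply/negP => /subset_leq_card; rewrite leqNgt => /negP[].
    apply: leq_ltn_trans (dD (typ i0)).
    apply: leq_trans (leq_card_setU _ _).1 (leq_add _ (d2 _ (fL i0))).
    apply: leq_trans (d1 i0); rewrite -(card_imset _ finj); apply/subset_leq_card/subsetP => x.
    by case/imsetP => j; rewrite !inE => h ->; rewrite fL.
  by case/subsetPn => j; rewrite inE => h1 h2; exists j.
move: jb; rewrite !inE negb_or negbK fA tj /= negbK => /andP[ok1 ok2].
pose f' := [ffun i => f (tperm i0 j i)].
have Pf' : P f'.
  apply/andP; split.
    by apply/injectiveP => i i'; rewrite !ffunE => /finj/perm_inj.
  apply/forallP => i; rewrite ffunE fL fA /=.
  by case: tpermP => [->|->|//]; rewrite ?eqxx // eq_sym.
have := fmax f' Pf'; rewrite leqNgt => /negP[].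
rewrite /w; apply: proper_card; apply/properP; split.
  apply/subsetP => i; rewrite !inE ffunE; case: tpermP => [->|->|//].
    by move=> h; rewrite h in nok.
  by [].
by exists i0; rewrite inE // ffunE tpermL.
Qed.

Local Open Scope ring_scope.

(** * Right and wrong edges, and block parities along a cycle *)

Section Edges.
Variables (T : finType) (H : {set {set T}}) (A : {set T}) (pi : bool).

(* An edge is right if its parity pi is that of the extremal hypergraph (true for
   Bodd, false for Beven) and wrong otherwise; a miss is an absent right edge. *)
Definition edge (t : seq T) := uniq t && ([set x in t] \in H).
Definition redge (t : seq T) := edge t && (par A t == pi).
Definition wedge (t : seq T) := edge t && (par A t != pi).
Definition miss (t : seq T) := [&& uniq t, par A t == pi & [set x in t] \notin H].

Lemma set_perm (s t : seq T) : perm_eq s t -> [set x in s] = [set x in t].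
Proof. by move=> /perm_mem h; apply/setP => x; rewrite !inE h. Qed.

Lemma edge_perm s t : perm_eq s t -> edge s = edge t.
Proof. by move=> h; rewrite /edge (perm_uniq h) (set_perm h). Qed.

Lemma redge_perm s t : perm_eq s t -> redge s = redge t.
Proof. by move=> h; rewrite /redge (edge_perm h) (par_perm A h). Qed.

Lemma wedge_perm s t : perm_eq s t -> wedge s = wedge t.
Proof. by move=> h; rewrite /wedge (edge_perm h) (par_perm A h). Qed.

Lemma miss_perm s t : perm_eq s t -> miss s = miss t.
Proof. by move=> h; rewrite /miss (perm_uniq h) (set_perm h) (par_perm A h). Qed.

Lemma edgeC (s t : seq T) : edge (s ++ t) = edge (t ++ s).
Proof. by apply: edge_perm; rewrite perm_catC. Qed.

Lemma redgeC (s t : seq T) : redge (s ++ t) = redge (t ++ s).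
Proof. by apply: redge_perm; rewrite perm_catC. Qed.

Lemma missC (s t : seq T) : miss (s ++ t) = miss (t ++ s).
Proof. by apply: miss_perm; rewrite perm_catC. Qed.

Lemma not_miss_edge t : uniq t -> par A t = pi -> ~~ miss t -> edge t.
Proof. by rewrite /miss /edge => -> -> /=; rewrite eqxx /= negbK. Qed.

(* Read along a Hamilton cycle, the block parities start at the end block of a
   given path, continue for L further blocks joined by right edges, close up at
   a block of parity f, and have the total parity prescribed by s. *)
Fixpoint fin (e f s : bool) (L : nat) : bool :=
  if L is L'.+1 then fin (e (+) pi) f (s (+) (e (+) pi)) L'
  else (f == e (+) pi) && ~~ s.

(** The blocks still missing lie between the end and the front of the path, so one of them may as
    well be attached in front. *)
Lemma fin_prepend e f s L : fin e f s L.+1 = fin e (f (+) pi) (s (+) (f (+) pi)) L.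
Proof.
elim: L e f s => [|L IH] e f s.
  by rewrite /=; case: e; case: f; case: s; case: pi.
rewrite -[LHS]/(fin (e (+) pi) f (s (+) (e (+) pi)) L.+1) IH /=.
by rewrite addbAC.
Qed.

(** The number of vertices of [A] in the middle blocks of N gadgets, slots included. An even block
    gets 2 rather than 0, since its slot may be meant for a vertex of [A]. *)
Fixpoint asum (e : bool) (N : nat) : nat :=
  if N is N'.+1 then ((if e then 1 else 2) + asum (e (+) pi) N')%N else 0.

Lemma asum_bounds e N : (N <= asum e N <= N.*2)%N.
Proof. by elim: N e => [|N IH] e //=; have := IH (e (+) pi); case: e => /=; lia. Qed.

Fixpoint eiter (e : bool) (N : nat) : bool :=
  if N is N'.+1 then eiter (e (+) pi) N' else e.

(** The three blocks of a gadget have parities e + pi, e, e + pi: a gadget contributes e to the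
    total and turns e into e + pi. *)
Lemma fin3 e f s N : fin e f s (3 * N) ->
  (s == odd (asum e N)) && (f == eiter e N (+) pi).
Proof.
elim: N e s => [|N IH] e s; first by rewrite muln0 /= => /andP[-> /negbTE ->].
rewrite mulnS -[(3 + _)%N]/((3 * N).+3) /= => /IH.
have -> : ((e (+) pi) (+) pi) (+) pi = e (+) pi by case: e; case: pi.
case/andP => /eqP E ->; rewrite oddD -E; case: e {E IH}; case: pi; case: s => //=.
Qed.

End Edges.

(** * Membership patterns prescribed for the gadgets *)

Definition pw (w : seq bool) := odd (count id w).

Section Words.
Variables (pi : bool) (r1 : nat).
Hypothesis r1_ge2 : (2 <= r1)%N.
Let r := r1.+1.

(* A pair (b, w) prescribes a gadget: three consecutive blocks, the middle one
   with an open slot for a vertex whose membership in A is b; w is the pattern of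
   membership in A of the other vertices. *)
Fixpoint wfs (e : bool) (ws : seq (bool * seq bool)) : bool :=
  if ws is bw :: ws' then
    [&& size bw.2 == (r + (r1 + r))%N, pw (take r bw.2) == e (+) pi,
        bw.1 (+) pw (take r1 (drop r bw.2)) == e,
        pw (drop r1 (drop r bw.2)) == e (+) pi & wfs (e (+) pi) ws']
  else true.

Definition block (j a : nat) := nseq a true ++ nseq (j - a) false.

Arguments block : simpl never.

Lemma size_block j a : (a <= j)%N -> size (block j a) = j.
Proof. by move=> h; rewrite size_cat !size_nseq subnKC. Qed.

Lemma count_block j a : count id (block j a) = a.
Proof. by rewrite count_cat !count_nseq /= mul1n mul0n addn0. Qed.

(** The middle blocks account for [asum]. The outer blocks of a gadget hold 2 * h0 vertices of [A],
    split evenly or as h0 - 1 and h0 + 1 according to the parity required, whence 1 <= h0 <= r1.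
    Slot types alternate, so about half of the slots are meant for [A]. *)
Lemma exists_words N e h (b : bool) : (N <= h <= N * r1)%N ->
  exists ws : seq (bool * seq bool), [/\ size ws = N, wfs e ws,
    sumn [seq (count id bw.2 + nat_of_bool bw.1)%N | bw : bool * seq bool <- ws] = (h.*2 + asum pi e N)%N &
    count id (unzip1 ws) = (N + b)./2 ].
Proof.
elim: N e h b => [|N IH] e h b; first by rewrite mul0n => /andP[_]; rewrite leqn0 => /eqP ->; exists [::]; case: b.
move=> /andP[h1 h2].
(* The larger of 1 and h - N * r1 leaves a feasible amount for the remaining N gadgets. *)
have [h0 [h0a h0b]] : exists h0, (1 <= h0 <= r1)%N /\ (N <= h - h0 <= N * r1)%N /\ (h0 <= h)%N.
  have [le|gt] := leqP (h - N * r1) 1; first by exists 1%N; move: r1_ge2; nia.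
  by exists (h - N * r1)%N; move: r1_ge2; rewrite mulSn in h2; nia.
have [ws [sz wf sm ct]] := IH (e (+) pi) (h - h0)%N (~~ b) (proj1 h0b).
pose q := e (+) pi.
pose a0 := if odd h0 == q then h0 else h0.-1.
pose a2 := if odd h0 == q then h0 else h0.+1.
pose a1 := if e then 1%N else 2.
have a0r : (a0 <= r)%N by rewrite /a0 /r; case: ifP => _; lia.
have a2r : (a2 <= r)%N by rewrite /a2 /r; case: ifP => _; lia.
have a1r : (a1 - b <= r1)%N by rewrite /a1; case: (e); lia.
have oa0 : odd a0 = q.
  have : odd h0.-1 = ~~ odd h0 by rewrite -[in RHS](prednK (n := h0)) ?(proj1 (andP h0a)) //= negbK.
  by rewrite /a0; case: ifP => [/eqP//|+ ->]; case: (odd h0); case: (q).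
have oa2 : odd a2 = q.
  by rewrite /a2; case: ifP => [/eqP//|] /=; case: (odd h0); case: (q).
exists ((b, block r a0 ++ (block r1 (a1 - b) ++ block r a2)) :: ws); split.
- by rewrite /= sz.
- apply/and5P; split.
  + by rewrite [(_, _).2]/= size_cat size_block // size_cat !size_block.
  + by rewrite [(_, _).2]/= take_size_cat ?size_block // /pw count_block oa0.
  + rewrite [(_, _).2]/= drop_size_cat ?size_block // take_size_cat ?size_block //.
    by rewrite /pw count_block /a1; case: (e); case: (b).
  + rewrite [(_, _).2]/= drop_size_cat ?size_block // drop_size_cat ?size_block //.
    by rewrite /pw count_block oa2.
  + exact: wf.
- rewrite /= sm count_cat count_block count_cat !count_block -/a1.
  have : (a0 + a2 = h0.*2)%N by rewrite /a0 /a2; case: ifP; lia.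
  have : (b <= a1)%N by rewrite /a1; case: (e); case: (b).
  lia.
- by rewrite /= ct; case: (b) => /=; lia.
Qed.

End Words.

(** * Completing a short path of blocks to a Hamilton cycle *)

Section Picking.
Variables (R : realFieldType) (T : finType).
Local Notation Pr := (@prob R T).

Lemma Pr_pick j (P Q1 Q2 Q3 : pred (seq T)) (b1 b2 b3 : R) :
  (0 < #|T|)%N -> Pr j Q1 <= b1 -> Pr j Q2 <= b2 -> Pr j Q3 <= b3 ->
  b1 + b2 + b3 < Pr j P ->
  exists t, [/\ size t = j, P t, ~~ Q1 t, ~~ Q2 t & ~~ Q3 t].
Proof.
move=> T0 h1 h2 h3 lt.
pose S t := [&& P t, ~~ Q1 t, ~~ Q2 t & ~~ Q3 t].
have [|t [st /and4P[? ? ? ?]]] := @Pr_ex R T T0 j S; last by exists t.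
have : Pr j P <= Pr j S + Pr j (fun t => [|| Q1 t, Q2 t | Q3 t]).
  by apply: Pr_or => // t _; rewrite /S; case: (P t); case: (Q1 t); case: (Q2 t); case: (Q3 t).
have := @Pr_or3 R T T0 j (fun t => [|| Q1 t, Q2 t | Q3 t]) Q1 Q2 Q3 (fun t _ h => h).
lra.
Qed.

Definition fresh (Z : {set T}) (t : seq T) := uniq t && ~~ has (mem Z) t.

Lemma Pr_nfresh (Z : {set T}) (x : R) (a j : nat) :
  (0 < #|T|)%N -> 0 < x -> 100 * a%:R <= x * #|T|%:R -> (j <= 3 * a)%N ->
  #|Z|%:R <= x * #|T|%:R -> Pr j (fun t => ~~ fresh Z t) <= 4 * a%:R * x.
Proof.
move=> T0 x0 hn ja hZ.
have n0 : (0 : R) < #|T|%:R by rewrite ltr0n.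
have j3 : (j%:R : R) <= 3 * a%:R by rewrite -natrM ler_nat.
have j0 : (0 : R) <= j%:R by [].
apply: le_trans (@Pr_or R T T0 j _ (fun t => ~~ uniq t) (has (mem Z)) _) _.
  by move=> t _; rewrite /fresh negb_and negbK.
have h1 := Pr_nuniq R T0 j; have h2 := Pr_hit R T0 Z j.
have h3 : #|Z|%:R / #|T|%:R <= x by rewrite ler_pdivrMr.
have h4 : j%:R / #|T|%:R <= 3/100 * x by rewrite ler_pdivrMr //; lra.
have h5 : j%:R * j%:R / #|T|%:R <= j%:R * (3/100 * x).
  by rewrite -mulrA; apply: ler_wpM2l.
have h6 : j%:R * (#|Z|%:R / #|T|%:R) <= j%:R * x by apply: ler_wpM2l.
have h7 : j%:R * x <= 3 * a%:R * x by apply: ler_wpM2r => //; exact: ltW.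
have h8 : 0 <= a%:R * x by rewrite mulr_ge0 // ltW.
lra.
Qed.

End Picking.

Section Completion.
Variables (R : realFieldType) (T : finType) (H : {set {set T}}) (A : {set T}) (pi : bool) (r1 m : nat).
Variables (c x : R).
Let r := r1.+1.
Local Notation n := #|T|.
Local Notation Pr := (@prob R T).
Local Notation edge := (edge H).
Local Notation redge := (redge H A pi).
Local Notation miss := (miss H A pi).
Local Notation par := (par A).
Local Notation fin := (fin pi).

(* Here x is tiny compared with c: a rok tuple can be continued by a right edge,
   a good one forms a right edge with almost every tuple of the right parity. *)
Definition rok (S : seq T) := c <= Pr r (fun t => redge (S ++ t)).
Definition good (S : seq T) := Pr r (fun t => miss (S ++ t)) <= x.

Definition path_ok (F : seq T) (Q : seq (seq T)) :=
  [&& all (fun b => size b == r) (F :: Q), uniq (flatten (F :: Q)) &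
      path (fun S U => edge (S ++ U)) F Q].
(* The m - (size Q).+1 blocks still missing can be joined by right edges only,
   as far as parities are concerned. *)
Definition inv (F : seq T) (Q : seq (seq T)) :=
  fin (par (last F Q)) (par F) (par (flatten (F :: Q)) (+) odd #|A|) (m - (size Q).+1).

(** The cube in [cs_miss] leaves room for Markov's inequality: at most x^2 n vertices are [bad], few
    enough to be absorbed within a path on at most x n vertices. [cs_xrho] makes exceptional tuples
    rarer than tuples with a prescribed pattern. In [cs_n2], N stands for the number of gadgets. *)
Record completion_setting : Prop := CompletionSetting {
  cs_r1 : (2 <= r1)%N;
  cs_x : 0 < x;
  cs_xc : 80 * r%:R * x <= c;
  cs_c : c <= 1/4;
  cs_xrho : 100 * x <= (1 / (10 * r%:R)) ^+ (r + (r1 + r));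
  cs_A : nearly_half A x;
  cs_miss : Pr (r + r) miss <= x ^+ 3;
  cs_vertex : forall v p,
    c <= Pr r1 (fun y => [&& uniq (v :: y), par (v :: y) == p & rok (v :: y)]);
  cs_n1 : 100 * r%:R <= x * n%:R;
  cs_n2 : forall N, (n <= 4 * r * N)%N -> (n ^ 16 < 2 ^ N)%N;
  cs_m : n = (r * m)%N
}.

Hypothesis cs : completion_setting.

Lemma r1_ge2 : (2 <= r1)%N. Proof. by case: cs. Qed.
Lemma x_gt0 : 0 < x. Proof. by case: cs. Qed.
Lemma x_c : 80 * r%:R * x <= c. Proof. by case: cs. Qed.
Lemma c_le : c <= 1/4. Proof. by case: cs. Qed.
Lemma x_rho : 100 * x <= (1 / (10 * r%:R)) ^+ (r + (r1 + r)). Proof. by case: cs. Qed.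
Lemma hA : nearly_half A x. Proof. by case: cs. Qed.
Lemma hmiss : Pr (r + r) miss <= x ^+ 3. Proof. by case: cs. Qed.
Lemma hv v p : c <= Pr r1 (fun y => [&& uniq (v :: y), par (v :: y) == p & rok (v :: y)]).
Proof. by case: cs. Qed.
Lemma hn1 : 100 * r%:R <= x * n%:R. Proof. by case: cs. Qed.
Lemma hn2 N : (n <= 4 * r * N)%N -> (n ^ 16 < 2 ^ N)%N. Proof. by case: cs => *; auto. Qed.
Lemma hm : n = (r * m)%N. Proof. by case: cs. Qed.

Let y := 4 * r%:R * x.
Lemma y_c : 20 * y <= c. Proof. by apply: le_trans x_c; rewrite /y; set a := r%:R; lra. Qed.
Lemma r_ge3 : (3 : R) <= r%:R. Proof. by rewrite (ler_nat _ 3) ltnS r1_ge2. Qed.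
Lemma x_small : 960 * x <= 1. Proof. by have := x_c; have := x_gt0; have := c_le; have := r_ge3; nra. Qed.
Lemma x_le_y : 12 * x <= y. Proof. by rewrite /y; have := r_ge3; have := x_gt0; nra. Qed.
Lemma T_gt0 : (0 < n)%N.
Proof.
rewrite lt0n; apply/eqP => h; have := hn1; rewrite h mulr0; have := r_ge3; lra.
Qed.
Lemma n_gt0 : (0 : R) < n%:R. Proof. by rewrite ltr0n T_gt0. Qed.
#[local] Hint Resolve T_gt0 n_gt0 x_gt0 : core.

Lemma Pr_bad_tuple : Pr r (fun t => ~~ good t) <= x.
Proof.
have h : x * Pr r (fun t => x <= Pr r (fun u => miss (t ++ u))) <= x ^+ 3.
  apply: le_trans hmiss; rewrite Pr_cat //; apply: markov => //; first exact: ltW.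
  by move=> s _; exact: Pr_ge0.
have h2 : Pr r (fun t => ~~ good t) <= Pr r (fun t => x <= Pr r (fun u => miss (t ++ u))).
  by apply: Pr_sub => // t _; rewrite /good -ltNge => /ltW.
have := x_small; have := x_gt0; move: h; rewrite exprS ler_pM2l // expr2 => h.
by nra.
Qed.

Definition bad (v : T) := x < Pr (r1 + r) (fun t => miss (v :: t)).

Lemma card_bad : #|[set v | bad v]|%:R <= x ^+ 2 * n%:R.
Proof.
have : (\sum_v Pr (r1 + r) (fun t => miss (v :: t))) / n%:R <= x ^+ 3.
  by apply: le_trans hmiss; rewrite -[(r + r)%N]/((r1 + r).+1) /prob EES.
rewrite ler_pdivrMr // => h.
have h2 : #|[set v | bad v]|%:R * x <= \sum_v Pr (r1 + r) (fun t => miss (v :: t)).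
  rewrite (bigID (fun v => bad v)) /= -[X in X <= _]addr0; apply: lerD; last first.
    by apply: sumr_ge0 => v _; exact: Pr_ge0.
  rewrite -sum1_card natr_sum mulr_suml.
  under [X in _ <= X]eq_bigl => v do rewrite -(in_set bad).
  apply: ler_sum => v; rewrite inE mul1r; exact: ltW.
rewrite -(ler_pM2r x_gt0); apply: le_trans h2 (le_trans h _).
by rewrite [X in _ <= X]mulrAC -exprSr.
Qed.

Lemma size_flatten_ok (Q : seq (seq T)) : all (fun b => size b == r) Q ->
  size (flatten Q) = (size Q * r)%N.
Proof. by elim: Q => //= b Q IH /andP[/eqP sb /IH h]; rewrite size_cat sb h mulSn. Qed.

Lemma path_ok_size F Q : path_ok F Q -> size (flatten (F :: Q)) = ((size Q).+1 * r)%N.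
Proof. by case/and3P => /size_flatten_ok ->. Qed.

Lemma flatten_rcons_cons (F : seq T) Q S : flatten (F :: rcons Q S) = flatten (F :: Q) ++ S.
Proof. by rewrite /= flatten_rcons catA. Qed.

Lemma append F Q S : path_ok F Q -> inv F Q -> ((size Q).+1 < m)%N -> size S = r ->
  fresh [set z in flatten (F :: Q)] S -> par S = par (last F Q) (+) pi ->
  edge (last F Q ++ S) -> path_ok F (rcons Q S) /\ inv F (rcons Q S).
Proof.
move=> /and3P[sz un pth] iv ltm sS /andP[uS hS] pS eS; split.
  apply/and3P; split.
  - by rewrite -rcons_cons all_rcons sS eqxx.
  - rewrite flatten_rcons_cons cat_uniq un uS andbT /=.
    by apply: contra hS => /hasP[z zS zF]; apply/hasP; exists z; rewrite // !inE.
  - by rewrite rcons_path pth.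
move: iv; rewrite /inv size_rcons last_rcons flatten_rcons_cons par_cat.
have -> : (m - (size Q).+1 = (m - (size Q).+2).+1)%N by clear -ltm; lia.
by rewrite /= -pS addbAC.
Qed.

Lemma last_fresh F Q S : path_ok F Q -> fresh [set z in flatten (F :: Q)] S ->
  uniq (last F Q ++ S) /\ size (last F Q) = r.
Proof.
move=> /and3P[/allP sz un _] /andP[uS hS].
have lin : last F Q \in F :: Q by exact: mem_last.
split; last by apply/eqP/sz.
have : subseq (last F Q) (flatten (F :: Q)).
  elim: (F :: Q) lin => //= b Q' IH; rewrite inE => /orP[/eqP <-|/IH h].
    by rewrite prefix_subseq.
  by apply: subseq_trans h _; exact: suffix_subseq.
move=> sub; rewrite cat_uniq uS (subseq_uniq sub un) andbT /=.
apply: contra hS => /hasP[z zS zF]; apply/hasP; exists z; rewrite // !inE.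
exact: (mem_subseq sub).
Qed.

Lemma used_le F Q a : path_ok F Q -> r%:R * ((size Q).+1 + a)%:R <= x * n%:R ->
  #|[set z in flatten (F :: Q)]|%:R + r%:R * a%:R <= x * n%:R /\ ((size Q).+1 + a < m)%N.
Proof.
move=> pok h; split.
  apply: le_trans h; rewrite cardsE natrD mulrDr lerD2r -natrM ler_nat.
  by apply: leq_trans (card_size _) _; rewrite (path_ok_size pok) mulnC.
have : (r * ((size Q).+1 + a))%:R < n%:R :> R.
  rewrite natrM; apply: le_lt_trans h _; have := x_small; have := n_gt0; nra.
by rewrite ltr_nat hm ltn_mul2l => /andP[].
Qed.

Lemma nfresh j (Z : {set T}) : (j <= 3 * r)%N -> #|Z|%:R <= x * n%:R ->
  Pr j (fun t => ~~ fresh Z t) <= y.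
Proof. by move=> hj hZ; exact: Pr_nfresh hn1 hj hZ. Qed.

Lemma le_r : (r <= 3 * r)%N. Proof. by rewrite leq_pmull. Qed.
Lemma le_r1 : (r1 <= 3 * r)%N. Proof. by rewrite /r; lia. Qed.

Lemma append_filler F Q : path_ok F Q -> inv F Q -> good (last F Q) ->
  r%:R * ((size Q).+1 + 1)%:R <= x * n%:R ->
  exists S, [/\ path_ok F (rcons Q S), inv F (rcons Q S) & good S].
Proof.
move=> pok iv gE hs; have [hu ltm] := used_le pok hs.
set Z := [set z in flatten (F :: Q)] in hu.
have hZ : #|Z|%:R <= x * n%:R by apply: le_trans hu; rewrite lerDl mulr_ge0.
have [h1 h2] := andP (Pr_par T_gt0 r1 (par (last F Q) (+) pi) hA).
have [|S [sS /eqP pS nm gS fS]] := Pr_pick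
  (P := fun t => par t == par (last F Q) (+) pi) T_gt0 gE Pr_bad_tuple (nfresh le_r hZ).
  by apply: lt_le_trans h1; have := y_c; have := x_le_y; have := c_le; have := x_gt0; lra.
move: gS fS; rewrite !negbK => gS fS.
have [uES _] := last_fresh pok fS.
have eS : edge (last F Q ++ S).
  by apply: (not_miss_edge uES _ nm); rewrite par_cat pS; case: (par _); case: pi.
have [p1 p2] := append pok iv (leq_ltn_trans (leq_addr _ _) ltm) sS fS pS eS.
by exists S.
Qed.

(** The vertex enters a [rok] block [S] with the parity of the last block. [S] is chosen before its
    neighbours: [T1] and [T2] come from the right edges at [S], where [T1] also joins the good last
    block and [T2] is good, so that the path can be continued. *)
Lemma append_vertex F Q v : path_ok F Q -> inv F Q -> good (last F Q) ->
  r%:R * ((size Q).+1 + 3)%:R <= x * n%:R -> v \notin flatten (F :: Q) ->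
  exists T1 S T2, [/\ path_ok F (rcons (rcons (rcons Q T1) S) T2),
    inv F (rcons (rcons (rcons Q T1) S) T2), good T2 & v \in S].
Proof.
move=> pok iv gE hs vZ; have [hu ltm] := used_le pok hs.
set Z := [set z in flatten (F :: Q)] in hu.
have hr : (r%:R : R) * 3 = r%:R + r%:R + r%:R by ring.
have y0 := y_c; have yx := x_le_y; have cx := c_le; have r3 := r_ge3.
have hZ : #|Z|%:R + (r%:R + r%:R + r%:R) <= x * n%:R by rewrite -hr.
have leU (Z1 Z2 : {set T}) (a b : R) : #|Z1|%:R <= a -> #|Z2|%:R <= b -> #|Z1 :|: Z2|%:R <= a + b :> R.
  move=> h1 h2; apply: le_trans (lerD h1 h2); rewrite -natrD ler_nat.
  exact: leq_of_leqif (leq_card_setU _ _).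
have les (S : seq T) : size S = r -> #|[set z in S]|%:R <= r%:R :> R.
  by move=> <-; rewrite ler_nat cardsE card_size.
have P0 : Pr r1 (fun _ => false) <= 0 :> R by apply: EE_leC.
have P0r : Pr r (fun _ => false) <= 0 :> R by apply: EE_leC.
pose e := par (last F Q).
have hZv : #|v |: Z|%:R <= x * n%:R.
  apply: le_trans (leU [set v] Z 1 _ _ (lexx _)) _; first by rewrite cards1.
  by have := r_ge3; move: hZ; lra.
have [|t [st /and3P[ut pt rt] ft _ _]] := Pr_pick
  (P := fun t => [&& uniq (v :: t), par (v :: t) == e & rok (v :: t)]) T_gt0 (nfresh le_r1 hZv) P0 P0.
  by apply: lt_le_trans (hv v e); move: y0 yx; have := x_gt0; lra.
move: ft; rewrite negbK => /andP[_ hy].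
pose S := v :: t; have sS : size S = r by rewrite /= st.
have fS : fresh Z S.
  rewrite /fresh ut /= inE (negbTE vZ) /=; apply: contra hy => /hasP[z zy zZ].
  by apply/hasP; exists z; rewrite //= !inE; apply/orP; right; move: zZ; rewrite /= inE.
have hZ1 : #|Z :|: [set z in S]|%:R <= x * n%:R.
  by apply: le_trans (leU _ _ _ _ (lexx _) (les S sS)) _; move: hZ; lra.
have [|T1 [sT1 /andP[eST1 /eqP pST1] m1 f1 _]] := Pr_pick
  (P := fun t => redge (S ++ t)) T_gt0 gE (nfresh le_r hZ1) P0r.
  by apply: lt_le_trans rt; move: y0 yx; have := x_gt0; lra.
move: f1; rewrite negbK => f1.
have hZ2 : #|(Z :|: [set z in S]) :|: [set z in T1]|%:R <= x * n%:R.
  apply: le_trans (leU _ _ _ _ (lexx _) (les T1 sT1)) _.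
  by have := leU Z [set z in S] _ _ (lexx _) (les S sS); move: hZ; lra.
have [|T2 [sT2 /andP[eST2 /eqP pST2] g2 f2 _]] := Pr_pick
  (P := fun t => redge (S ++ t)) T_gt0 Pr_bad_tuple (nfresh le_r hZ2) P0r.
  by apply: lt_le_trans rt; move: y0 yx; have := x_gt0; lra.
move: f2 g2; rewrite !negbK => f2 g2.
have pS : par S = e by exact/eqP.
have pT1 : par T1 = e (+) pi by rewrite -pST1 par_cat pS addbA addbb.
have pT2 : par T2 = e (+) pi by rewrite -pST2 par_cat pS addbA addbb.
have fT1 : fresh Z T1.
  rewrite /fresh; case/andP: (f1) => -> h /=; apply: contra h => /hasP[z zT zZ]; apply/hasP; exists z => //=.
  by rewrite inE; apply/orP; left.
have [uET1 _] := last_fresh pok fT1.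
have eET1 : edge (last F Q ++ T1).
  by apply: (not_miss_edge uET1 _ m1); rewrite par_cat pT1 -/e; case: (e); case: (pi).
have [|p1 i1] := append pok iv _ sT1 fT1 pT1 eET1; first by move: ltm; clear; lia.
have f1S : fresh [set z in flatten (F :: rcons Q T1)] S.
  rewrite /fresh ut andTb; apply/negP => /hasP[z zS]; rewrite /= inE flatten_rcons catA mem_cat.
  have /andP[_ h] := fS; have /andP[_ h1] := f1.
  case/orP => [zF|zT].
    by move: h => /hasPn/(_ z zS)/negP; apply; rewrite /= inE.
  move: h1 => /hasPn/(_ z zT)/negP; apply; have := zS.
  by rewrite /= !inE => ->; rewrite orbT.
have [|||p2 i2] := append p1 i1 _ sS f1S.
- by rewrite size_rcons; move: ltm; clear; lia.
- by rewrite last_rcons pT1 pS; case: (e); case: (pi).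
- by rewrite last_rcons edgeC.
have f2T : fresh [set z in flatten (F :: rcons (rcons Q T1) S)] T2.
  case/andP: f2 => u2 h2; rewrite /fresh u2 /=; apply: contra h2 => /hasP[z zT].
  rewrite /= inE !flatten_rcons !catA !mem_cat => h; apply/hasP; exists z => //.
  rewrite /= !inE mem_cat; case/orP: h => [/orP[/orP[->|->]|]|]; rewrite ?orbT //.
  - by move=> ->; rewrite orbT.
  - by rewrite inE => ->; rewrite !orbT.
have [|||p3 i3] := append p2 i2 _ sT2 f2T.
- by rewrite !size_rcons; move: ltm; clear; lia.
- by rewrite last_rcons pT2 pS.
- by rewrite last_rcons.
by exists T1, S, T2; split=> //; rewrite inE eqxx.
Qed.

Lemma cover_vertices (vs : seq T) F Q : path_ok F Q -> inv F Q -> good (last F Q) ->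
  r%:R * ((size Q).+1 + 3 * size vs)%:R <= x * n%:R ->
  exists Q', [/\ path_ok F Q', inv F Q', good (last F Q'),
    {subset flatten (F :: Q) ++ vs <= flatten (F :: Q')} &
    (size Q <= size Q' <= size Q + 3 * size vs)%N].
Proof.
elim: vs F Q => [|v vs IH] F Q pok iv gE hs.
  by exists Q; split=> //; rewrite ?cats0 // muln0 addn0 leqnn.
suff [Q1 [p1 i1 g1 [sub1 v1] s1]] : exists Q1, [/\ path_ok F Q1, inv F Q1, good (last F Q1),
   {subset flatten (F :: Q) <= flatten (F :: Q1)} /\ v \in flatten (F :: Q1) & (size Q <= size Q1 <= size Q + 3)%N].
  have [|Q' [p2 i2 g2 sub2 s2]] := IH F Q1 p1 i1 g1.
    apply: le_trans hs; rewrite ler_wpM2l // ler_nat /=; clear -s1; lia.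
  exists Q'; split=> //; last by clear -s1 s2; move: s1 s2 => /=; lia.
  move=> z; rewrite mem_cat inE => /or3P[h|/eqP->|h]; apply: sub2; rewrite mem_cat.
  - by rewrite (sub1 z h).
  - by rewrite v1.
  - by rewrite h orbT.
have [vZ|vZ] := boolP (v \in flatten (F :: Q)); first by exists Q; split; rewrite ?leqnn ?leq_addr //; split.
have [|T1 [S [T2 [p i g vS]]]] := append_vertex pok iv gE _ vZ.
  apply: le_trans hs; rewrite ler_wpM2l // ler_nat /=; clear; lia.
exists (rcons (rcons (rcons Q T1) S) T2); split=> //.
- by rewrite last_rcons.
- split; last by rewrite /= !flatten_rcons !mem_cat vS !orbT.
  by move=> z; rewrite /= !flatten_rcons !mem_cat => /orP[->|->]; rewrite ?orbT.
- by rewrite !size_rcons; clear; lia.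
Qed.

Lemma append_fillers j F Q : path_ok F Q -> inv F Q -> good (last F Q) ->
  r%:R * ((size Q).+1 + j)%:R <= x * n%:R ->
  exists Q', [/\ path_ok F Q', inv F Q', good (last F Q'),
    {subset flatten (F :: Q) <= flatten (F :: Q')} & size Q' = (size Q + j)%N].
Proof.
elim: j Q => [|j IH] Q pok iv gE hs; first by exists Q; split=> //; rewrite addn0.
have [|S [p1 i1 gS]] := append_filler pok iv gE.
  by apply: le_trans hs; rewrite ler_wpM2l // ler_nat; clear; lia.
have [||Q' [p2 i2 g2 sub s2]] := IH (rcons Q S) p1 i1; rewrite ?last_rcons //.
  by apply: le_trans hs; rewrite ler_wpM2l // ler_nat size_rcons; clear; lia.
exists Q'; split=> //; last by rewrite s2 size_rcons; clear; lia.
by move=> z h; apply: sub; rewrite /= flatten_rcons catA mem_cat -[_ ++ _]/(flatten (F :: Q)) h.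
Qed.

(** * Gadgets with slots *)

Definition T0 (g : seq T) := take r g.
Definition S0 (g : seq T) := take r1 (drop r g).
Definition T2 (g : seq T) := drop r1 (drop r g).
Local Notation gsize := (r + (r1 + r))%N.

Definition fail (v : T) (g : seq T) :=
  miss (T0 g ++ v :: S0 g) || miss ((v :: S0 g) ++ T2 g).

Lemma parts (a b d : seq T) : size a = r -> size b = r1 ->
  [/\ T0 (a ++ b ++ d) = a, S0 (a ++ b ++ d) = b & T2 (a ++ b ++ d) = d].
Proof.
move=> sa sb; rewrite /T0 /S0 /T2 take_size_cat // drop_size_cat //.
by rewrite take_size_cat // drop_size_cat.
Qed.

Lemma EE3 (f : seq T -> R) :
  EE gsize f = EE r (fun a => EE r1 (fun b => EE r (fun d => f (a ++ b ++ d)))).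
Proof.
rewrite EE_cat //; apply: EE_eq => a _; rewrite EE_cat //.
Qed.

Lemma Pr_T0 P : Pr gsize (fun g => P (T0 g)) = Pr r P.
Proof.
rewrite /prob EE3; apply: EE_eq => a sa.
rewrite -[RHS](EE_cst T_gt0 r1); apply: EE_eq => b sb.
rewrite -[RHS](EE_cst T_gt0 r); apply: EE_eq => d _.
by have [-> _ _] := parts d sa sb.
Qed.

Lemma Pr_T2 P : Pr gsize (fun g => P (T2 g)) = Pr r P.
Proof.
rewrite /prob EE3 -[RHS](EE_cst T_gt0 r); apply: EE_eq => a sa.
rewrite -[RHS](EE_cst T_gt0 r1); apply: EE_eq => b sb.
by apply: EE_eq => d _; have [_ _ ->] := parts d sa sb.
Qed.

Lemma fail_le v : Pr gsize (fail v) <= 2 * Pr (r1 + r) (fun t => miss (v :: t)).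
Proof.
apply: le_trans (@Pr_or R T T_gt0 gsize _ (fun g => miss (T0 g ++ v :: S0 g))
  (fun g => miss ((v :: S0 g) ++ T2 g)) (fun g _ h => h)) _.
have -> : Pr gsize (fun g => miss (T0 g ++ v :: S0 g)) = Pr (r1 + r) (fun t => miss (v :: t)).
  rewrite /prob EE3 EE_cat // EE_exch; apply: EE_eq => b sb; apply: EE_eq => a sa.
  rewrite -[RHS](EE_cst T_gt0 r); apply: EE_eq => d _.
  by have [-> -> _] := parts d sa sb; rewrite missC.
have -> : Pr gsize (fun g => miss ((v :: S0 g) ++ T2 g)) = Pr (r1 + r) (fun t => miss (v :: t)).
  rewrite /prob EE3 -[RHS](EE_cst T_gt0 r); apply: EE_eq => a sa.
  rewrite EE_cat //; apply: EE_eq => b sb; apply: EE_eq => d sd.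
  by have [_ -> ->] := parts d sa sb.
by lra.
Qed.

Lemma EE_sum (I : finType) (P : pred I) j (f : I -> seq T -> R) :
  EE j (fun t => \sum_(i | P i) f i t) = \sum_(i | P i) EE j (f i).
Proof.
by rewrite EE.unlock exchange_big /= mulr_suml.
Qed.

Lemma sum_miss : \sum_v Pr (r1 + r) (fun t => miss (v :: t)) <= x ^+ 3 * n%:R.
Proof.
rewrite -ler_pdivrMr //; apply: le_trans hmiss.
by rewrite -[(r + r)%N]/((r1 + r).+1) /prob EES.
Qed.

(* The weight phi of a vertex is 2 to the number of gadgets it cannot enter so
   far; a random gadget multiplies the total weight by at most 33/32. *)
Lemma gadget_step (E F : seq T) (Z : {set T}) (w : seq bool) (phi : T -> R) :
  good E -> good F -> size w = gsize -> (forall v, 0 <= phi v) ->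
  1 / (10 * r%:R) * n%:R + gsize%:R <= #|A :\: Z|%:R :> R ->
  1 / (10 * r%:R) * n%:R + gsize%:R <= #|~: A :\: Z|%:R :> R ->
  exists g, [/\ size g = gsize, fresh Z g, map (mem A) g = w, good (T2 g) &
    [/\ ~~ miss (E ++ T0 g), ~~ miss (F ++ T2 g),
      #|[set v | fail v g]|%:R <= 2 * x ^+ 2 * n%:R &
      \sum_(v | ~~ bad v) phi v * (fail v g)%:R <= 1/32 * \sum_(v | ~~ bad v) phi v]].
Proof.
move=> gE gF sw phi0 hA1 hB1.
have eta0 : 0 <= 1 / (10 * r%:R) :> R by rewrite divr_ge0 ?mulr_ge0.
have := @Pr_typed R T T_gt0 A w Z _ eta0; rewrite sw => /(_ hA1 hB1) typ.
set Phi := \sum_(v | ~~ bad v) phi v.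
pose f1 (g : seq T) : R := \sum_v (fail v g)%:R.
have f1E g : f1 g = #|[set v | fail v g]|%:R.
  rewrite /f1 -sum1_card natr_sum [RHS]big_mkcond /=; apply: eq_bigr => v _.
  by rewrite inE; case: (fail v g).
pose f2 (g : seq T) : R := \sum_(v | ~~ bad v) phi v * (fail v g)%:R.
have x3 := x_gt0.
have xn : 0 < 2 * x ^+ 2 * n%:R by rewrite !mulr_gt0 ?exprn_gt0.
have B1 : Pr gsize (fun g => miss (E ++ T0 g) || miss (F ++ T2 g)) <= x + x.
  apply: le_trans (@Pr_or R T T_gt0 gsize _ _ _ (fun g _ h => h)) _.
  by rewrite (Pr_T0 (fun t => miss (E ++ t))) (Pr_T2 (fun t => miss (F ++ t))) lerD.
have B2 : Pr gsize (fun g => ~~ good (T2 g) || (2 * x ^+ 2 * n%:R <= f1 g)) <= x + x.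
  apply: le_trans (@Pr_or R T T_gt0 gsize _ _ _ (fun g _ h => h)) _.
  rewrite (Pr_T2 (fun t => ~~ good t)) lerD ?Pr_bad_tuple //.
  rewrite -(ler_pM2l xn); apply: le_trans (markov T_gt0 (ltW xn) _) _.
    by move=> g _; apply: sumr_ge0.
  rewrite EE_sum; apply: (@le_trans _ _ (2 * \sum_v Pr (r1 + r) (fun t => miss (v :: t)))).
    by rewrite mulr_sumr; apply: ler_sum => v _; exact: fail_le.
  have := sum_miss; rewrite exprS; set s := \sum_v _; move: (x ^+ 2) => x2; nra.
(* The mean of [f2] is at most 2 * x * Phi, so Markov's inequality at Phi / 32 gives 64 * x. With
   [B1] and [B2] the losses are 68 * x, below the density of tuples with pattern [w]. *)
have B3 : Pr gsize (fun g => 1/32 * Phi < f2 g) <= 64 * x.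
  have Phi0 : 0 <= Phi by apply: sumr_ge0.
  have f2P g : f2 g <= Phi.
    by apply: ler_sum => v _; rewrite ler_piMr // lern1 leq_b1.
  have [Phi_0|PhiN] := eqVneq Phi 0.
    rewrite (@Pr_eq R T gsize _ (fun=> false)); first by rewrite /prob EE_cst // mulr_ge0 // ltW.
    by move=> g _; apply: negbTE; rewrite -leNgt Phi_0 mulr0 -Phi_0.
  have Phip : 0 < 1/32 * Phi by rewrite mulr_gt0 ?divr_gt0 // lt_def PhiN.
  rewrite -(ler_pM2l Phip).
  apply: (@le_trans _ _ (1/32 * Phi * Pr gsize (fun g => 1/32 * Phi <= f2 g))).
    by rewrite ler_pM2l //; apply: Pr_sub => // g _; exact: ltW.
  apply: le_trans (markov T_gt0 (ltW Phip) _) _.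
    by move=> g _; apply: sumr_ge0 => v _; rewrite mulr_ge0.
  rewrite EE_sum.
  apply: (@le_trans _ _ (\sum_(v | ~~ bad v) phi v * (2 * x))).
    apply: ler_sum => v vb; rewrite EEZ ler_wpM2l //.
    apply: le_trans (fail_le v) _; rewrite ler_pM2l //.
    by move: vb; rewrite /bad -leNgt.
  by rewrite -mulr_suml -/Phi; lra.
have [|g [sg /and3P[ug hg /eqP mg] h1 h2 h3]] := Pr_pick T_gt0 B1 B2 B3 (lt_le_trans _ typ).
  by apply: lt_le_trans x_rho; lra.
move: h1 h2 h3; rewrite !negb_or negbK -ltNge -leNgt f1E => /andP[m1 m2] /andP[gg fg] pg.
exists g; split=> //; first by rewrite /fresh ug.
by split=> //; exact: ltW.
Qed.

(** Every gadget, not only the last, is required to join back to [F], so that the cycle can be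
    closed after any of them. *)
Fixpoint chain (F E : seq T) (gs : seq (seq T)) : bool :=
  if gs is g :: gs' then
    [&& size g == gsize, ~~ miss (E ++ T0 g), ~~ miss (F ++ T2 g) & chain F (T2 g) gs']
  else true.

Definition fcount (v : T) (bgs : seq (bool * seq T)) : nat :=
  count (fun p => (p.1 == (v \in A)) && fail v p.2) bgs.

Lemma card_setD_word (B Z : {set T}) (g : seq T) :
  (#|B :\: Z| <= #|B :\: (Z :|: [set z in g])| + count (mem B) g)%N.
Proof.
apply: leq_trans (_ : #|(B :\: (Z :|: [set z in g])) :|: [set z in filter (mem B) g]| <= _)%N.
  apply/subset_leq_card/subsetP => z; rewrite !inE mem_filter /= => /andP[zZ zB].
  by rewrite zB (negbTE zZ) /=; case: (z \in g).
apply: leq_trans (leq_card_setU _ _).1 _.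
by rewrite leq_add2l cardsE -size_filter card_size.
Qed.

(** The weight [phi] is left free for the induction: a gadget doubles the weight of the vertices of
    its slot type that it rejects. The bounds on [A :\: Z] and [~: A :\: Z] keep enough vertices on
    both sides for all later gadgets. *)
Lemma gadgets (ws : seq (bool * seq bool)) : forall (E F : seq T) (Z : {set T}) (phi : T -> R),
  good E -> good F -> all (fun bw => size bw.2 == gsize) ws -> (forall v, 0 <= phi v) ->
  (sumn [seq count id bw.2 | bw <- ws])%:R + (1 / (10 * r%:R) * n%:R + gsize%:R) <= #|A :\: Z|%:R :> R ->
  (sumn [seq count negb bw.2 | bw <- ws])%:R + (1 / (10 * r%:R) * n%:R + gsize%:R) <= #|~: A :\: Z|%:R :> R ->
  exists gs, [/\ map (map (mem A)) gs = unzip2 ws, uniq (flatten gs), ~~ has (mem Z) (flatten gs),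
    chain F E gs & all (fun g => #|[set v | fail v g]|%:R <= 2 * x ^+ 2 * n%:R) gs /\
    \sum_(v | ~~ bad v) phi v * 2 ^+ (fcount v (zip (unzip1 ws) gs)) <=
    (33/32) ^+ (size ws) * \sum_(v | ~~ bad v) phi v].
Proof.
elim: ws => [|[b w] ws IH] E F Z phi gE gF sz phi0 hA1 hB1.
  exists [::]; split=> //; split=> //.
  by rewrite [_ ^+ size _]expr0 mul1r; apply: ler_sum => v _; rewrite expr0 mulr1.
move: sz hA1 hB1; rewrite /= => /andP[/eqP sw sz] hA1 hB1.
have [||g [sg fg mg gT2 [m1 m2 d1 d2]]] := gadget_step (Z := Z) gE gF sw phi0.
- by apply: le_trans hA1; rewrite lerDr.
- by apply: le_trans hB1; rewrite lerDr.
pose phi' v := phi v * (if (b == (v \in A)) && fail v g then 2 else 1).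
have phi'0 v : 0 <= phi' v by rewrite /phi'; case: ifP => _; rewrite mulr_ge0.
have cA : count (mem A) g = count id w by rewrite -mg count_map; apply: eq_count => z.
have cB : count (mem (~: A)) g = count negb w.
  by rewrite -mg count_map; apply: eq_count => z; rewrite /= inE.
have [||gs [mgs ugs hgs cgs [dgs pgs]]] := IH (T2 g) F (Z :|: [set z in g]) phi' gT2 gF sz phi'0.
- have := card_setD_word A Z g; rewrite cA -(ler_nat R) natrD => h.
  by move: hA1 h; rewrite natrD; set u := _%:R * _; lra.
- have := card_setD_word (~: A) Z g; rewrite cB -(ler_nat R) natrD => h.
  by move: hB1 h; rewrite natrD; set u := _%:R * _; lra.
have /andP[ug hg] := fg.
exists (g :: gs); split=> /=.
- by rewrite mg mgs.
- rewrite cat_uniq ug ugs andbT /=; apply: contra hgs => /hasP[z z1 z2].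
  by apply/hasP; exists z => //=; rewrite !inE z2 orbT.
- rewrite has_cat negb_or hg /=; apply: contra hgs => /hasP[z z1 z2].
  by apply/hasP; exists z => //=; rewrite !inE; apply/orP; left.
- by rewrite sg eqxx m1 m2 cgs.
split; first by rewrite d1 dgs.
have -> : \sum_(v | ~~ bad v) phi v * 2 ^+ fcount v ((b, g) :: zip (unzip1 ws) gs) =
          \sum_(v | ~~ bad v) phi' v * 2 ^+ fcount v (zip (unzip1 ws) gs).
  apply: eq_bigr => v _; rewrite /phi' -mulrA; congr (_ * _); rewrite /fcount /=.
  by case: ifP => _; rewrite ?add1n ?exprS ?add0n ?mul1r.
apply: le_trans pgs _; rewrite exprSr -mulrA ler_wpM2l ?exprn_ge0 ?divr_ge0 //.
apply: (@le_trans _ _ (\sum_(v | ~~ bad v) (phi v + phi v * (fail v g)%:R))).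
  apply: ler_sum => v _; rewrite /phi'; case: (fail v g); rewrite ?andbT ?andbF ?mulr1 ?mulr0 ?addr0 //.
  by case: (b == _); have := phi0 v; lra.
by rewrite big_split /=; move: d2; set S1 := \sum_(v | _) _ * _; set S2 := \sum_(v | _) _; lra.
Qed.

Lemma uniq_catl (s t : seq T) : uniq (s ++ t) -> uniq s.
Proof. by rewrite cat_uniq => /andP[]. Qed.

Lemma uniq_catr (s t : seq T) : uniq (s ++ t) -> uniq t.
Proof. by rewrite cat_uniq => /and3P[]. Qed.

Fixpoint build (gs : seq (seq T)) (l : seq T) : seq (seq T) :=
  match gs, l with
  | g :: gs', z :: l' => [:: T0 g, z :: S0 g, T2 g & build gs' l']
  | _, _ => [::]
  end.

Lemma flatten_build gs l : size gs = size l -> perm_eq (flatten (build gs l)) (flatten gs ++ l).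
Proof.
elim: gs l => [|g gs IH] [|z l] //= [/IH h].
have E : T0 g ++ S0 g ++ T2 g = g by rewrite /T0 /S0 /T2 !cat_take_drop.
apply/seq.permP => p; have /seq.permP/(_ p) := h.
have Eg : count p g = (count p (T0 g) + count p (S0 g) + count p (T2 g))%N.
  by rewrite -{1}E !count_cat addnA.
rewrite count_cat => hp; rewrite /= !count_cat /= !count_cat hp Eg; ring.
Qed.

Lemma build_sizes (F E : seq T) gs l : chain F E gs -> size gs = size l ->
  all (fun b => size b == r) (build gs l) /\ size (build gs l) = (3 * size gs)%N.
Proof.
elim: gs l E => [|g gs IH] [|z l] E //= /and4P[/eqP sg _ _ ch] [/(IH l _ ch) [h1 h2]].
rewrite h1 h2 /T0 /S0 /T2 /= !size_take !size_drop sg; split; last by lia.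
have -> : (r < gsize)%N by rewrite /r; lia.
have -> : (gsize - r = r1 + r)%N by rewrite addKn.
have -> : (r1 < r1 + r)%N by rewrite /r; lia.
by rewrite addKn !eqxx.
Qed.

(** By [wfs] the parities of consecutive blocks add up to [pi], so a union that is not a miss is an
    edge; the hypothesis on the parity of [F] makes this true of the closing pair as well. *)
Lemma build_path (F E : seq T) (ws : seq (bool * seq bool)) gs l (e : bool) :
  wfs pi r1 e ws -> map (map (mem A)) gs = unzip2 ws -> chain F E gs ->
  map (mem A) l = unzip1 ws -> size gs = size l ->
  all (fun p => ~~ fail p.2 p.1) (zip gs l) ->
  par E = e -> par F = eiter pi e (size ws) (+) pi ->
  uniq (F ++ E ++ flatten (build gs l)) ->
  (nilp gs ==> ~~ miss (F ++ E)) ->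
  path (fun S U => [set z in S ++ U] \in H) E (rcons (build gs l) F).
Proof.
have parw (g : seq T) : par g = pw (map (mem A) g).
  by rewrite /par /pw count_map; congr odd; apply: eq_count => z.
have closeE S U : uniq (S ++ U) -> par S (+) par U = pi -> ~~ miss (S ++ U) -> [set z in S ++ U] \in H.
  move=> u p nm; have : edge (S ++ U) by apply: (not_miss_edge u _ nm); rewrite par_cat.
  by case/andP.
elim: gs l ws E e => [|g gs IH] [|z l] [|[b w] ws] E e //=.
  move=> _ _ _ _ _ _ pE pF; rewrite cats0 => u nm; rewrite andbT; apply: closeE.
  - by rewrite (perm_uniq (_ : perm_eq _ (F ++ E))) // perm_catC.
  - by rewrite pE pF; case: e {pE pF}; case: pi.
  - by rewrite missC.
case/and5P => /eqP sw /eqP w0 /eqP w1 /eqP w2 wf [mg mgs] /and4P[/eqP sg m1 m2 ch] [zA ml] [sl].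
rewrite /fail negb_or -andbA => /and3P[f1 f2 al] pE pF u _.
have p0 : par (T0 g) = e (+) pi by rewrite parw /T0 map_take mg.
have p1 : par (z :: S0 g) = e.
  rewrite -[z :: _]cat1s par_cat [par (S0 g)]parw /S0 map_take map_drop mg.
  by rewrite /par /= addn0 [z \in A]zA oddb.
have p2 : par (T2 g) = e (+) pi by rewrite parw /T2 !map_drop mg.
have u1 : uniq (E ++ T0 g ++ (z :: S0 g) ++ T2 g ++ flatten (build gs l)).
  by move: u; rewrite cat_uniq => /and3P[].
have uE : uniq (E ++ T0 g) by move: u1; rewrite catA cat_uniq => /and3P[].
have u2 : uniq (T0 g ++ (z :: S0 g) ++ T2 g ++ flatten (build gs l)).
  by move: u1; rewrite cat_uniq => /and3P[].
have u3 : uniq ((z :: S0 g) ++ T2 g ++ flatten (build gs l)).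
  by move: u2; rewrite cat_uniq => /and3P[].
apply/and4P; split.
- by apply: closeE => //; rewrite pE p0; case: (e); case: (pi).
- apply: closeE => //; first by apply: (uniq_catl (t := T2 g ++ flatten (build gs l))); rewrite -catA.
  by rewrite p0 p1; case: (e); case: (pi).
- apply: (closeE (z :: S0 g) (T2 g)) => //; first by apply: (uniq_catl (t := flatten (build gs l))); rewrite -catA.
  by rewrite p1 p2; case: (e); case: (pi).
apply: (IH l ws (T2 g) (e (+) pi)) => //; last by apply/implyP => _.
move: u; rewrite cat_uniq => /and3P[uF hF _].
rewrite cat_uniq uF (uniq_catr u3) andbT andTb.
apply: contra hF => /hasP[t t1 t2]; apply/hasP; exists t => //.
by move: t1; rewrite -cat_cons !mem_cat => ->; rewrite !orbT.
Qed.

Lemma count_ord (S : eqType) (p : pred S) (s : seq S) s0 k : size s = k ->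
  count p s = #|[set i : 'I_k | p (nth s0 s i)]|.
Proof.
move=> <-; rewrite -sum1_count (big_nth s0) big_mkord -sum1_card.
by apply: eq_bigl => i; rewrite inE.
Qed.

Lemma card_word_exact (B Z : {set T}) (g : seq T) : uniq g -> ~~ has (mem Z) g ->
  #|B :\: Z| = (#|~: (Z :|: [set z in g]) :&: B| + count (mem B) g)%N.
Proof.
move=> ug hg; rewrite -(cardsID [set z in g] (B :\: Z)) addnC; congr (_ + _)%N.
  by apply: eq_card => z; rewrite !inE negb_or; case: (z \in Z); case: (z \in g); case: (z \in B).
rewrite -size_filter -(card_uniqP (filter_uniq _ ug)); apply: eq_card => z.
rewrite !inE mem_filter /=; have [zg|] := boolP (z \in g); rewrite ?andbF ?andbT //.
by have /hasPn/(_ z zg) := hg; rewrite /= => ->.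
Qed.

Lemma pow_bound : (33/32 : R) ^+ 16 <= 2.
Proof.
have h1 : (33/32 : R) ^+ 4 <= 1145/1000 by rewrite !exprS expr0; lra.
have h2 : (33/32 : R) ^+ 8 <= 1312/1000.
  rewrite (exprM _ 4 2) expr2; have : 0 <= (33/32 : R) ^+ 4 by rewrite exprn_ge0 ?divr_ge0.
  by move: h1; set u := _ ^+ 4 => h1 h0; nra.
rewrite (exprM _ 8 2) expr2; have : 0 <= (33/32 : R) ^+ 8 by rewrite exprn_ge0 ?divr_ge0.
by move: h2; set u := _ ^+ 8 => h2 h0; nra.
Qed.

(** If N < 8 * f, the 16th power of the hypothesis and (33/32)^16 <= 2 give 2^(2N) <= 2^N n^16,
    against [hn2]. *)
Lemma few_fails (N f : nat) : (n <= 4 * r * N)%N ->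
  2 ^+ f <= (33/32) ^+ N * n%:R :> R -> (8 * f <= N)%N.
Proof.
move=> hN hf; rewrite leqNgt; apply/negP => lt.
have := hn2 hN; rewrite ltnNge => /negP[].
have h : (2 ^+ f) ^+ 16 <= ((33/32) ^+ N * n%:R) ^+ 16 :> R.
  by rewrite lerXn2r ?nnegrE ?exprn_ge0 ?mulr_ge0 ?exprn_ge0 ?divr_ge0.
have h1 : 2 ^+ N * 2 ^+ N <= (2 ^+ f) ^+ 16 :> R.
  by rewrite -exprD -exprM ler_eXn2l ?ltr1n //; lia.
have h2 : ((33/32) ^+ N * n%:R) ^+ 16 <= 2 ^+ N * n%:R ^+ 16 :> R.
  rewrite exprMn ler_wpM2r ?exprn_ge0 // -exprM mulnC exprM.
  by rewrite lerXn2r ?nnegrE ?exprn_ge0 ?divr_ge0 // pow_bound.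
rewrite -(ler_nat R) !natrX -(ler_pM2l (_ : 0 < 2 ^+ N :> R)) ?exprn_gt0 //.
exact: le_trans h1 (le_trans h h2).
Qed.

(* Each vertex left over fits into all but an eighth of the slots of its type, so
   the slots can be filled bijectively. *)
Lemma finish F Q N : path_ok F Q -> inv F Q -> good F -> good (last F Q) ->
  (0 < size Q)%N -> (forall v, bad v -> v \in flatten (F :: Q)) ->
  r%:R * ((size Q).+1)%:R <= x * n%:R -> (m = (size Q).+1 + 3 * N)%N ->
  has_hamilton_cycle (r + r) r H.
Proof.
move=> pok iv gF gE Q0 badZ hs Em.
set Z := [set z in flatten (F :: Q)].
have uFQ : uniq (flatten (F :: Q)) by case/and3P: pok.
have cZ : #|Z| = ((size Q).+1 * r)%N by rewrite cardsE (card_uniqP uFQ) (path_ok_size pok).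
have hZ : #|Z|%:R <= x * n%:R by rewrite cZ natrM mulrC.
have nZ : n = (#|Z| + r * (3 * N))%N by rewrite cZ hm Em; clear; nia.
have [/eqP par1 /eqP par2] : (par (flatten (F :: Q)) (+) odd #|A| == odd (asum pi (par (last F Q)) N)) /\
    (par F == eiter pi (par (last F Q)) N (+) pi).
  by apply/andP/(@fin3 pi); move: iv; rewrite /inv; have -> : (m - (size Q).+1 = 3 * N)%N by clear -Em; lia.
set e := par (last F Q) in par1 par2.
pose al := #|A :\: Z|.
have AZ : #|A :&: Z| = count (mem A) (flatten (F :: Q)).
  rewrite -size_filter -(card_uniqP (filter_uniq _ uFQ)); apply: eq_card => z.
  by rewrite !inE mem_filter.
have Aal : #|A| = (count (mem A) (flatten (F :: Q)) + al)%N by rewrite -AZ cardsID.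
have oal : odd al = odd (asum pi e N) by rewrite -par1 Aal oddD /par addbA addbb.
have [a1 a2] := andP (asum_bounds pi e N).
have rx : 320 * (r%:R * x) <= 1 by have := x_c; have := c_le; set u := r%:R; lra.
have xp := x_gt0; have np := n_gt0; have r3 := r_ge3.
have nN : (1 - x) * n%:R <= 3 * (r%:R * N%:R) :> R.
  have : n%:R = #|Z|%:R + 3 * (r%:R * N%:R) :> R by rewrite {1}nZ natrD !natrM; ring.
  by move: hZ; set u := #|Z|%:R; lra.
have nN' : 3 * (r%:R * N%:R) <= n%:R :> R.
  have : n%:R = #|Z|%:R + 3 * (r%:R * N%:R) :> R by rewrite {1}nZ natrD !natrM; ring.
  by have : 0 <= #|Z|%:R :> R by []; set u := #|Z|%:R; lra.
have N9 : 9 * N%:R <= n%:R :> R.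
  apply: le_trans nN'; have : 0 <= N%:R :> R by []; set u := N%:R; move: r3; set w := r%:R; nra.
have xn : 100 * r%:R <= x * n%:R by exact: hn1.
have x1 : 960 * x <= 1 by exact: x_small.
have := hA; rewrite nearly_half.unlock => /andP[]; rewrite ler_pdivlMr // ler_pdivrMr // => hA1 hA2.
have al1 : (1/2 - 2 * x) * n%:R <= al%:R.
  have : #|A|%:R <= #|Z|%:R + al%:R :> R.
    by rewrite -natrD ler_nat -(cardsID Z A) leq_add2r subset_leq_card // subsetIr.
  by move: hA1 hZ; set u := #|A|%:R; set w := #|Z|%:R; lra.
have al2 : al%:R <= (1/2 + x) * n%:R.
  by apply: le_trans hA2; rewrite ler_nat Aal leq_addl.
have rN0 : 0 <= r%:R * N%:R :> R by rewrite mulr_ge0.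
have al4N : (4 * N <= al)%N.
  rewrite -(ler_nat R) natrM; apply: le_trans al1; move: N9 x1 np; set u := n%:R; nra.
have al2rN : (al + N <= 2 * (r * N))%N.
  rewrite -(ler_nat R) natrD !natrM.
  have h3N : 3 * N%:R <= r%:R * N%:R :> R by rewrite ler_wpM2r.
  move: al2 nN h3N x1 np rN0; set u := n%:R; set w := r%:R * N%:R; nra.
(* By the parity invariant of the path, the surplus over what the middle blocks take is even. *)
have [h Eh] : exists h, al = (h.*2 + asum pi e N)%N.
  exists (al - asum pi e N)./2.
  have le : (asum pi e N <= al)%N by clear -a2 al4N; lia.
  rewrite -[X in X = _](subnK le); congr (_ + _)%N; apply/esym.
  by have := odd_double_half (al - asum pi e N); rewrite oddB // oal addbb.
have [|ws [sws wf sm ct]] := @exists_words pi r1 r1_ge2 N e h false.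
  move: al4N al2rN a1 a2; rewrite Eh /r; clear; nia.
rewrite -Eh addn0 in sm ct.
have szw : all (fun bw : bool * seq bool => size bw.2 == gsize) ws.
  by elim: ws e wf {sws sm ct par1 par2 oal a1 a2 h Eh} => //= bw ws' IH e /and5P[-> _ _ _ /IH ->].
have sumA : (sumn [seq count id bw.2 | bw : bool * seq bool <- ws] + N./2 = al)%N.
  by rewrite -sm -ct; elim: (ws) => //= bw ws' <-; case: (bw.1) => /=; clear; lia.
have sumB : (sumn [seq count id bw.2 | bw : bool * seq bool <- ws] +
             sumn [seq count negb bw.2 | bw : bool * seq bool <- ws] = N * gsize)%N.
  rewrite -sws; elim: (ws) szw => //= bw ws' IH /andP[/eqP s1 /IH s2].
  have : (count id bw.2 + count negb bw.2 = gsize)%N.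
    by rewrite -s1 -(count_predC id); congr (_ + _)%N; apply: eq_count.
  by move: s2; rewrite mulSn; clear; lia.
pose be := #|~: A :\: Z|.
have abN : (al + be = N * gsize + N)%N.
  have := cardsC Z; rewrite nZ => /(@addnI _ _ _).
  have -> : #|~: Z| = (al + be)%N.
    rewrite -(cardsID A (~: Z)); congr (_ + _)%N; apply: eq_card => z;
      by rewrite !inE // andbC.
  by rewrite /r => ->; clear; nia.
(* The roughly N / 2 vertices per side set aside for the slots cover the reserve that [gadgets]
   demands: n is about 3 * r * N, so n / (10 * r) is about 0.3 * N. *)
have Nbig : 1 / (10 * r%:R) * n%:R + gsize%:R + 2 <= 1/2 * N%:R :> R.
  have rp : 0 < r%:R :> R by rewrite ltr0n.
  rewrite -(ler_pM2l (_ : 0 < 10 * r%:R :> R)) ?mulr_gt0 //.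
  have -> : 10 * r%:R * (1 / (10 * r%:R) * n%:R + gsize%:R + 2) = n%:R + 10 * r%:R * (gsize%:R + 2) :> R.
    by field; rewrite lt0r_neq0.
  have g3 : gsize%:R + 2 <= 4 * r%:R :> R by rewrite -natrD -natrM ler_nat /r; clear; lia.
  have h1 : 10 * r%:R * (gsize%:R + 2) <= 40 * (r%:R * r%:R) :> R by move: g3 rp; set u := gsize%:R; set w := r%:R; nra.
  have h2 : 100 * (r%:R * r%:R) <= (r%:R * x) * n%:R :> R.
    by move: xn rp; set w := r%:R; set u := n%:R; nra.
  move: h1 h2 rx nN x1 np; set u := n%:R; set w := r%:R * N%:R; set s := r%:R * x.
  have -> : 10 * r%:R * (1 / 2 * N%:R) = 5 * w by rewrite /w; field.
  by nra.
have half1 : (N <= (N./2).*2.+1)%N by have := odd_double_half N; case: (odd N); clear; lia.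
have half2 : ((N./2).*2 <= N)%N by have := odd_double_half N; clear; lia.
have halfR : 1/2 * N%:R - 1 <= (N./2)%:R :> R.
  by move: half1; rewrite -(ler_nat R) -natr1 -mul2n natrM; lra.
have halfR2 : (N./2)%:R <= 1/2 * N%:R :> R.
  by move: half2; rewrite -(ler_nat R) -mul2n natrM; lra.
have [||gs [mgs ugs hgs cgs [dgs pgs]]] :=
   @gadgets ws (last F Q) F Z (fun=> 1) gE gF szw (fun=> ler01).
- move: sumA => /(congr1 (fun k => k%:R : R)); rewrite natrD -/al => <-.
  by move: Nbig halfR; set u := _ * _; lra.
- have : be%:R = (sumn [seq count negb bw.2 | bw : bool * seq bool <- ws])%:R + (N%:R - (N./2)%:R) :> R.
    have : (be + N./2 = sumn [seq count negb bw.2 | bw : bool * seq bool <- ws] + N)%N.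
      by move: sumA sumB abN; clear; lia.
    by move=> /(congr1 (fun k => k%:R : R)); rewrite !natrD; lra.
  by rewrite -/be => ->; move: Nbig halfR2; set u := _ * _; lra.
have sgs : size gs = N by rewrite -(size_map (map (mem A))) mgs size_map.
have N2 : (2 <= N)%N.
  rewrite -(ler_nat R); move: Nbig; have : 0 <= 1 / (10 * r%:R) * n%:R :> R by rewrite mulr_ge0 ?divr_ge0 ?mulr_ge0.
  by have : 0 <= gsize%:R :> R by []; set u := _ * n%:R; set w := gsize%:R; lra.
have cnt (B : {set T}) p : (forall z, (z \in B) = p (z \in A)) ->
    count (mem B) (flatten gs) = sumn [seq count p bw.2 | bw : bool * seq bool <- ws].
  move=> hB; rewrite count_flatten; congr sumn.
  have -> : [seq count p bw.2 | bw : bool * seq bool <- ws] = map (count p) (map (map (mem A)) gs).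
    by rewrite mgs /unzip2 -map_comp.
  by rewrite -map_comp; apply: eq_map => g; rewrite /= count_map; apply: eq_count => z; rewrite /= hB.
(* The vertices left for the slots; by the choice of the patterns, their numbers inside and outside
   [A] match the slot types. *)
pose L := ~: (Z :|: [set z in flatten gs]).
have sz1 : size (unzip1 ws) = N by rewrite size_map.
have cLA : #|L :&: A| = N./2.
  have := card_word_exact A ugs hgs; rewrite (cnt A id) // -/L -/al; move: sumA; clear; lia.
have cLB : (#|L :\: A| + N./2 = N)%N.
  have := card_word_exact (~: A) ugs hgs; rewrite (cnt (~: A) negb) -/L -/be; last by move=> z; rewrite inE.
  by rewrite setDE; move: sumA sumB abN; clear; lia.
pose typ (i : 'I_N) := nth false (unzip1 ws) i.
pose ok (i : 'I_N) v := ~~ fail v (nth [::] gs i).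
have ctyp : #|[set i | typ i]| = N./2 by rewrite -ct (count_ord _ false sz1).
have ctypN : (#|[set i | ~~ typ i]| + N./2 = N)%N.
  rewrite -ct (_ : #|_| = count negb (unzip1 ws)); last by rewrite (count_ord _ false sz1).
  rewrite -[RHS]sz1 -(count_predC id) addnC; congr (_ + _)%N; exact: eq_count.
have nrN : (n <= 4 * r * N)%N.
  rewrite -(ler_nat R) !natrM -mulrA; move: nN x1 np; set u := n%:R; set w := r%:R * N%:R; nra.
have N8 (k : nat) : (8 * k <= N)%N -> (k <= N %/ 8)%N by clear; lia.
have d1 i : (#|[set v in L | ~~ ok i v]| <= N %/ 8)%N.
  apply: N8; have gi : nth [::] gs i \in gs by rewrite mem_nth // sgs.
  have := allP dgs _ gi => hfl.
  apply: leq_trans (_ : 8 * #|[set v | fail v (nth [::] gs i)]| <= _)%N.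
    rewrite leq_mul2l; apply/orP; right; apply/subset_leq_card/subsetP => v.
    by rewrite !inE /ok negbK => /andP[].
  rewrite -(ler_nat R) natrM; apply: le_trans (ler_wpM2l _ hfl) _ => //.
  have rp : 0 < r%:R :> R by rewrite ltr0n.
  rewrite -(ler_pM2l rp).
  have -> : r%:R * (8 * (2 * x ^+ 2 * n%:R)) = 16 * ((r%:R * x) * (x * n%:R)) by rewrite expr2; ring.
  have h0 : 0 <= x * n%:R by rewrite mulr_ge0 // ltW.
  have : (320 * (r%:R * x)) * (x * n%:R) <= 1 * (x * n%:R) by rewrite ler_wpM2r.
  move: nN x1 np; set u := n%:R; set w := r%:R * N%:R; set s := r%:R * x; nra.
have d2 v : v \in L -> (#|[set i | (typ i == (v \in A)) && ~~ ok i v]| <= N %/ 8)%N.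
  move=> vL; apply: N8.
  have -> : #|[set i | (typ i == (v \in A)) && ~~ ok i v]| = fcount v (zip (unzip1 ws) gs).
    rewrite /fcount (count_ord _ (false, [::]) (_ : size _ = N)); last by rewrite size_zip sz1 sgs minnn.
    apply: eq_card => i; rewrite !inE nth_zip ?sz1 ?sgs //= /ok negbK.
    by rewrite /typ.
  apply: (few_fails nrN).
  have nb : ~~ bad v.
    by move: vL; rewrite !inE negb_or => /andP[vZ _]; apply: contra vZ => /badZ.
  have h1 : 2 ^+ fcount v (zip (unzip1 ws) gs) <= \sum_(v | ~~ bad v) 1 * 2 ^+ fcount v (zip (unzip1 ws) gs) :> R.
    by rewrite (bigD1 v) //= mul1r lerDl; apply: sumr_ge0 => z _; rewrite mul1r exprn_ge0.
  apply: le_trans h1 (le_trans pgs _); rewrite sws ler_wpM2l ?exprn_ge0 ?divr_ge0 //.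
  rewrite sumr_const ler_nat; exact: max_card.
have dD b : (N %/ 8 + N %/ 8 < #|[set i | typ i == b]|)%N.
  case: b.
    have -> : #|[set i | typ i == true]| = N./2 by rewrite -ctyp; apply: eq_card => i; rewrite !inE eqb_id.
    by move: N2; clear; lia.
  have -> : #|[set i | typ i == false]| = #|[set i | ~~ typ i]| by apply: eq_card => i; rewrite !inE eqbF_neg.
  by move: N2 ctypN; clear; lia.
have [||f [finj fL fA fok]] := slot_assignment _ _ d1 d2 dD.
- by rewrite cLA ctyp.
- by move: cLB ctypN; clear; lia.
pose l := [seq f i | i <- enum 'I_N].
have sl : size l = N by rewrite size_map size_enum_ord.
have ml : map (mem A) l = unzip1 ws.
  rewrite -map_comp (eq_map (g := (nth false (unzip1 ws)) \o val)); last by move=> i /=; rewrite fA.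
  by rewrite map_comp val_enum_ord -sz1 map_nth_iota0 // take_size.
have zl : zip gs l = [seq (nth [::] gs (val i), f i) | i <- enum 'I_N].
  have gE' : gs = [seq nth [::] gs (val i) | i <- enum 'I_N].
    by rewrite (map_comp (nth [::] gs) val) val_enum_ord -sgs map_nth_iota0 // take_size.
  by rewrite {1}gE' /l; elim: (enum 'I_N) => //= i s ->.
have al_ok : all (fun p => ~~ fail p.2 p.1) (zip gs l).
  by rewrite zl all_map; apply/allP => i _; exact: fok.
have ul : uniq l by rewrite map_inj_uniq ?enum_uniq.
have lL z : z \in l -> z \in L by case/mapP => i _ ->; exact: fL.
have [szb szb'] := build_sizes cgs (etrans sgs (esym sl)).
pose bs := F :: (Q ++ build gs l).
have pbs : perm_eq (flatten bs) (flatten (F :: Q) ++ (flatten gs ++ l)).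
  rewrite /bs /= flatten_cat catA perm_cat2l; apply: flatten_build; exact: etrans sgs (esym sl).
have ubs : uniq (flatten bs).
  rewrite (perm_uniq pbs) cat_uniq uFQ cat_uniq ugs ul andbT /=; apply/andP; split.
    rewrite has_cat negb_or; apply/andP; split.
      by apply: contra hgs => /hasP[z z1 z2]; apply/hasP; exists z => //=; rewrite inE.
    by apply/hasPn => z /lL; rewrite !inE negb_or => /andP[].
  by apply/hasPn => z /lL; rewrite !inE negb_or => /andP[].
have sbs : size (flatten bs) = n.
  rewrite (perm_size pbs) size_cat (path_ok_size pok) size_cat sl -cZ.
  have -> : size (flatten gs) = (N * gsize)%N.
    rewrite -sgs; elim: (gs) (last F Q) (cgs) => //= g gs' IH E' /and4P[/eqP sg _ _ /IH hh].
    by rewrite size_cat sg hh mulSn.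
  by rewrite [RHS]nZ /r; clear; nia.
have [/allP szFQ _ pthQ] := and3P pok.
apply: (@hamilton_of_blocks T H r bs) => //.
- by rewrite /bs /= size_cat; move: Q0; clear; lia.
- apply/allP => b; rewrite /bs -cat_cons mem_cat => /orP[/szFQ//|]; exact: (allP szb).
rewrite /bs /= rcons_cat cat_path; apply/andP; split.
  by apply: sub_path pthQ => S U /andP[].
apply: (build_path wf mgs cgs ml (etrans sgs (esym sl)) al_ok (erefl _)).
- by rewrite par2 sws.
- apply: subseq_uniq ubs; rewrite /bs /= flatten_cat.
  apply: cat_subseq => //; apply: cat_subseq => //.
  have : last F Q \in Q by case: (Q) Q0 => //= q0 Q' _; exact: mem_last.
  move: (last F Q) => E0; elim: (Q) => //= b Q' IH; rewrite inE => /orP[/eqP <-|/IH hh]; first exact: prefix_subseq.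
  by apply: subseq_trans hh _; exact: suffix_subseq.
- by case: (gs) sgs N2 => // <-.
Qed.

Lemma rok_extend (S : seq T) (Z : {set T}) : rok S -> #|Z|%:R <= x * n%:R ->
  exists U, [/\ size U = r, redge (S ++ U), good U & fresh Z U].
Proof.
move=> rS hZ.
have P0r : Pr r (fun _ => false) <= 0 :> R by apply: EE_leC.
have [|U [sU eU gU fU _]] := Pr_pick (P := fun t => redge (S ++ t)) T_gt0 Pr_bad_tuple (nfresh le_r hZ) P0r.
  by apply: lt_le_trans rS; have := y_c; have := x_le_y; have := x_gt0; lra.
by exists U; split=> //; rewrite -[X in is_true X]negbK.
Qed.

(** Both ends are extended to good blocks, since [rok] promises only a positive proportion of
    continuations. After the bad vertices are absorbed, at most two filler blocks make the number of
    missing blocks divisible by 3, the length of a gadget. The bound 11 accommodates three wrong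
    edges joined by two triples of connecting blocks. *)
Lemma completion (P0 : seq T) (P : seq (seq T)) :
  path_ok P0 P -> rok P0 -> rok (last P0 P) -> inv P0 P -> (size P <= 11)%N ->
  has_hamilton_cycle (r + r) r H.
Proof.
move=> pok r0 rl iv sP.
have xp := x_gt0; have np := n_gt0; have r3 := r_ge3; have n1 := hn1.
have sR : (size P)%:R <= 11 :> R by rewrite (ler_nat _ _ 11).
have [hu1 ltm1] : #|[set z in flatten (P0 :: P)]|%:R + r%:R * 3%:R <= x * n%:R /\ ((size P).+1 + 3 < m)%N.
  apply: used_le pok _; rewrite natrD -natr1; move: sR r3 n1 np xp.
  by set a := (size P)%:R; set b := r%:R; set d := x * _; nra.
have hu1' : #|[set z in flatten (P0 :: P)]|%:R <= x * n%:R by apply: le_trans hu1; rewrite lerDl mulr_ge0.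
have [F [sF eF gF fF]] := rok_extend r0 hu1'.
have [uF hF] := andP fF.
have pF : par F = par P0 (+) pi by case/andP: eF => _; rewrite par_cat => /eqP <-; rewrite addbA addbb.
have pok1 : path_ok F (P0 :: P).
  have /and3P[sz un pth] := pok; apply/and3P; split.
  - by rewrite [all _ _]/= sF eqxx.
  - rewrite -[flatten _]/(F ++ flatten (P0 :: P)) cat_uniq uF un andbT /=.
    apply/hasPn => z zP; apply: contra hF => zF; apply/hasP; exists z => //=.
    by rewrite inE.
  - by rewrite /= pth andbT edgeC; case/andP: eF.
have iv1 : inv F (P0 :: P).
  move: iv; rewrite /inv -[flatten (F :: _)]/(F ++ flatten (P0 :: P)) par_cat pF.
  have -> : (m - (size P).+1 = (m - (size (P0 :: P)).+1).+1)%N by rewrite /=; clear -ltm1; lia.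
  rewrite fin_prepend /=; congr (fin _ _ _ _).
  by rewrite [RHS]addbC [RHS]addbA [RHS]addbC [in RHS]addbC; case: (par P0); case: (pi); case: (odd _); case: (par _).
have [hu2 ltm2] : #|[set z in flatten (F :: P0 :: P)]|%:R + r%:R * 3%:R <= x * n%:R /\ ((size (P0 :: P)).+1 + 3 < m)%N.
  apply: used_le pok1 _; rewrite natrD -natr1 /= -natr1; move: sR r3 n1 np xp.
  by set a := (size P)%:R; set b := r%:R; set d := x * _; nra.
have hu2' : #|[set z in flatten (F :: P0 :: P)]|%:R <= x * n%:R by apply: le_trans hu2; rewrite lerDl mulr_ge0.
have [U [sU eU gU fU]] := rok_extend rl hu2'.
have [|||pok2 iv2] := append pok1 iv1 _ sU fU _ _.
- by move: ltm2; clear; lia.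
- by case/andP: eU => _; rewrite par_cat => /eqP <- /=; rewrite addbA addbb.
- by case/andP: eU.
set Q1 := rcons (P0 :: P) U in pok2 iv2.
have sQ1 : (size Q1 <= 13)%N by rewrite size_rcons /=; clear -sP; lia.
pose vs := enum [set v | bad v].
have svs : (size vs)%:R <= x ^+ 2 * n%:R by rewrite -cardE card_bad.
have big a : (a <= 16)%N -> r%:R * (a + 3 * size vs)%:R <= x * n%:R.
  move=> a16; have aR : a%:R <= 16 :> R by rewrite (ler_nat _ _ 16).
  have rx : 320 * (r%:R * x) <= 1 by have := x_c; have := c_le; set u := r%:R; lra.
  have h1 : r%:R * (size vs)%:R <= (r%:R * x) * (x * n%:R).
    by apply: le_trans (ler_wpM2l _ svs) _; rewrite // expr2; lra.
  have h0 : 0 <= x * n%:R by rewrite mulr_ge0 // ltW.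
  have h2 : 320 * (r%:R * x) * (x * n%:R) <= 1 * (x * n%:R) by rewrite ler_wpM2r.
  have h3 : r%:R * a%:R <= r%:R * 16 :> R by rewrite ler_wpM2l.
  rewrite natrD natrM mulrDr; move: h1 h2 h3 n1.
  by set s := (size vs)%:R; set u := r%:R; set w := x * n%:R; set t := a%:R; lra.
have [||Q2 [pok3 iv3 gE3 sub3 s3]] := @cover_vertices vs F Q1 pok2 iv2; rewrite ?last_rcons //.
  by apply: big; clear -sQ1; lia.
pose j := ((m - (size Q2).+1) %% 3)%N.
have j3 : (j < 3)%N by rewrite ltn_mod.
have hj : r%:R * ((size Q2).+1 + j)%:R <= x * n%:R.
  apply: le_trans (big 16%N _); rewrite // ler_wpM2l // ler_nat; clear -s3 sQ1 j3; lia.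
have [_ ltm3] := used_le pok3 hj.
have [Q3 [pok4 iv4 gE4 sub4 s4]] := append_fillers pok3 iv3 gE3 hj.
have Em : (m = (size Q3).+1 + 3 * ((m - (size Q2).+1) %/ 3))%N.
  have := divn_eq (m - (size Q2).+1) 3; rewrite -/j s4; move: ltm3; clear; lia.
apply: (finish pok4 iv4 gF gE4 _ _ _ Em).
- by rewrite s4; move: s3; rewrite size_rcons; clear; lia.
- move=> v bv; apply/sub4/sub3; rewrite mem_cat; apply/orP; right.
  by rewrite mem_enum inE.
- by move: hj; rewrite s4 addSn.
Qed.

End Completion.

(** * Wrong edges through tuples with few right edges *)

Section Structure.
Variables (R : realFieldType) (T : finType) (H : {set {set T}}) (A : {set T}).
Variables (pi : bool) (r1 m : nat) (x : R).
Let r := r1.+1.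
Local Notation n := #|T|.
Local Notation Pr := (@prob R T).
Local Notation edge := (edge H).
Local Notation redge := (redge H A pi).
Local Notation wedge := (wedge H A pi).
Local Notation miss := (miss H A pi).
Local Notation par := (par A).

(** Bounds the number of rearrangements of the vertices of an edge, the cost of each use of
    [Pr_symm]. *)
Definition fact_cst : R := ((r + r)`!)%:R.
(** Chosen so that 8 * rok_cst is the density 1/8 of suitable right edges through a vertex, divided
    by the cost of rearranging them. *)
Definition rok_cst : R := 1 / (64 * fact_cst).
(** The start 1/8 is the density of wrong edges at an r-set that is not [rok]. After rearrangement,
    the ratio 20 * fact_cst leaves 20 times the next level, against two losses of at most 8 times
    that level in [split_of_link]. *)
Definition level (j : nat) : R := 1/8 * (1 / (20 * fact_cst)) ^+ j.

Local Notation K := fact_cst.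
Local Notation c := rok_cst.
Local Notation rok := (@rok R T H A pi r1 c).
Local Notation good := (@good R T H A pi r1 x).

Record setting : Prop := Setting {
  st_r1 : (2 <= r1)%N;
  st_x : 0 < x;
  st_xc : 80 * r%:R * x <= c;
  st_xrho : 100 * x <= (1 / (10 * r%:R)) ^+ (r + (r1 + r));
  st_xlevel : 4 * K * x <= c * level r1;
  st_A : nearly_half A x;
  st_miss : Pr (r + r) miss <= x ^+ 3;
  st_degree : forall U : seq T, uniq U -> (0 < size U <= r)%N ->
    1/2 - x <= Pr (r - size U + r) (fun t => edge (U ++ t));
  st_vertex : forall v, 1/4 - x <= Pr (r1 + r) (fun t => redge (v :: t));
  st_n1 : 100 * r%:R <= x * n%:R;
  st_n2 : forall N, (n <= 4 * r * N)%N -> (n ^ 16 < 2 ^ N)%N;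
  st_m : n = (r * m)%N
}.

Hypothesis st : setting.

Lemma K_ge1 : 1 <= K. Proof. by rewrite /fact_cst (ler_nat _ 1) fact_gt0. Qed.
Lemma c_gt0 : 0 < c.
Proof. by rewrite divr_gt0 // mulr_gt0 //; apply: lt_le_trans K_ge1. Qed.
Lemma cK : 64 * (c * K) = 1.
Proof. by rewrite /rok_cst; field; rewrite gt_eqF //; apply: lt_le_trans K_ge1. Qed.
Lemma c_small : 64 * c <= 1.
Proof. by have := cK; have := K_ge1; have := c_gt0; nra. Qed.
Lemma sx_gt0 : 0 < x. Proof. by case: st. Qed.
Lemma sr_ge3 : (3 : R) <= r%:R. Proof. by rewrite (ler_nat _ 3) ltnS; case: st. Qed.
Lemma sx_c : 80 * r%:R * x <= c. Proof. by case: st. Qed.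
Lemma sx_c240 : 240 * x <= c.
Proof. by have := sx_c; have := sr_ge3; have := sx_gt0; nra. Qed.
Lemma sT_gt0 : (0 < n)%N.
Proof.
rewrite lt0n; apply/eqP => h; have : 100 * r%:R <= x * n%:R by case: st.
by rewrite h mulr0; have := sr_ge3; lra.
Qed.
#[local] Hint Resolve sT_gt0 sx_gt0 c_gt0 : core.

(** Rearranging such a tuple gives an initial part either parity; a tuple on one side of the
    partition has no such freedom. *)
Definition mixed (t : seq T) := ~~ all (mem A) t && ~~ all (mem (~: A)) t.

Lemma mixed_catr s t : mixed t -> mixed (s ++ t).
Proof. by rewrite /mixed !all_cat !negb_and => /andP[-> ->]; rewrite !orbT. Qed.

Lemma mixed_arrange (t : seq T) i b : mixed t -> (0 < i < size t)%N ->
  exists2 t', perm_eq t' t & par (take i t') = b.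
Proof.
move=> /andP[/allPn[b1 b1t b1A] /allPn[a1 a1t a1A]] /andP[i0 lti].
have {}a1A : a1 \in A by move: a1A; rewrite /= inE negbK.
have {}b1A : b1 \notin A by [].
have ne : b1 != a1 by apply: contraNneq b1A => ->.
pose s := rem b1 (rem a1 t).
have b1t' : b1 \in rem a1 t.
  have : b1 \in a1 :: rem a1 t by rewrite -(perm_mem (perm_to_rem a1t)).
  by rewrite inE (negbTE ne).
have pt : perm_eq t (a1 :: b1 :: s).
  by rewrite (perm_trans (perm_to_rem a1t)) // perm_cons perm_to_rem.
have sz : size t = (size s).+2 by rewrite (perm_size pt).
case: i i0 lti => // i _ lti.
have lei : (i <= size s)%N by rewrite sz in lti; clear -lti; lia.
have tk (z w : T) : take i.+1 (z :: s ++ [:: w]) = z :: take i s.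
  by rewrite /= takel_cat.
have P1 : perm_eq (a1 :: s ++ [:: b1]) t.
  by rewrite perm_sym (perm_trans pt) // perm_cons -cat1s perm_catC.
have P2 : perm_eq (b1 :: s ++ [:: a1]) t.
  by rewrite perm_sym (perm_trans pt) // -[b1 :: s]/([:: b1] ++ s) -[a1 :: _]cat1s perm_catCA /= perm_cons -cat1s perm_catC.
have [E|E] := eqVneq (par (take i.+1 (a1 :: s ++ [:: b1]))) b; first by exists (a1 :: s ++ [:: b1]).
exists (b1 :: s ++ [:: a1]) => //; move: E; rewrite !tk /par /= a1A (negbTE b1A) /=.
by case: (odd _); case: b.
Qed.

Lemma Pr_trivial j : Pr j (fun t => ~~ mixed t) <= 2 * (1/2 + x) ^+ j.
Proof.
have := st_A st; rewrite nearly_half.unlock => /andP[h1 h2].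
have n0 : (0 : R) < n%:R by rewrite ltr0n.
have hB : #|~: A|%:R / n%:R <= 1/2 + x.
  have -> : #|~: A|%:R / n%:R = 1 - #|A|%:R / n%:R :> R.
    rewrite -[X in X - _](divff (lt0r_neq0 n0)) -mulrBl -(cardsC A) natrD.
    by rewrite addrAC subrr add0r.
  by lra.
apply: le_trans (@Pr_or R T sT_gt0 j _ (all (mem A)) (all (mem (~: A))) _) _.
  by move=> t _; rewrite /mixed negb_and !negbK.
by have := Pr_all sT_gt0 j h2; have := Pr_all sT_gt0 j hB; lra.
Qed.

Lemma Pr_trivial_le j i : (i <= j)%N -> (1/2 + x) ^+ j <= (1/2 + x) ^+ i.
Proof.
move=> ij; have := c_small; have := sx_c240; have := c_gt0; have := sx_gt0 => ? ? ? ?.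
by apply: ler_wiXn2l => //; lra.
Qed.

Lemma triv3 : 2 * (1/2 + x) ^+ 3 <= 27/100.
Proof.
have := c_small; have := sx_c240; have := c_gt0; have := sx_gt0 => ? ? ? ?.
have hx : 1/2 + x <= 501/1000 by lra.
have h0 : 0 <= 1/2 + x by lra.
have : (1/2 + x) ^+ 3 <= (501/1000) ^+ 3 by rewrite lerXn2r ?nnegrE //; lra.
by rewrite !exprS expr0; lra.
Qed.

Lemma triv5 : 2 * (1/2 + x) ^+ 5 <= 7/100.
Proof.
have := c_small; have := sx_c240; have := c_gt0; have := sx_gt0 => ? ? ? ?.
have hx : 1/2 + x <= 501/1000 by lra.
have h0 : 0 <= 1/2 + x by lra.
have : (1/2 + x) ^+ 5 <= (501/1000) ^+ 5 by rewrite lerXn2r ?nnegrE //; lra.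
by rewrite !exprS expr0; lra.
Qed.

(** Right edges through [v] have density at least about 1/4, of which at most 7/100 have all other
    vertices on one side. Rearranging the others reaches parity [p] at the cost of [fact_cst]. *)
Lemma vertex_parity v p :
  8 * c <= Pr (r1 + r) (fun t => redge (v :: t) && (par (v :: take r1 t) == p)).
Proof.
have r12 := st_r1 st.
have h1 := st_vertex st v.
have h2 : Pr (r1 + r) (fun t => redge (v :: t)) <=
    Pr (r1 + r) (fun t => redge (v :: t) && mixed t) + Pr (r1 + r) (fun t => ~~ mixed t).
  by apply: Pr_or => // t _; case: (redge _); case: (mixed t).
have h3 := Pr_trivial (r1 + r).
have h4 : (1/2 + x) ^+ (r1 + r) <= (1/2 + x) ^+ 5 by apply: Pr_trivial_le; rewrite /r; clear -r12; lia.
have h5 := triv5.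
have h6 : Pr (r1 + r) (fun t => redge (v :: t) && mixed t) <=
   ((r1 + r)`!)%:R * Pr (r1 + r) (fun t => redge (v :: t) && (par (v :: take r1 t) == p)).
  apply: Pr_symm => // t st' /andP[ht mt].
  have [|t' pt pp] := @mixed_arrange t r1 (p (+) (v \in A)) mt.
    by rewrite st' /r; clear -r12; lia.
  exists t' => //; rewrite (redge_perm _ _ _ (_ : perm_eq _ (v :: t))) ?perm_cons // ht /=.
  by rewrite -[v :: _]cat1s par_cat pp /par /= addn0; case: (v \in A); case: p {pp}.
have h7 : ((r1 + r)`!)%:R <= K by rewrite ler_nat /fact_cst leq_fact // /r; clear; lia.
have P0 := Pr_ge0 R sT_gt0 (r1 + r) (fun t => redge (v :: t) && (par (v :: take r1 t) == p)).
have h8 := ler_wpM2r P0 h7.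
have := cK; have := c_small; have := sx_c240; have := c_gt0; have := sx_gt0; have := K_ge1.
move: h1 h2 h3 h4 h5 h6 h8 P0; set P1 := Pr _ _; set P2 := Pr _ _; set P3 := Pr _ _; set P4 := Pr _ _.
move=> h1 h2 h3 h4 h5 h6 h8 P0 k1 x0 c0 xc cs ck.
have : 1/8 <= K * P4 by lra.
by nra.
Qed.

Lemma completion_of_setting : completion_setting H A pi r1 m c x.
Proof.
have [r12 x0 xc xr _ hA hm _ _ n1 n2 nm] := st.
split=> //; first by have := c_small; lra.
move=> v p; have h := vertex_parity v p.
suff : Pr (r1 + r) (fun t => redge (v :: t) && (par (v :: take r1 t) == p)) <=
    Pr r1 (fun y => [&& uniq (v :: y), par (v :: y) == p & rok (v :: y)]) + c.
  by have := c_gt0; move: h; set u := Pr _ _; set w := Pr _ _; lra.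
rewrite Pr_cat // -[X in _ <= _ + X](EE_cst sT_gt0 r1) -EED; apply: EE_le => // y sy.
case E : [&& _, _ & _].
  by apply: (le_trans (Pr_le1 R sT_gt0 _ _)); rewrite lerDl ltW.
rewrite add0r; have [uy|uy] := boolP (uniq (v :: y)); last first.
  apply: EE_leC => // t st'; rewrite /redge /edge.
  have -> : uniq (v :: y ++ t) = false.
    by apply: contraNF uy; rewrite -cat_cons cat_uniq => /andP[].
  by rewrite ltW.
have [/eqP py|py] := boolP (par (v :: y) == p); last first.
  apply: EE_leC => // t st'; rewrite take_size_cat // (negbTE py) andbF.
  by rewrite ltW.
move: E; rewrite uy py eqxx /= => /negbT; rewrite -ltNge => /ltW h1; apply: le_trans h1.
by apply: Pr_sub => // t _ /andP[].
Qed.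

Lemma good_rok S : good S -> uniq S -> size S = r -> rok S.
Proof.
move=> gS uS sS; rewrite /rok -/r.
have [h1 _] := andP (Pr_par sT_gt0 r1 (par S (+) pi) (st_A st)); rewrite -/r in h1.
have hZ : #|[set z in S]|%:R <= x * n%:R.
  have : #|[set z in S]|%:R <= r%:R :> R by rewrite ler_nat cardsE -sS card_size.
  by have := st_n1 st; have := sr_ge3; set w := x * _; rewrite -/r; lra.
have h2 := Pr_nfresh sT_gt0 sx_gt0 (st_n1 st) (_ : (r <= 3 * r)%N) hZ.
have h3 : Pr r (fun t => par t == par S (+) pi) <=
   Pr r (fun t => redge (S ++ t)) + Pr r (fun t => miss (S ++ t)) + Pr r (fun t => ~~ fresh [set z in S] t).
  apply: Pr_or3 => // t _ /eqP pt.
  have [/andP[ut ht]|] := boolP (fresh _ t); last by rewrite !orbT.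
  have u : uniq (S ++ t).
    rewrite cat_uniq uS ut andbT /=; apply: contra ht => /hasP[z z1 z2].
    by apply/hasP; exists z => //=; rewrite inE.
  have pp : par (S ++ t) == pi by rewrite par_cat pt addbA addbb.
  by rewrite orbF /redge /edge /miss u pp /= andbT orbN.
have h4 : 4 * r%:R * x <= c / 20 by have := sx_c; set u := r%:R; lra.
have {}h2 := h2 (leq_pmull r (isT : 0 < 3)%N).
move: gS h1 h3; rewrite /good -/r; have := c_small; have := sx_c240; have := c_gt0.
by move: h2 h4; set a := Pr r _; set b := Pr r _; set d := Pr r _; set e := Pr _ _; lra.
Qed.

(** The set [U] has r - j vertices; the tuple completes it to a block and supplies a second block.
    Only mixed tuples count, since the edge will be cut again after rearrangement. *)
Definition W (j : nat) (U : seq T) : R := Pr (j + r) (fun t => wedge (U ++ t) && mixed t).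

(** Edges at [S] have density at least about 1/2; right ones have density below [rok_cst], and
    tuples on one side account for at most 27/100. *)
Lemma not_rok_W S : uniq S -> size S = r -> ~~ rok S -> 1/8 <= W 0 S.
Proof.
move=> uS sS; rewrite /rok -/r -ltNge => nr.
have := st_degree st uS; rewrite sS leqnn /= subnn => /(_ isT) h1.
have h2 : Pr (0 + r) (fun t => edge (S ++ t)) <=
   Pr r (fun t => redge (S ++ t)) + W 0 S + Pr r (fun t => ~~ mixed t).
  apply: Pr_or3 => // t _; rewrite /redge /wedge => -> /=.
  by case: (par _ == pi) => //=; case: (mixed t).
have h3 := Pr_trivial r.
have h4 : (1/2 + x) ^+ r <= (1/2 + x) ^+ 3 by apply: Pr_trivial_le; rewrite /r ltnS (st_r1 st).
have h5 := triv3.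
have := c_small; have := sx_c240; have := c_gt0; move: h1 h2 h3 h4 h5 nr.
by rewrite -/r; set a := Pr r _; set b := Pr r _; set d := Pr _ _; set e := W _ _; lra.
Qed.

Lemma W_mono j U : (size U + j = r)%N ->
  Pr j (fun Y => uniq (U ++ Y) && ~~ rok (U ++ Y)) <= 8 * W j U.
Proof.
move=> sj; rewrite /W Pr_cat // -EEZ; apply: EE_le => // Y sY.
have [/andP[u nr]|_] := boolP (_ && _); last by apply: mulr_ge0 => //; exact: Pr_ge0.
have := not_rok_W u _ nr; rewrite size_cat sY sj => /(_ erefl) h.
have h2 : W 0 (U ++ Y) <= Pr r (fun t => wedge (U ++ Y ++ t) && mixed (Y ++ t)).
  apply: Pr_sub => // t _ /andP[]; rewrite -catA => -> /=; exact: mixed_catr.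
move: h h2; set a := W _ _; set b := Pr _ _ => h h2; change (1 <= 8 * b); lra.
Qed.

Definition split_edge (p : bool) := exists S0 S1 : seq T,
  [/\ size S0 = r, size S1 = r, wedge (S0 ++ S1), par S0 = p & rok S0 /\ rok S1].

(** Wrong edges through [s] and [U1] are cut so as to separate [s] from [U1]. Each half then extends
    a set with few wrong edges, so by [W_mono] it rarely fails to be [rok]. *)
Lemma split_of_link j s (U1 : seq T) p : (j < r1)%N -> size U1 = (r1 - j)%N ->
  level j <= W j (s :: U1) -> W r1 [:: s] <= level r1 -> W j.+1 U1 <= level j.+1 ->
  split_edge p.
Proof.
move=> ltj sU hW hs hU.
have szU : (size U1 + j.+1 = r)%N by rewrite sU /r; clear -ltj; lia.
pose P Y := wedge ((s :: U1) ++ Y) && (par (s :: take r1 Y) == p).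
pose Q1 Y := uniq ([:: s] ++ take r1 Y) && ~~ rok ([:: s] ++ take r1 Y).
pose Q2 Y := uniq (U1 ++ drop r1 Y) && ~~ rok (U1 ++ drop r1 Y).
have e1 : (j + r = r1 + j.+1)%N by rewrite /r; clear; lia.
have h1 : W j (s :: U1) <= ((j + r)`!)%:R * Pr (j + r) P.
  apply: Pr_symm => // t stt /andP[wt mt].
  have [|t' pt pp] := @mixed_arrange t r1 (p (+) (s \in A)) mt.
    by rewrite stt /r; have := st_r1 st; clear; lia.
  exists t' => //; rewrite /P (wedge_perm _ _ _ (_ : perm_eq _ ((s :: U1) ++ t))) ?perm_cat2l // wt /=.
  by rewrite -[s :: _]cat1s par_cat pp /par /= addn0; case: (s \in A); case: (p).
have hK : ((j + r)`!)%:R <= K by rewrite ler_nat /fact_cst leq_fact // /r; clear -ltj; lia.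
have P0 := Pr_ge0 R sT_gt0 (j + r) P.
have h2 := ler_wpM2r P0 hK.
have q1 : Pr (j + r) Q1 <= 8 * level r1.
  apply: (@le_trans _ _ (8 * W r1 [:: s])); last by lra.
  apply: le_trans (W_mono _); last by rewrite /= add1n.
  rewrite e1 Pr_cat // /prob; apply: EE_le => // Y sY.
  by apply: EE_leC => // t _; rewrite /Q1 take_size_cat.
have q2 : Pr (j + r) Q2 <= 8 * level j.+1.
  apply: (@le_trans _ _ (8 * W j.+1 U1)); last by lra.
  apply: le_trans (W_mono szU).
  rewrite e1 Pr_cat //; apply: EE_leC => // Y sY.
  by apply: Pr_sub => // t _; rewrite /Q2 drop_size_cat.
have lv0 i : 0 < level i.
  rewrite /level mulr_gt0 ?exprn_gt0 ?divr_gt0 ?mulr_gt0 //; apply: lt_le_trans K_ge1 => //.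
have lv i : level i.+1 * (20 * K) = level i.
  by rewrite /level exprSr; field; rewrite gt_eqF //; apply: lt_le_trans K_ge1.
have lvm : level r1 <= level j.+1.
  have : forall i, level (j.+1 + i) <= level j.+1.
    elim=> [|i IH]; first by rewrite addn0.
    apply: le_trans IH; rewrite addnS -[X in _ <= X]lv.
    by have := lv0 (j.+1 + i).+1; have := K_ge1; nra.
  by move=> /(_ (r1 - j.+1)%N); rewrite subnKC.
have [|Y [sY]] := @Pr_ex R T sT_gt0 (j + r) (fun Y => [&& P Y, ~~ Q1 Y & ~~ Q2 Y]).
  have h3 : Pr (j + r) P <= Pr (j + r) (fun Y => [&& P Y, ~~ Q1 Y & ~~ Q2 Y]) + Pr (j + r) Q1 + Pr (j + r) Q2.
    by apply: Pr_or3 => // t _; case: (P t); case: (Q1 t); case: (Q2 t).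
  have h4 := lv j; have h5 := lv0 j.+1; have h6 := K_ge1.
  move: hW h1 h2 h3 q1 q2 lvm P0 h4 h5 h6; set a := Pr _ P; set b := Pr _ Q1; set d := Pr _ Q2; set e := Pr _ _.
  move=> hW h1 h2 h3 q1 q2 lvm P0 h4 h5 h6.
  have h7 : level j <= K * a by lra.
  have h8 : 20 * level j.+1 <= a.
    have Kp : 0 < K by lra.
    by rewrite -(ler_pM2l Kp); lra.
  by lra.
case/and3P => /andP[wY pY] n1 n2.
have pm : perm_eq ((s :: U1) ++ Y) ((s :: take r1 Y) ++ (U1 ++ drop r1 Y)).
  by rewrite -{1}(cat_take_drop r1 Y) /= perm_cons perm_catCA.
have uu : uniq ((s :: take r1 Y) ++ (U1 ++ drop r1 Y)).
  by rewrite -(perm_uniq pm); case/andP: wY => /andP[].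
have u1 := uniq_catl uu; have u2 := uniq_catr uu.
exists (s :: take r1 Y), (U1 ++ drop r1 Y); split.
- by rewrite /= size_takel // sY /r; clear; lia.
- by rewrite size_cat size_drop sY sU /r; clear -ltj; lia.
- by rewrite -(wedge_perm _ _ _ pm).
- exact/eqP.
- by move: n1 n2; rewrite /Q1 /Q2 u2 [uniq _]u1 /= !negbK.
Qed.

(** Blocks [v :: y] that are not [rok] contribute at most c to the 8 * c of [vertex_parity]. *)
Lemma vertex_rok v p :
  7 * c <= Pr r1 (fun y => [&& uniq (v :: y), par (v :: y) == p & rok (v :: y)]).
Proof.
have h := vertex_parity v p.
suff : Pr (r1 + r) (fun t => redge (v :: t) && (par (v :: take r1 t) == p)) <=
    Pr r1 (fun y => [&& uniq (v :: y), par (v :: y) == p & rok (v :: y)]) + c.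
  by move: h; set u := Pr _ _; set w := Pr _ _; lra.
rewrite Pr_cat // -[X in _ <= _ + X](EE_cst sT_gt0 r1) -EED; apply: EE_le => // y sy.
case E : [&& _, _ & _].
  by apply: (le_trans (Pr_le1 R sT_gt0 _ _)); rewrite lerDl ltW.
rewrite add0r; have [uy|uy] := boolP (uniq (v :: y)); last first.
  apply: EE_leC => // t st'; rewrite /redge /edge.
  have -> : uniq (v :: y ++ t) = false.
    by apply: contraNF uy; rewrite -cat_cons cat_uniq => /andP[].
  by rewrite ltW.
have [/eqP py|py] := boolP (par (v :: y) == p); last first.
  apply: EE_leC => // t st'; rewrite take_size_cat // (negbTE py) andbF.
  by rewrite ltW.
move: E; rewrite uy py eqxx /= => /negbT; rewrite -ltNge => /ltW h1; apply: le_trans h1.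
by apply: Pr_sub => // t _ /andP[].
Qed.

(** If cutting the edges into consecutive halves fails, many halves through [v] of parity [p] are
    not [rok]. One of them, [v :: y0], forms wrong edges with almost all tuples of the fitting
    parity, and these edges can be cut differently: [v] goes with r1 vertices of the tuple, and [y0]
    with the one vertex left. *)
Lemma split_of_vertex v p : level r1 <= W r1 [:: v] -> split_edge p.
Proof.
move=> hW.
have k1 := K_ge1; have c0 := c_gt0; have x0 := sx_gt0; have xc := sx_c240; have cs := c_small.
have xl := st_xlevel st.
have bt : Pr r (fun t => ~~ good t) <= x := Pr_bad_tuple completion_of_setting.
pose P Y := wedge (v :: Y) && (par (v :: take r1 Y) == p).
have h1 : W r1 [:: v] <= ((r1 + r)`!)%:R * Pr (r1 + r) P.
  apply: Pr_symm => // t stt /andP[wt mt].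
  have [|t' pt pp] := @mixed_arrange t r1 (p (+) (v \in A)) mt.
    by rewrite stt /r; have := st_r1 st; clear; lia.
  exists t' => //; rewrite /P (wedge_perm _ _ _ (_ : perm_eq _ (v :: t))) ?perm_cons // wt /=.
  by rewrite -[v :: _]cat1s par_cat pp /par /= addn0; case: (v \in A); case: (p).
have hK : ((r1 + r)`!)%:R <= K by rewrite ler_nat /fact_cst leq_fact // /r; clear; lia.
have h2 := ler_wpM2r (Pr_ge0 R sT_gt0 (r1 + r) P) hK.
pose G Y := [&& P Y, rok (v :: take r1 Y) & rok (drop r1 Y)].
have [/(Pr_ex sT_gt0)[Y [sY /and3P[/andP[wY /eqP pY] g1 g2]]]|hG] := ltrP 0 (Pr (r1 + r) G).
  exists (v :: take r1 Y), (drop r1 Y); split=> //.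
  - by rewrite /= size_takel // sY leq_addr.
  - by rewrite size_drop sY addKn.
  - by rewrite cat_cons cat_take_drop.
pose B y := [&& uniq (v :: y), par (v :: y) == p & ~~ rok (v :: y)].
pose D y := c <= Pr 1 (fun t => ~~ good (y ++ t)).
have h3 : Pr (r1 + r) P <= Pr (r1 + r) G + Pr (r1 + r) (fun Y => B (take r1 Y)) +
    Pr (r1 + r) (fun Y => ~~ good (drop r1 Y)).
  apply: Pr_or3 => // Y sY PY; rewrite /G PY /B; have /andP[wY ->] := PY.
  have uY : uniq ((v :: take r1 Y) ++ drop r1 Y).
    by rewrite cat_cons cat_take_drop; case/andP: wY => /andP[].
  rewrite (uniq_catl uY) /=; case: (boolP (rok (v :: _))) => //= _; rewrite ?orbT //.
  case: (boolP (good _)) => g; rewrite ?orbT //= orbF.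
  apply: good_rok g (uniq_catr uY) _.
  by rewrite size_drop sY addKn.
have h4 : Pr (r1 + r) (fun Y => B (take r1 Y)) <= Pr r1 B.
  rewrite Pr_cat //; apply: EE_le => // Y sY; apply: EE_leC => // t _.
  by rewrite take_size_cat.
have h5 : Pr (r1 + r) (fun Y => ~~ good (drop r1 Y)) <= x.
  rewrite Pr_cat //; apply: EE_leC => // Y sY; apply: le_trans bt.
  by apply: Pr_sub => // t _; rewrite drop_size_cat.
have h6 : c * Pr r1 D <= x.
  apply: le_trans bt; rewrite -[r]addn1 Pr_cat //; apply: markov => //; first exact: ltW.
  by move=> y _; exact: Pr_ge0.
(* Outside [D], adding almost any vertex to [y0] gives a good block, hence a [rok] one after the new
   cut. *)
have [|y0 [sy0 /andP[/and3P[uy py nry] nD]]] := @Pr_ex R T sT_gt0 r1 (fun y => B y && ~~ D y).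
  have h7 : Pr r1 B <= Pr r1 (fun y => B y && ~~ D y) + Pr r1 D.
    by apply: Pr_or => // t _; case: (B t); case: (D t).
  move: hW h1 h2 hG h3 h4 h5 h6 h7; set a := Pr _ P; set g := Pr _ G; set b1 := Pr _ (fun _ => B _).
  set b2 := Pr _ B; set d := Pr _ D; set e := Pr r1 _; set gg := Pr _ _; set w := W _ _.
  move=> hW h1 h2 hG h3 h4 h5 h6 h7.
  have s1 : level r1 <= K * a by lra.
  have s2 : a <= e + d + x by lra.
  have s3 : c * level r1 <= K * (c * e + x + c * x).
    have : c * level r1 <= c * (K * a) by rewrite ler_pM2l.
    have : K * (c * a) <= K * (c * e + c * d + c * x) by rewrite ler_pM2l; last lra; have := ler_wpM2l (ltW c0) s2; lra.
    have : K * (c * d) <= K * x by rewrite ler_pM2l //; lra.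
    by lra.
  have s4 : c * x <= x by have := ler_wpM2r (ltW x0) (_ : c <= 1); rewrite mul1r; apply; lra.
  have s5 : K * (c * x) <= K * x by rewrite ler_pM2l //; lra.
  have s6 : 2 * (K * x) <= K * (c * e) by lra.
  have kx : 0 < K * x by rewrite mulr_gt0 //; lra.
  have kc : 0 < K * c by rewrite mulr_gt0 //; lra.
  by rewrite -(pmulr_rgt0 _ kc); lra.
pose S := v :: y0.
have sS : size S = r by rewrite /= sy0.
have h7 := st_degree st uy; rewrite sS leqnn /= subnn in h7.
have {}h7 := h7 isT; rewrite [(0 + r)%N]add0n in h7.
pose PW t := par t == ~~ pi (+) p.
have [_ h8] := andP (Pr_par sT_gt0 r1 (~~ pi (+) p) (st_A st)).
rewrite -/r in h8.
have pS : par S = p by exact/eqP.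
have h9 : Pr r (fun t => edge (S ++ t)) <= Pr r (fun t => redge (S ++ t)) + Pr r (fun t => wedge (S ++ t)).
  by apply: Pr_or => // t _; rewrite /redge /wedge => ->; case: (_ == pi).
have h10 : Pr r (fun t => wedge (S ++ t)) + Pr r (fun t => PW t && ~~ wedge (S ++ t)) <= Pr r PW.
  rewrite -EED; apply: EE_le => // t _; rewrite -natrD ler_nat.
  case w : (wedge _); last by case: (PW t).
  have -> : PW t; last by [].
  move: w => /andP[_]; rewrite par_cat pS /PW; case: (par t); case: (pi); case: (p) => //.
pose G2 t := [&& wedge (S ++ t), par (v :: take r1 t) == p, rok (v :: take r1 t) & rok (y0 ++ drop r1 t)].
have [/(Pr_ex sT_gt0)[t [stt /and4P[wt /eqP pt g1 g2]]]|hG2] := ltrP 0 (Pr (r1 + 1) G2).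
  exists (v :: take r1 t), (y0 ++ drop r1 t); split=> //.
  - by rewrite /= size_takel // stt leq_addr.
  - by rewrite size_cat size_drop stt sy0 addKn addn1.
  - rewrite (wedge_perm _ _ _ (_ : perm_eq _ (S ++ t))) // /S /= perm_cons.
    by rewrite -[X in perm_eq _ (y0 ++ X)](cat_take_drop r1) perm_catCA.
(* The parity of the last vertex for which [t] satisfies [PW] once [v :: take r1 t] has parity
   [p]. *)
pose s := ~~ pi (+) (v \in A).
pose Z y := [&& uniq (v :: y), par (v :: y) == p & rok (v :: y)].
have h11 : Pr (r1 + 1) (fun t => Z (take r1 t) && (par (drop r1 t) == s)) <=
    Pr (r1 + 1) G2 + Pr (r1 + 1) (fun t => PW t && ~~ wedge (S ++ t)) +
    Pr (r1 + 1) (fun t => ~~ good (y0 ++ drop r1 t)).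
  apply: Pr_or3 => // t stt /andP[/and3P[uz pz rz] pd]; rewrite /G2 pz rz /=.
  have pw : PW t.
    rewrite /PW -[t](cat_take_drop r1) par_cat (eqP pd); move: pz.
    rewrite -[v :: _]cat1s par_cat /s /par /= addn0.
    by case: (v \in A); case: (odd (count _ (take _ _))); case: (pi); case: (p).
  rewrite pw /=; case w : (wedge _) => //=.
  case: (boolP (good _)) => g; rewrite ?orbT //= ?orbF.
  apply: good_rok g _ _; last by rewrite size_cat size_drop stt sy0 addKn addn1.
  have u : uniq ((S ++ take r1 t) ++ drop r1 t).
    by rewrite -catA cat_take_drop; case/andP: w => /andP[].
  have pm : perm_eq ((v :: take r1 t) ++ (y0 ++ drop r1 t)) ((S ++ take r1 t) ++ drop r1 t).
    by rewrite /S -catA /= perm_cons perm_catCA.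
  have uu : uniq ((v :: take r1 t) ++ (y0 ++ drop r1 t)) by rewrite (perm_uniq pm).
  exact: uniq_catr uu.
have h12 : Pr (r1 + 1) (fun t => ~~ good (y0 ++ drop r1 t)) <= c.
  rewrite Pr_cat //; apply: EE_leC => // Y sY.
  move: nD; rewrite /D -ltNge => /ltW; apply: le_trans.
  by apply: Pr_sub => // t _; rewrite drop_size_cat.
have [h13 _] := andP (Pr_par sT_gt0 0 s (st_A st)).
have h14 : Pr r1 Z * (1/2 - x) <= Pr (r1 + 1) (fun t => Z (take r1 t) && (par (drop r1 t) == s)).
  rewrite mulrC -EEZ Pr_cat //; apply: EE_le => // y sy.
  case Zy : (Z y); last by rewrite mulr0; exact: Pr_ge0.
  rewrite mulr1; apply: le_trans h13 _; apply: Pr_sub => // t _.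
  by rewrite take_size_cat // drop_size_cat // Zy.
have h15 : 7 * c <= Pr r1 Z := vertex_rok v p.
move: nry; rewrite /rok -/r -ltNge -/S => h16.
rewrite [(r1 + 1)%N]addn1 -/r in h11 h12 h14 hG2.
exfalso; move: h7 h8 h9 h10 h11 h12 h14 h15 h16 hG2; rewrite -/(PW).
set a := Pr r (fun t => edge _); set b := Pr r (fun t => par _ == _); set d := Pr r (fun t => redge _).
set e := Pr r (fun t => wedge _); set f := Pr r (fun t => PW t && _).
set g := Pr r (fun t => Z _ && _); set h := Pr r G2; set i := Pr r (fun t => ~~ _); set j := Pr r1 Z.
move=> h7 h8 h9 h10 h11 h12 h14 h15 h16 hG2.
(* The losses stay below the 7 * c * (1/2 - x) coming from [vertex_rok], which is the
   contradiction. *)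
have t1 : j * (1/2 - x) <= 2 * c + 2 * x by lra.
have t2 : 7 * c * (1/2 - x) <= j * (1/2 - x) by rewrite ler_wpM2r //; lra.
by nra.
Qed.

(* Choose j maximal such that some r - j vertices lie in many (level j) wrong
   edges. By maximality most wrong edges through them split into two rok halves,
   and a mixed edge can be split so that a half has any given parity. *)
Lemma split_of_not_rok S p : uniq S -> size S = r -> ~~ rok S -> split_edge p.
Proof.
move=> uS sS nr.
pose Pj j := (j <= r1)%N && [exists U : (r - j).-tuple T, uniq U && (level j <= W j U)].
have P0 : exists j, Pj j.
  exists 0%N; rewrite /Pj /=; apply/existsP.
  have sS0 : size S == (r - 0)%N by rewrite sS subn0.
  exists (Tuple sS0); rewrite /= uS /level expr0 mulr1; exact: not_rok_W.
have bnd j : Pj j -> (j <= r1)%N by case/andP.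
case: (ex_maxnP P0 bnd) => j /andP[jr /existsP[U /andP[uU hU]]] jmax.
have nP i (V : seq T) : (j < i <= r1)%N -> uniq V -> size V = (r - i)%N -> W i V <= level i.
  move=> /andP[ji ir] uV sV; rewrite leNgt; apply/negP => lt.
  have : Pj i.
    rewrite /Pj ir /=; apply/existsP; have sV' : size V == (r - i)%N by rewrite sV.
    by exists (Tuple sV'); rewrite /= uV ltW.
  by move/jmax; rewrite leqNgt ji.
have := size_tuple U; move: (tval U) uU hU => {U} U uU hU sU.
have [E|ne] := eqVneq j r1.
  move: hU uU sU; rewrite E {1}/r subSnn; case: U => [|v [|w t]] //= hU _ _.
  exact: split_of_vertex hU.
have ltj : (j < r1)%N by rewrite ltn_neqAle ne.
case: U uU hU sU => [|s U1] uU hU sU.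
  by move: sU; rewrite /= /r; clear -ltj; lia.
apply: (@split_of_link j s U1) => //.
- by move: sU; rewrite /= /r; clear -ltj; lia.
- by apply: nP => //; rewrite ?ltj ?leqnn //= /r subSnn.
- apply: nP; rewrite ?leqnn ?ltj //; first by case/andP: uU.
  by move: sU; rewrite /= /r; clear -ltj; lia.
Qed.

End Structure.

(** * Correcting the parity by wrong edges *)

(** Four steps along right edges restore the block parity and contribute an even total. *)
Lemma fin_mod4 pi e f s L : fin pi e f s L = fin pi e f s (L %% 4).
Proof.
rewrite {1}(divn_eq L 4); elim: (L %/ 4)%N e s => [|d IH] e s; first by rewrite mul0n.
rewrite mulSn -addnA -[LHS]/(fin pi ((((e (+) pi) (+) pi) (+) pi) (+) pi) f _ _).
by rewrite IH; clear IH; congr (fin _ _ _ _); case: pi; case: e; case: s.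
Qed.

Section Configurations.
Variables (R : realFieldType) (T : finType) (H : {set {set T}}) (A : {set T}).
Variables (pi : bool) (r1 m : nat) (x : R).
Let r := r1.+1.
Local Notation n := #|T|.
Local Notation Pr := (@prob R T).
Local Notation edge := (edge H).
Local Notation redge := (redge H A pi).
Local Notation wedge := (wedge H A pi).
Local Notation miss := (miss H A pi).
Local Notation par := (par A).
Local Notation rok := (@rok R T H A pi r1 (rok_cst R r1)).
Local Notation good := (@good R T H A pi r1 x).
Local Notation HC := (has_hamilton_cycle (r + r) r H).

Hypothesis st : setting H A pi r1 m x.

Let T0 : (0 < n)%N. Proof. exact: sT_gt0 st. Qed.
Let cs := completion_of_setting st.

(** For odd [m] and true [pi], parities alternate except at one wrong edge, whose halves share a
    parity p. The total is then p + (m - 1)/2 modulo 2, so p must be this value. *)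
Definition target := odd #|A| (+) (1 < m %% 4)%N.

Lemma m_big : (12 <= m)%N.
Proof.
have x0 := sx_gt0 st; have xc := sx_c240 st; have c1 := c_small R r1; have r3 := sr_ge3 st.
have : 100 * r%:R <= x * n%:R := st_n1 st.
have n0 : (0 : R) < n%:R by rewrite ltr0n.
have : x * n%:R <= n%:R by rewrite ler_piMl // ltW //; lra.
move=> h1 h2; have : 100 * r%:R <= n%:R :> R by exact: le_trans h2 h1.
rewrite -natrM ler_nat (st_m st) -/r mulnC leq_mul2l /= => h.
by apply: leq_trans h.
Qed.

Lemma small_set (Z : {set T}) a : (a <= 100)%N -> (#|Z| <= a * r)%N -> #|Z|%:R <= x * n%:R.
Proof.
move=> a100 hZ; apply: le_trans (st_n1 st); rewrite -/r -natrM ler_nat.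
by apply: leq_trans hZ _; rewrite leq_mul2r a100 orbT.
Qed.

Lemma exists_good p (Z : {set T}) : (#|Z| <= 50 * r)%N ->
  exists S, [/\ size S = r, par S = p, good S & fresh Z S].
Proof.
move=> hZ; have hZ' := @small_set _ 50 isT hZ.
have [h1 _] := andP (Pr_par T0 r1 p (st_A st)); rewrite -/r in h1.
have P0r : Pr r (fun _ => false) <= 0 :> R by apply: EE_leC.
have [|S [sS /eqP pS gS fS _]] := Pr_pick (P := fun t => par t == p) T0 (Pr_bad_tuple cs) (nfresh cs (le_r r1) hZ') P0r.
  apply: lt_le_trans h1.
  have := sx_gt0 st; have := sx_c240 st; have := c_small R r1; have := sx_c st.
  by rewrite -/r; set u := r%:R; set w := rok_cst _ _; lra.
by exists S; split=> //; rewrite -[X in is_true X]negbK.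
Qed.

Lemma not_rok_neighbour S (Z : {set T}) : uniq S -> size S = r -> ~~ rok S ->
  (#|Z| <= 50 * r)%N ->
  exists U, [/\ size U = r, wedge (S ++ U), good U & fresh Z U].
Proof.
move=> uS sS nr hZ; have hZ' := @small_set _ 50 isT hZ.
have P0r : Pr r (fun _ => false) <= 0 :> R by apply: EE_leC.
have h := not_rok_W st uS sS nr.
have [|U [sU /andP[eU _] gU fU _]] := Pr_pick (P := fun t => wedge (S ++ t) && mixed A t) T0 (Pr_bad_tuple cs) (nfresh cs (le_r r1) hZ') P0r.
  apply: lt_le_trans h.
  have := sx_gt0 st; have := sx_c240 st; have := c_small R r1; have := sx_c st.
  by rewrite -/r; set u := r%:R; set w := rok_cst _ _; lra.
by exists U; split=> //; rewrite -[X in is_true X]negbK.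
Qed.

Lemma fresh_uniq (Z : {set T}) S : fresh Z S -> uniq S.
Proof. by case/andP. Qed.

(** [T1] and [T2] are good continuations of the two blocks along right edges; being good and of
    equal parity, they have a common neighbour [C]. *)
Lemma join S S' (Z : {set T}) : rok S -> rok S' -> par S = par S' -> (#|Z| <= 40 * r)%N ->
  exists T1 C T2, [/\ [&& size T1 == r, size C == r & size T2 == r],
    fresh Z (T1 ++ C ++ T2), [&& redge (S ++ T1), redge (T2 ++ S'), edge (T1 ++ C) & edge (C ++ T2)],
    par T1 = par S (+) pi & par C = par S /\ par T2 = par S (+) pi].
Proof.
move=> rS rS' pp hZ.
have cardU (Y : {set T}) (U : seq T) a : (#|Y| <= a * r)%N -> size U = r -> (#|Y :|: [set z in U]| <= a.+1 * r)%N.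
  move=> h1 h2; apply: leq_trans (leq_card_setU _ _).1 _.
  by rewrite mulSn addnC leq_add // cardsE -h2 card_size.
have [T1 [s1 e1 g1 f1]] := rok_extend cs rS (@small_set _ 40 isT hZ).
have hZ1 := cardU _ _ _ hZ s1.
have [T2 [s2 e2 g2 f2]] := rok_extend cs rS' (@small_set _ 41 isT hZ1).
have hZ2 := cardU _ _ _ hZ1 s2.
have hZ2' := @small_set _ 42 isT hZ2.
have [h1 _] := andP (Pr_par T0 r1 (par S) (st_A st)); rewrite -/r in h1.
have [|C [sC /eqP pC m1 m2 f3]] := Pr_pick (P := fun t => par t == par S) T0 g1 g2 (nfresh cs (le_r r1) hZ2').
  apply: lt_le_trans h1.
  have := sx_gt0 st; have := sx_c240 st; have := c_small R r1; have := sx_c st.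
  by rewrite -/r; set u := r%:R; set w := rok_cst _ _; lra.
move: f3; rewrite negbK => f3.
have pT1 : par T1 = par S (+) pi by case/andP: e1 => _; rewrite par_cat => /eqP <-; rewrite addbA addbb.
have pT2 : par T2 = par S (+) pi by case/andP: e2 => _; rewrite par_cat pp => /eqP <-; rewrite addbA addbb.
have [u1 h1'] := andP f1; have [u2 h2'] := andP f2; have [u3 h3'] := andP f3.
have d12 z : z \in T2 -> z \notin T1.
  by move=> z2; have /hasPn/(_ z z2) := h2'; rewrite /= !inE negb_or => /andP[].
have dC z : z \in C -> [/\ z \notin T1, z \notin T2 & z \notin Z].
  by move=> z3; have /hasPn/(_ z z3) := h3'; rewrite /= !inE !negb_or => /andP[/andP[]].
have uT1C : uniq (T1 ++ C).
  rewrite cat_uniq u1 u3 andbT /=; apply/hasPn => z /dC[]//.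
have uCT2 : uniq (C ++ T2).
  rewrite cat_uniq u2 u3 andbT /=; apply/hasPn => z z2; apply/negP => /dC[_]; by rewrite z2.
exists T1, C, T2; split=> //; first by rewrite s1 s2 sC !eqxx.
- rewrite /fresh cat_uniq u1 uCT2 andbT /=; apply/andP; split.
    by apply/hasPn => z; rewrite mem_cat => /orP[/dC[]//|/d12].
  rewrite !has_cat !negb_or h1' /=; apply/andP; split.
    by apply/hasPn => z /dC[].
  by apply/hasPn => z z2; have /hasPn/(_ z z2) := h2'; rewrite /= !inE negb_or => /andP[].
- rewrite e1 redgeC e2 /=; apply/andP; split.
    apply: (not_miss_edge uT1C _ m1); rewrite par_cat pT1 pC.
    by case: (par S); case: (pi).
  rewrite edgeC; apply: (not_miss_edge _ _ m2); first by rewrite uniq_catC.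
  by rewrite par_cat pT2 pC; case: (par S); case: (pi).
Qed.

(** When [pi] is false all blocks have one parity, which for odd [m] can be chosen to fit [A] and
    for even [m] gives an even total. When [pi] is true parities alternate, so [m] is even and the
    total is m/2 modulo 2. *)
Lemma hc_right : (if odd m then ~~ pi else odd #|A| == (pi && (1 < m %% 4)%N)) -> HC.
Proof.
move=> hp.
pose p := if odd m then odd #|A| else false.
have [|S [sS pS gS fS]] := exists_good p (Z := set0); first by rewrite cards0.
have rS := good_rok st gS (fresh_uniq fS) sS.
apply: (completion cs (P0 := S) (P := [::])) => //.
  by rewrite /path_ok /= cats0 sS eqxx (fresh_uniq fS).
rewrite /inv /= cats0 pS fin_mod4; have mb := m_big.
have e1 : ((m - 1) %% 4 = ((m %% 4) + 3) %% 4)%N by clear -mb; lia.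
have e2 : odd m = odd (m %% 4) by rewrite {1}(divn_eq m 4) oddD oddM andbF.
move: hp; rewrite e1 /p e2; have : (m %% 4 < 4)%N by rewrite ltn_mod.
by case: (m %% 4)%N => [|[|[|[|]]]] //= _; case: (odd _); case: (pi).
Qed.

Lemma m_sub q : (q <= 12)%N -> ((m - q) %% 4 = ((m %% 4) + (12 - q)) %% 4)%N.
Proof. by have := m_big; clear => h1 h2; lia. Qed.

Lemma odd_m4 : odd m = odd (m %% 4).
Proof. by rewrite {1}(divn_eq m 4) oddD oddM andbF. Qed.

Lemma join_paths F Q F' Q' (Z : {set T}) : path_ok H r1 F Q -> path_ok H r1 F' Q' ->
  ~~ has (mem (flatten (F :: Q))) (flatten (F' :: Q')) ->
  rok (last F Q) -> rok F' -> par (last F Q) = par F' ->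
  (size Q + size Q' <= 20)%N -> (#|Z| <= 10 * r)%N ->
  exists T1 C T2, [/\ path_ok H r1 F (Q ++ [:: T1, C, T2, F' & Q']),
    par T1 = par F' (+) pi, par C = par F', par T2 = par F' (+) pi &
    ~~ has (mem Z) (T1 ++ C ++ T2)].
Proof.
move=> pQ pQ' dj rL rF' pp sQ hZ.
pose Y : {set T} := Z :|: ([set z in flatten (F :: Q)] :|: [set z in flatten (F' :: Q')]).
have hY : (#|Y| <= 40 * r)%N.
  apply: leq_trans (leq_card_setU _ _).1 _.
  have h1 := leq_of_leqif (leq_card_setU [set z in flatten (F :: Q)] [set z in flatten (F' :: Q')]).
  have h2 : (#|[set z in flatten (F :: Q)]| <= (size Q).+1 * r)%N by rewrite cardsE; apply: leq_trans (card_size _) _; rewrite (path_ok_size pQ).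
  have h3 : (#|[set z in flatten (F' :: Q')]| <= (size Q').+1 * r)%N by rewrite cardsE; apply: leq_trans (card_size _) _; rewrite (path_ok_size pQ').
  have : (((size Q).+1 + (size Q').+1) * r <= 30 * r)%N by rewrite leq_mul2r; apply/orP; right; clear -sQ; lia.
  rewrite mulnDl; move: h1 h2 h3 hZ; clear; set a := #|_|; set b := #|_|; set c := #|_|; set d := #|_|; lia.
have [T1 [C [T2 [/and3P[s1 s2 s3] fY /and4P[e1 e2 e3 e4] p1 [p2 p3]]]]] := join rL rF' pp hY.
have [uW /hasPn dW] := andP fY.
exists T1, C, T2; split; rewrite -?pp //; last first.
  by apply/hasPn => z /dW; rewrite /= !inE negb_or => /andP[].
have [a1 u1 q1] := and3P pQ; have [a2 u2 q2] := and3P pQ'.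
apply/and3P; split.
- by move: a1 a2; rewrite /= all_cat /= s1 s2 s3 => /andP[-> ->].
- have -> : flatten (F :: Q ++ [:: T1, C, T2, F' & Q']) =
      flatten (F :: Q) ++ (T1 ++ C ++ T2) ++ flatten (F' :: Q').
    by rewrite -cat_cons flatten_cat /= !catA.
  rewrite cat_uniq u1 cat_uniq uW u2 /= !andbT has_cat negb_or dj andbT; apply/andP; split.
    by apply/hasPn => z /dW; rewrite /= !inE !negb_or => /and3P[].
  apply/hasPn => z zQ; apply/negP => /dW; rewrite /= !inE !negb_or => /and3P[_ _ /negP]; apply; exact: zQ.
- rewrite cat_path q1 /= e3 e4 /=; case/andP: e1 => -> _; case/andP: e2 => -> _ /=.
  exact: q2.
Qed.

Hypothesis kH : kgraph (r + r) H.
Definition wrong : {set {set T}} := [set e in H | odd #|e :&: A| != pi].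
Local Notation WW := wrong.

Lemma set_enum_cat (S S' : {set T}) : [set z in enum S ++ enum S'] = S :|: S'.
Proof. by apply/setP => z; rewrite inE mem_cat !mem_enum inE. Qed.

Lemma par_enum (S : {set T}) : par (enum S) = odd #|S :&: A|.
Proof.
rewrite /par -size_filter; congr odd.
rewrite cardE; apply: perm_size; apply: uniq_perm.
  by apply: filter_uniq; exact: enum_uniq.
  exact: enum_uniq.
move=> z; rewrite mem_filter !mem_enum. by rewrite in_setI andbC.
Qed.

Lemma edge_enum (S S' : {set T}) : [disjoint S & S'] -> S :|: S' \in H -> edge (enum S ++ enum S').
Proof.
move=> dj hH; rewrite /edge set_enum_cat hH andbT cat_uniq !enum_uniq andbT /=.
apply/hasPn => z; rewrite /= !mem_enum => zS'; apply/negP => zS.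
by have := disjointFr dj zS; rewrite zS'.
Qed.

(** When this holds, wrong edges may be cut into halves arbitrarily; otherwise a set that is not
    [rok] supplies the wrong edges. *)
Definition all_rok := [forall S : {set T}, (#|S| == r) ==> rok (enum S)].

Lemma all_rokP (S : {set T}) : all_rok -> #|S| = r -> rok (enum S).
Proof. by move=> /forallP/(_ S)/implyP h /eqP/h. Qed.

Lemma odd_cardID (S e : {set T}) : S \subset e ->
  odd #|(e :\: S) :&: A| = odd #|S :&: A| (+) odd #|e :&: A|.
Proof.
move=> Se; rewrite -(cardsID S (e :&: A)) oddD.
have -> : e :&: A :&: S = S :&: A by rewrite setIAC (setIidPr Se).
have -> : (e :&: A) :\: S = (e :\: S) :&: A by apply/setP => z; rewrite !inE andbA.
by rewrite addbA addbb.
Qed.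

Lemma edge_path e (S : {set T}) : all_rok -> e \in WW -> S \subset e -> #|S| = r ->
  exists F G, [/\ path_ok H r1 F [:: G], flatten [:: F; G] =i e,
    par F = odd #|S :&: A|, par G = odd #|S :&: A| (+) ~~ pi & rok F /\ rok G].
Proof.
move=> ar; rewrite inE => /andP[eH pe] Se sS.
have sG : #|e :\: S| = r.
  by have := cardsID S e; rewrite (setIidPr Se) sS (kH eH); move/addnI.
exists (enum S), (enum (e :\: S)).
have E : edge (enum S ++ enum (e :\: S)).
  apply: edge_enum; last by rewrite -{1}(setIidPr Se) setID.
  by rewrite -setI_eq0; apply/eqP/setP => z; rewrite !inE; do !case: (z \in _).
split.
- apply/and3P; split; first by rewrite /= -!cardE sS sG !eqxx.
    by rewrite /= cats0; case/andP: E.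
  by rewrite /= E.
- move=> z; rewrite /= cats0 mem_cat !mem_enum !inE.
  by have [zS|] := boolP (z \in S); rewrite //= (subsetP Se).
- by rewrite par_enum.
- rewrite par_enum (odd_cardID Se); congr (_ (+) _).
  by case: (odd _) pe; case: (pi).
- by split; apply: all_rokP.
Qed.

(** Wrong edges sharing exactly r vertices are consecutive on a path whose middle block is their
    intersection. *)
Lemma pair_path e1 e2 : all_rok -> e1 \in WW -> e2 \in WW -> #|e1 :&: e2| = r ->
  exists F I G, [/\ path_ok H r1 F [:: I; G], flatten [:: F; I; G] =i e1 :|: e2,
    par I = odd #|e1 :&: e2 :&: A|,
    par F = odd #|e1 :&: e2 :&: A| (+) ~~ pi &
    par G = odd #|e1 :&: e2 :&: A| (+) ~~ pi /\ rok F /\ rok G].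
Proof.
move=> ar h1 h2 sI.
have [F1 [I1 [k1 k2 k3 k4 [k5 k6]]]] := edge_path ar h1 (subsetIl e1 e2) sI.
move: h1 h2; rewrite !inE => /andP[e1H p1] /andP[e2H p2].
have sF : #|e1 :\: e2| = r by have := cardsID e2 e1; rewrite sI (kH e1H) => /addnI.
have sG : #|e2 :\: e1| = r.
  by have := cardsID e1 e2; rewrite setIC sI (kH e2H) => /addnI.
exists (enum (e1 :\: e2)), (enum (e1 :&: e2)), (enum (e2 :\: e1)).
have E1 : edge (enum (e1 :\: e2) ++ enum (e1 :&: e2)).
  apply: edge_enum; last by rewrite setUC setID.
  by rewrite -setI_eq0; apply/eqP/setP => z; rewrite !inE; do !case: (z \in _).
have E2 : edge (enum (e1 :&: e2) ++ enum (e2 :\: e1)).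
  apply: edge_enum; last by rewrite setIC setID.
  by rewrite -setI_eq0; apply/eqP/setP => z; rewrite !inE; do !case: (z \in _).
split.
- apply/and3P; split; first by rewrite /= -!cardE sI sF sG !eqxx.
    rewrite /= cats0 catA cat_uniq enum_uniq andbT; case/andP: E1 => -> _ /=.
    by apply/hasPn => z; rewrite /= mem_cat !mem_enum !inE; do !case: (z \in _).
  by rewrite /= E1 E2.
- by move=> z; rewrite /= cats0 !mem_cat !mem_enum !inE; do !case: (z \in _).
- by rewrite par_enum.
- have -> : e1 :\: e2 = e1 :\: (e1 :&: e2) by rewrite setDIr setDv set0U.
  rewrite par_enum.
  rewrite (odd_cardID (subsetIl e1 e2)); congr (_ (+) _).
  by case: (odd _) p1; case: (pi).
- split; last by split; apply: all_rokP.
  rewrite par_enum; have -> : e2 :\: e1 = e2 :\: (e1 :&: e2) by rewrite setDIr setDv setU0.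
  rewrite (odd_cardID (subsetIr e1 e2)); congr (_ (+) _).
  by case: (odd _) p2; case: (pi).
Qed.

Definition pair_in := exists e1 e2, [/\ e1 \in WW, e2 \in WW & #|e1 :&: e2| = r].
Definition three_in := exists e1 e2 e3, [/\ [&& e1 \in WW, e2 \in WW & e3 \in WW],
  [disjoint e1 & e2], [disjoint e1 & e3] & [disjoint e2 & e3]].
Definition pair_disjoint_in := exists e1 e2 e3, [/\ [&& e1 \in WW, e2 \in WW & e3 \in WW],
  #|e1 :&: e2| = r, [disjoint e1 & e3] & [disjoint e2 & e3]].

Lemma all_rokNP : ~~ all_rok -> exists S, [/\ uniq S, size S = r & ~~ rok S].
Proof.
rewrite negb_forall => /existsP[S]; rewrite negb_imply => /andP[/eqP sS nr].
by exists (enum S); rewrite enum_uniq -cardE.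
Qed.

Lemma exists_half e : e \in WW -> exists2 S : {set T}, S \subset e & #|S| = r.
Proof.
rewrite inE => /andP[/kH ce _].
by have [|S ? ?] := @exists_subset _ e r; [rewrite ce leq_addr | exists S].
Qed.

Lemma wedge_par S U : wedge (S ++ U) -> par U = par S (+) ~~ pi.
Proof. by case/andP=> _; rewrite par_cat; case: (par S); case: (par U); case: (pi). Qed.

(* Two wrong edges compensate the parity of A. *)
Lemma hc_even : ~~ odd m -> odd #|A| != (pi && (1 < m %% 4)%N) ->
  pair_in \/ three_in -> HC.
Proof.
move=> em pA comb.
have [ar|nar] := boolP all_rok; last first.
  (* A block that is not [rok] lies in many wrong edges, so it can be the middle block shared by two
     of them. *)
  have [S [uS sS nr]] := all_rokNP nar.
  have [U [sU eU gU fU]] : exists U, [/\ size U = r, wedge (S ++ U), good U & fresh [set z in S] U].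
    by apply: not_rok_neighbour => //; rewrite cardsE; apply: leq_trans (card_size _) _; rewrite sS leq_pmull.
  have [V [sV eV gV fV]] : exists U', [/\ size U' = r, wedge (S ++ U'), good U' & fresh [set z in S ++ U] U'].
    apply: not_rok_neighbour => //; rewrite cardsE; apply: leq_trans (card_size _) _.
    by rewrite size_cat sS sU; clear; lia.
  apply: (completion cs (P0 := U) (P := [:: S; V])) => //.
  - apply/and3P; split; first by rewrite /= sU sS sV !eqxx.
      rewrite /= cats0 catA cat_uniq (@perm_uniq _ _ (S ++ U)); last by rewrite perm_catC.
      have [/andP[-> _] _] := andP eU; have [uV hV] := andP fV; rewrite uV andbT /=.
      by apply/hasPn => z /(hasPn hV); rewrite /= inE !mem_cat orbC.
    by rewrite /= edgeC; have [-> _] := andP eU; have [-> _] := andP eV.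
  - by apply: (good_rok st) => //; exact: fresh_uniq fU.
  - by apply: (good_rok st) => //; exact: fresh_uniq fV.
  - rewrite /inv [last _ _]/= fin_mod4 m_sub //= !par_cat (wedge_par eU) (wedge_par eV) /par /= -/(par S).
    move: em pA; rewrite odd_m4; have : (m %% 4 < 4)%N by rewrite ltn_mod.
    by case: (m %% 4)%N => [|[|[|[|]]]] //= _; case: (par S); case: (odd #|A|); case: (pi).
case: comb => [[e1 [e2 [h1 h2 hI]]]|].
  have [F [I [G [k1 k2 k3 k4 [k5 [k6 k7]]]]]] := pair_path ar h1 h2 hI.
  apply: (completion cs (P0 := F) (P := [:: I; G])) => //.
  rewrite /inv [last _ _]/= fin_mod4 m_sub //= !par_cat k3 k4 k5 /par /=.
  move: em pA; rewrite odd_m4; have : (m %% 4 < 4)%N by rewrite ltn_mod.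
  by case: (m %% 4)%N => [|[|[|[|]]]] //= _; case: (odd #|_ :&: A|); case: (odd #|A|); case: (pi).
move=> [e1 [e2 [e3 [/and3P[h1 h2 h3] d12 d13 d23]]]].
(* Two disjoint wrong edges suffice if they have halves of equal parity, to be joined by three
   blocks; among three edges, two have such halves by pigeonhole. *)
have two e e' (S S' : {set T}) : e \in WW -> e' \in WW -> [disjoint e & e'] -> S \subset e -> S' \subset e' ->
  #|S| = r -> #|S'| = r -> odd #|S :&: A| = odd #|S' :&: A| -> HC.
  move=> h h' dj Se Se' sS sS' pp.
  have [F [G [k1 k2 k3 k4 [k5 k6]]]] := edge_path ar h Se sS.
  have [F' [G' [l1 l2 l3 l4 [l5 l6]]]] := edge_path ar h' Se' sS'.
  have p1 : path_ok H r1 G [:: F].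
    move: k1; rewrite /path_ok /= !andbT !cats0 => /and3P[/andP[-> ->] u1 ee].
    by rewrite uniq_catC u1 edgeC ee.
  have [|||T1 [C [T2 [j1 j2 j3 j4 j5]]]] := join_paths (Z := set0) p1 l1 _ k5 l5 _ isT.
  - by apply/hasPn => z; rewrite l2 /= cats0 mem_cat orbC -mem_cat => z2; have := k2 z; rewrite /= cats0 => ->; rewrite (disjointFl dj).
  - by rewrite k3 l3 pp.
  - by rewrite cards0.
  apply: (completion cs (P0 := G) (P := [:: F, T1, C, T2, F' & [:: G']])) => //.
  rewrite /inv [last _ _]/= fin_mod4 m_sub //= !par_cat j2 j3 j4 k3 k4 l3 l4 pp /par /=.
  move: em pA; rewrite odd_m4; have : (m %% 4 < 4)%N by rewrite ltn_mod.
  by case: (m %% 4)%N => [|[|[|[|]]]] //= _; case: (odd #|_ :&: A|); case: (odd #|A|); case: (pi).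
have [S1 a1 b1] := exists_half h1; have [S2 a2 b2] := exists_half h2; have [S3 a3 b3] := exists_half h3.
have : [|| odd #|S1 :&: A| == odd #|S2 :&: A|, odd #|S1 :&: A| == odd #|S3 :&: A| | odd #|S2 :&: A| == odd #|S3 :&: A|].
  by do 3!case: (odd _).
case/or3P => /eqP pp.
- exact: (two e1 e2 S1 S2).
- exact: (two e1 e3 S1 S3).
- exact: (two e2 e3 S2 S3).
Qed.

Definition half_in p := exists e S : {set T}, [/\ e \in WW, S \subset e, #|S| = r & odd #|S :&: A| = p].

(* For odd m an odd number of wrong edges is needed: a single one suffices if it
   has a half of the target parity, otherwise three are used. *)
Lemma hc_odd : odd m -> pi -> half_in target \/ pair_disjoint_in \/ three_in -> HC.
Proof.
move=> om pi1 comb.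
have short F G : path_ok H r1 F [:: G] -> rok F -> rok G -> par F = target -> par G = target -> HC.
  move=> k1 rF rG pF pG; apply: (completion cs (P0 := F) (P := [:: G])) => //.
  rewrite /inv [last _ _]/= fin_mod4 m_sub //= !par_cat pF pG /par /= /target pi1.
  move: om; rewrite odd_m4; have : (m %% 4 < 4)%N by rewrite ltn_mod.
  by case: (m %% 4)%N => [|[|[|[|]]]] //= _; case: (odd #|A|).
have [ar|nar] := boolP all_rok; last first.
  have [S [uS sS nr]] := all_rokNP nar.
  have [S0 [S1 [s0 s1 w p0 [r0 r1']]]] := split_of_not_rok st target uS sS nr.
  apply: (short S0 S1) => //; last by rewrite (wedge_par w) p0 pi1 addbF.
  apply/and3P; split; first by rewrite /= s0 s1 !eqxx.
    by rewrite /= cats0; case/andP: w => /andP[].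
  by rewrite /=; case/andP: w => ->.
have half e (S : {set T}) : e \in WW -> S \subset e -> #|S| = r -> odd #|S :&: A| = target -> HC.
  move=> h Se sS pS; have [F [G [k1 k2 k3 k4 [k5 k6]]]] := edge_path ar h Se sS.
  by apply: (short F G) => //; rewrite ?k3 ?k4 pS ?pi1 ?addbF.
case: comb => [[e [S [h1 h2 h3 h4]]]|comb]; first exact: half h1 h2 h3 h4.
(* As [pi] is true, a wrong edge is even and its complementary halves have equal parity; failing the
   target, both have the opposite one. *)
have other e : e \in WW -> HC \/ exists F G, [/\ path_ok H r1 F [:: G], flatten [:: F; G] =i e,
    par F = ~~ target, par G = ~~ target & rok F /\ rok G].
  move=> h; have [S Se sS] := exists_half h.
  have [pS|pS] := eqVneq (odd #|S :&: A|) target; first by left; apply: half h Se sS pS.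
  have {}pS : odd #|S :&: A| = ~~ target by case: (odd _) (target) pS => [] [].
  have [F [G [k1 k2 k3 k4 k5]]] := edge_path ar h Se sS.
  by right; exists F, G; split=> //; rewrite ?k3 ?k4 pS ?pi1 ?addbF.
case: comb => [[e1 [e2 [e3 [/and3P[h1 h2 h3] hI d13 d23]]]]|[e1 [e2 [e3 [/and3P[h1 h2 h3] d12 d13 d23]]]]].
  have [//|[F' [G' [l1 l2 l3 l4 [l5 l6]]]]] := other _ h3.
  have [pS|pS] := eqVneq (odd #|e1 :&: e2 :&: A|) target.
    exact: half h1 (subsetIl _ _) hI pS.
  have {}pS : odd #|e1 :&: e2 :&: A| = ~~ target by case: (odd _) (target) pS => [] [].
  have [F [I [G [k1 k2 k3 k4 [k5 [k6 k7]]]]]] := pair_path ar h1 h2 hI.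
  have [|||T1 [C [T2 [j1 j2 j3 j4 j5]]]] := join_paths (Z := set0) l1 k1 _ l6 k6 _ isT.
  - apply/hasPn => z; rewrite k2 inE => /orP hz; rewrite [mem _ _]l2; apply/negP => z3.
    by case: hz; [rewrite (disjointFl d13)|rewrite (disjointFl d23)].
  - by rewrite [last _ _]/= l4 k4 pS pi1 addbF.
  - by rewrite cards0.
  apply: (completion cs (P0 := F') (P := [:: G', T1, C, T2, F & [:: I; G]])) => //.
  rewrite /inv [last _ _]/= fin_mod4 m_sub //= !par_cat j2 j3 j4 k3 k4 k5 l3 l4 pS /par /= /target pi1.
  move: om; rewrite odd_m4; have : (m %% 4 < 4)%N by rewrite ltn_mod.
  by case: (m %% 4)%N => [|[|[|[|]]]] //= _; case: (odd #|A|).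
have [//|[F1 [G1 [k1 k2 k3 k4 [k5 k6]]]]] := other _ h1.
have [//|[F2 [G2 [l1 l2 l3 l4 [l5 l6]]]]] := other _ h2.
have [//|[F3 [G3 [q1 q2 q3 q4 [q5 q6]]]]] := other _ h3.
have [|||T1 [C [T2 [j1 j2 j3 j4 j5]]]] := join_paths (Z := e3) k1 l1 _ k6 l5 _ isT.
- by apply/hasPn => z; rewrite l2 => hz; rewrite [mem _ _]k2 (disjointFl d12).
- by rewrite [last _ _]/= k4 l3.
- by case/setIdP: h3 => /kH -> _; rewrite addnn -mul2n leq_mul2r orbT.
have [|||T1' [C' [T2' [i1 i2 i3 i4 i5]]]] := join_paths (Z := set0) j1 q1 _ l6 q5 _ isT.
- apply/hasPn => z; rewrite q2 => hz.
  have -> : flatten (F1 :: ([:: G1] ++ [:: T1, C, T2, F2 & [:: G2]])) =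
    flatten [:: F1; G1] ++ (T1 ++ C ++ T2) ++ flatten [:: F2; G2] by rewrite /= !catA !cats0.
  rewrite [mem _ _]mem_cat k2 (disjointFl d13 hz) mem_cat l2 (disjointFl d23 hz) orbF /=.
  by apply/negP => /(hasPn j5); rewrite /= hz.
- by rewrite [last _ _]/= l4 q3.
- by rewrite cards0.
apply: (completion cs (P0 := F1) (P := [:: G1, T1, C, T2, F2, G2, T1', C', T2', F3 & [:: G3]])) => //.
rewrite /inv [last _ _]/= fin_mod4 m_sub //= !par_cat j2 j3 j4 i2 i3 i4 k3 k4 l3 l4 q3 q4 /par /= /target pi1.
move: om; rewrite odd_m4; have : (m %% 4 < 4)%N by rewrite ltn_mod.
by case: (m %% 4)%N => [|[|[|[|]]]] //= _; case: (odd #|A|).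
Qed.

End Configurations.

Local Close Scope ring_scope.

(** * Minimum degrees and the extremal family *)

Section MinDegree.
Variable T : finType.
Implicit Types (F H : {set {set T}}) (S : {set T}).

Lemma min_degree_le F d S : #|S| = d -> min_degree d F <= degree F S.
Proof.
move=> sS; rewrite /min_degree.
have : S \in index_enum {set T} by rewrite mem_index_enum.
elim: (index_enum _) => // S' s IH; rewrite inE big_cons => /orP[/eqP <-|h].
  by rewrite sS eqxx geq_minl.
by case: ifP => _; rewrite ?geq_min IH ?orbT.
Qed.

Lemma le_min_degree F d a : a <= #|F| -> (forall S, #|S| = d -> a <= degree F S) ->
  a <= min_degree d F.
Proof.
move=> h0 h; rewrite /min_degree; elim/big_rec: _ => // S b /eqP/h h1 h2.
by rewrite leq_min h1.
Qed.

Lemma exists_min_degree F d : d <= #|T| ->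
  exists2 S : {set T}, #|S| = d & degree F S = min_degree d F.
Proof.
move=> dT; have [|S0 _ s0] := @exists_subset _ [set: T] d; first by rewrite cardsT.
have p0 : #|S0| == d by apply/eqP.
case: (@arg_minnP _ S0 (fun S : {set T} => #|S| == d) (degree F) p0) => S /eqP sS hS.
exists S => //; apply/eqP; rewrite eqn_leq min_degree_le // andbT.
apply: le_min_degree => [|S' sS']; last by apply: hS; apply/eqP.
by apply: subset_leq_card; apply/subsetP => e; rewrite inE => /andP[].
Qed.

End MinDegree.

Section Relabel.
Variables (T U : finType) (f : T -> U).
Hypothesis f_bij : bijective f.
Let f_inj : injective f := bij_inj f_bij.

Lemma min_degree_imset (F : {set {set T}}) d : d <= #|T| ->
  min_degree d F <= min_degree d [set f @: (e : {set T}) | e in F].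
Proof.
have [g fg gf] := f_bij => dT.
have im_inj : injective (fun e : {set T} => f @: e) := imset_inj f_inj.
have img (S : {set U}) : f @: (g @: S) = S.
  by rewrite -imset_comp -[RHS]imset_id; apply: eq_imset => x /=; rewrite gf.
apply: le_min_degree => [|S sS].
  rewrite card_imset //; have [S sS <-] := exists_min_degree F dT.
  by apply: subset_leq_card; apply/subsetP => e; rewrite inE => /andP[].
have sS' : #|g @: S| = d by rewrite card_imset //; exact: can_inj gf.
apply: leq_trans (min_degree_le F sS') _.
rewrite /degree -(card_imset _ im_inj); apply: subset_leq_card.
apply/subsetP => _ /imsetP[e + ->]; rewrite !inE => /andP[eF Se].
by rewrite (mem_imset _ _ im_inj) eF /= -{1}(img S) imsetS.
Qed.

Lemma imset_Bpar k (A : {set T}) (P : pred nat) :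
  [set f @: (e : {set T}) | e in [set e : {set T} | (#|e| == k) && P #|e :&: A|]] =
  [set e : {set U} | (#|e| == k) && P #|e :&: f @: A|].
Proof.
have [g fg gf] := f_bij.
apply/setP => e'; apply/imsetP/idP => [[e + ->]|].
  by rewrite !inE (card_imset _ f_inj) -imsetI ?(card_imset _ f_inj) //; move=> ? ? _ _; apply: f_inj.
have img : e' = f @: (g @: e').
  by rewrite -imset_comp -[LHS]imset_id; apply: eq_imset => x /=; rewrite gf.
rewrite {1}img inE (card_imset _ f_inj) -imsetI ?(card_imset _ f_inj) //; last by move=> ? ? _ _; apply: f_inj.
by move=> h; exists (g @: e') => //; rewrite inE.
Qed.

Lemma imset_Bprime k (A : {set T}) v :
  [set f @: (e : {set T}) | e in Bprime k A v] = Bprime k (f @: A) (f v).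
Proof.
have [g fg gf] := f_bij.
rewrite /Bprime imsetU (imset_Bpar k A odd); congr (_ :|: _).
apply/setP => e'; apply/imsetP/idP => [[e + ->]|].
  by rewrite !inE card_imset // mem_imset // => /and3P[-> /imsetS-> ->].
have img : e' = f @: (g @: e').
  by rewrite -imset_comp -[LHS]imset_id; apply: eq_imset => x /=; rewrite gf.
rewrite {1}img inE (card_imset _ f_inj) => /and3P[h1 h2 h3].
exists (g @: e') => //; rewrite inE h1 /= -(mem_imset _ _ f_inj) h3 andbT.
apply/subsetP => x xe; rewrite -(mem_imset _ _ f_inj); apply: (subsetP h2).
by rewrite (mem_imset _ _ f_inj).
Qed.

Lemma Hext_imset k F : #|T| = #|U| -> F \in Hext T k ->
  [set f @: (e : {set T}) | e in F] \in Hext U k.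
Proof.
move=> TU; rewrite /Hext -TU; case: ifP => _.
  rewrite !inE => /orP[|] /imsetP[A + ->]; rewrite inE => hA.
    apply/orP; left; rewrite (imset_Bpar k A odd); apply/imsetP; exists (f @: A) => //.
    by rewrite inE card_imset.
  apply/orP; right; rewrite (imset_Bpar k A (fun a => ~~ odd a)).
  by apply/imsetP; exists (f @: A) => //; rewrite inE card_imset.
case: ifP => _; last by rewrite inE.
rewrite !inE => /orP[/imsetP[A _ ->]|/existsP[A /existsP[v /and3P[vA /eqP-> h]]]].
  by apply/orP; left; rewrite (imset_Bpar k A odd); apply/imsetP; exists (f @: A).
apply/orP; right; apply/existsP; exists (f @: A); apply/existsP; exists (f v).
by rewrite mem_imset // vA imset_Bprime eqxx card_imset.
Qed.

End Relabel.

Lemma min_degree_le_bar_delta (T : finType) k d (F : {set {set T}}) : d <= #|T| ->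
  F \in Hext T k -> min_degree d F <= bar_delta #|T| k d.
Proof.
move=> dT hF; have bij := @enum_rank_bij T.
apply: leq_trans (min_degree_imset bij F dT) _; rewrite /bar_delta.
by apply: (@leq_bigmax_cond _ _ (fun F => min_degree d F)); apply: Hext_imset; rewrite ?card_ord.
Qed.

Lemma colouring_perm (T : finType) (X : eqType) (c c' : T -> X) :
  (forall z, #|[set x | c x == z]| = #|[set x | c' x == z]|) ->
  exists s : {perm T}, forall x, c' (s x) = c x.
Proof.
move=> h; pose t (g : T -> X) := map_tuple g (enum_tuple T).
have cnt (g : T -> X) z : count_mem z (t g) = #|[set x | g x == z]|.
  rewrite /= count_map [in RHS]cardE [in RHS]/enum_mem size_filter enumT.
  by apply: eq_count => x; rewrite /= inE.
have : perm_eq (t c) (t c') by apply/allP => z _ /=; rewrite !cnt h.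
case/tuple_permP => p E.
have inj : injective (fun x : T => enum_val (p (enum_rank x)) : T).
  by move=> x y /enum_val_inj /perm_inj /enum_rank_inj.
exists (perm inj) => x; rewrite permE.
have : tnth (t c) (enum_rank x) = tnth [tuple tnth (t c') (p i) | i < #|T|] (enum_rank x).
  by rewrite (_ : t c = [tuple tnth (t c') (p i) | i < #|T|]) //; apply: val_inj.
have tE i : tnth (enum_tuple T) i = enum_val i by rewrite (tnth_nth (enum_default i)).
by rewrite tnth_mktuple !tnth_map !tE enum_rankK.
Qed.

Lemma card_bigcup_le (T I : finType) (P : pred I) (F : I -> {set T}) a :
  (forall i, P i -> #|F i| <= a) -> #|\bigcup_(i | P i) F i| <= #|[set i | P i]| * a.
Proof.
move=> h; rewrite cardsE -sum_nat_const; elim/big_rec2: _ => [|i b S Pi IH]; first by rewrite cards0.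
by apply: leq_trans (leq_card_setU _ _).1 _; apply: leq_add => //; apply: h.
Qed.


(** * Pairs of edges meeting in exactly half of their vertices *)

(** Deleting the common vertex turns sets of size 2l + 2 meeting in l + 1 points into sets of size
    2l + 1 meeting in l points. *)
Lemma forbidden_link l : exists K, forall (T : finType) (W : {set {set T}}) (c : T),
  (forall e, e \in W -> #|e| = l.+1.*2) -> (forall e, e \in W -> c \in e) ->
  K * #|T| ^ l < #|W| -> exists e1 e2 : {set T}, [/\ e1 \in W, e2 \in W & #|e1 :&: e2| = l.+1].
Proof.
have [K hK] := forbidden_intersection l; exists K => T W c sW cW.
have inj : {in W &, injective (fun e : {set T} => e :\ c)}.
  by move=> e1 e2 /cW h1 /cW h2 /= E; rewrite -(setD1K h1) -(setD1K h2) E.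
rewrite -(card_in_imset inj) => /hK[|e1' [e2' [/imsetP[e1 h1 ->] /imsetP[e2 h2 ->] hI]]].
  move=> _ /imsetP[e eW ->]; have := cardsD1 c e; rewrite cW // sW // doubleS add1n => -[] //.
exists e1, e2; split=> //; rewrite (cardsD1 c) inE !cW // add1n; congr S.
by rewrite -hI; apply: eq_card => z; rewrite !inE; case: (z == c).
Qed.

(** Greedily chosen disjoint members either reach three, or the union of the at most two found meets
    every member. *)
Lemma three_or_hit (T : finType) k (W : {set {set T}}) :
  (forall e, e \in W -> #|e| = k) ->
  (exists e1 e2 e3 : {set T}, [/\ [&& e1 \in W, e2 \in W & e3 \in W],
     [disjoint e1 & e2], [disjoint e1 & e3] & [disjoint e2 & e3]]) \/
  exists2 X : {set T}, #|X| <= k + k & forall e, e \in W -> ~~ [disjoint e & X].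
Proof.
move=> sW.
case: (set_0Vmem W) => [->|[e1 h1]]; first by right; exists set0; [rewrite cards0 | move=> e; rewrite inE].
have [/exists_inP[e2 h2 d12]|/exists_inPn n2] := boolP [exists e2 in W, [disjoint e1 & e2]]; last first.
  by right; exists e1; [rewrite sW // leq_addr | move=> e /n2; rewrite disjoint_sym].
have [/exists_inP[e3 h3 /andP[d13 d23]]|/exists_inPn n3] :=
    boolP [exists e3 in W, [disjoint e1 & e3] && [disjoint e2 & e3]].
  by left; exists e1, e2, e3; rewrite h1 h2 h3.
right; exists (e1 :|: e2).
  by apply: leq_trans (leq_card_setU _ _).1 _; rewrite !sW.
move=> e /n3; apply: contra => dj; rewrite ![[disjoint _ & e]]disjoint_sym.
by rewrite !(disjointWr _ dj) ?subsetUl ?subsetUr.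
Qed.

(* Pigeonhole over c in X: some W c contains a positive proportion of the P-sets. *)
Lemma cover_pair l d D : exists n0, forall (T : finType) (W : T -> {set {set T}}) (X : {set T}) (P : {set {set T}}),
  n0 <= #|T| -> (forall c e, e \in W c -> #|e| = l.+1.*2 /\ c \in e) ->
  #|X| <= 4 * l.+1 -> (forall S, S \in P -> #|S| = d) ->
  (forall S, S \in P -> exists2 c, c \in X & exists2 e, e \in W c & S \subset e) ->
  #|T| ^ l.+1 <= D * #|P| ->
  exists c (e1 e2 : {set T}), [/\ e1 \in W c, e2 \in W c & #|e1 :&: e2| = l.+1].
Proof.
have [K hK] := forbidden_link l.
have [q hq] : exists q, forall (T : finType) (e : {set T}), #|e| = l.+1.*2 -> #|powerset e| = q.
  by exists (2 ^ l.+1.*2) => T e <-; rewrite card_powerset.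
exists (D * (4 * l.+1 * (K * q))).+1 => T W X P n0 hW hX hP cov hD.
have [/exists_inP[c cX big]|/exists_inPn small] := boolP [exists c in X, K * #|T| ^ l < #|W c|].
  by have [| |e1 [e2 h]] := hK T (W c) c _ _ big; [by move=> e /hW[] | by move=> e /hW[] | exists c, e1, e2].
suff : #|T| ^ l.+1 <= D * (4 * l.+1 * (K * q)) * #|T| ^ l.
  by rewrite expnS leq_pmul2r ?expn_gt0 ?(leq_trans _ n0) // leqNgt n0.
apply: leq_trans hD _; rewrite -mulnA leq_mul2l; apply/orP; right.
have sub : P \subset \bigcup_(c in X) \bigcup_(e in W c) powerset e.
  apply/subsetP => S /cov[c cX [e eW Se]]; apply/bigcupP; exists c => //.
  by apply/bigcupP; exists e => //; rewrite powersetE.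
apply: leq_trans (subset_leq_card sub) _.
apply: leq_trans (card_bigcup_le (a := K * #|T| ^ l * q) _) _ => [c cX|].
  apply: leq_trans (card_bigcup_le (a := q) _) _ => [e /hW[/hq-> _]//|].
  by rewrite leq_mul2r cardsE; have := small c cX; rewrite -leqNgt => ->; rewrite orbT.
by rewrite cardsE mulnAC mulnA leq_mul2r leq_mul2r hX !orbT.
Qed.

(** The j points in [A] and the d - j others are chosen from sets that retain #|T| / 8 points even
    after the removal of [X] and of d more points. *)
Lemma many_typed (T : finType) (A X : {set T}) d M j : j <= d -> 8 * (M + d) <= #|T| ->
  #|T| <= 4 * #|A| -> #|T| <= 4 * #|~: A| -> #|X| <= M ->
  #|T| ^ d <= 8 ^ d * (d`! * d`!) *
    #|[set S : {set T} | [&& #|S| == d, #|S :&: A| == j & [disjoint S & X]]]|.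
Proof.
move=> jd n0 nA nB hX.
pose dr (Y : {set T}) i := [set U : {set T} | U \subset Y & #|U| == i].
pose Y := A :\: X; pose Z := ~: A :\: X.
have big (B : {set T}) i : #|T| <= 4 * #|B| -> i <= d -> #|T| ^ i <= 8 ^ i * (d`! * 'C(#|B :\: X|, i)).
  move=> nB' id; apply: (@leq_trans ((8 * (#|B :\: X| - i)) ^ i)).
    have h : #|B| <= #|B :\: X| + M by rewrite -(cardsID X B) addnC leq_add2l; apply: leq_trans hX; apply: subset_leq_card; apply: subsetIr.
    have : #|T| <= 8 * (#|B :\: X| - i) by move: h nB' id n0; clear; set b := #|_|; set c := #|_|; set t := #|_|; lia.
    by case: (i) => // i' ?; rewrite leq_exp2r.
  rewrite expnMn leq_mul2l; apply/orP; right; apply: leq_trans (expn_le_bin _ _) _.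
  by rewrite mulnC leq_mul2r; apply/orP; right; exact: leq_fact.
have hj := big _ _ nA jd; have hdj := big _ _ nB (leq_subr j d).
have : 'C(#|Y|, j) * 'C(#|Z|, d - j) <= #|[set S : {set T} | [&& #|S| == d, #|S :&: A| == j & [disjoint S & X]]]|.
  rewrite -!cards_draws -cardsX.
  have inA (U V : {set T}) : U \subset Y -> V \subset Z -> (U :|: V) :&: A = U /\ (U :|: V) :\: A = V.
    move=> /subsetP hU /subsetP hV; split; apply/setP => z; rewrite !inE.
      have := hU z; have := hV z; rewrite !inE; case: (z \in U); case: (z \in V); case: (z \in A); case: (z \in X) => //= h1 h2; first [by have := h1 isT | by have := h2 isT].
    have := hU z; have := hV z; rewrite !inE; case: (z \in U); case: (z \in V); case: (z \in A); case: (z \in X) => //= h1 h2; first [by have := h1 isT | by have := h2 isT].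
  rewrite -(card_in_imset (f := fun UV : {set T} * {set T} => UV.1 :|: UV.2)); last first.
    move=> [U V] [U' V']; rewrite !inE /= => /andP[/andP[a1 _] /andP[a2 _]] /andP[/andP[b1 _] /andP[b2 _]] E.
    have [u v] := inA _ _ a1 a2; have [u' v'] := inA _ _ b1 b2; move: E => /= E.
    by congr pair; [rewrite -u E u' | rewrite -v E v'].
  apply: subset_leq_card; apply/subsetP => _ /imsetP[[U V] + ->]; rewrite !inE /=.
  move=> /andP[/andP[a1 /eqP c1] /andP[a2 /eqP c2]]; have [i1 i2] := inA _ _ a1 a2.
  rewrite -(cardsID A (U :|: V)) i1 i2 c1 c2 subnKC // !eqxx /=.
  have dY (B : {set T}) : [disjoint B :\: X & X] by rewrite -setI_eq0; apply/eqP/setP => z; rewrite !inE; case: (z \in X); rewrite ?andbF.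
  rewrite -setI_eq0 setIUl setU_eq0 !setI_eq0.
  by rewrite (disjointWl a1 (dY _)) (disjointWl a2 (dY _)).
move=> h; rewrite -{1 2}(subnKC jd) !expnD.
apply: leq_trans (leq_mul hj hdj) _.
rewrite mulnACA -[X in _ <= X]mulnA leq_mul2l; apply/orP; right; rewrite mulnACA leq_mul2l; apply/orP; right.
exact: h.
Qed.

Definition three_disjoint (T : finType) (W : {set {set T}}) := exists e1 e2 e3 : {set T},
  [/\ [&& e1 \in W, e2 \in W & e3 \in W],
     [disjoint e1 & e2], [disjoint e1 & e3] & [disjoint e2 & e3]].

(** Without three disjoint members, a bounded set meets every member of [W] and [cover_pair]
    applies. The positive proportion of d-sets supplied by [many_typed] reaches order n^(l+1)
    because l < d. *)
Lemma pair_of_cover l d : l < d -> exists n0, forall (T : finType) (A : {set T}) (W : {set {set T}}) j,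
  n0 <= #|T| -> #|T| <= 4 * #|A| -> #|T| <= 4 * #|~: A| ->
  (forall e, e \in W -> #|e| = l.+1.*2) -> j <= d ->
  (forall S : {set T}, #|S| = d -> #|S :&: A| = j -> exists2 e, e \in W & S \subset e) ->
  (exists e1 e2 : {set T}, [/\ e1 \in W, e2 \in W & #|e1 :&: e2| = l.+1]) \/ three_disjoint W.
Proof.
move=> ld; pose M := 4 * l.+1.
have [n1 h1] := cover_pair l d (8 ^ d * (d`! * d`!)).
exists (maxn 1 (maxn n1 (8 * (M + d)))) => T A W j; rewrite !geq_max => /and3P[T0 hn1 hn2] nA nB sW jd cov.
have [h3|[X hX hit]] := three_or_hit sW; first by right.
left; have {}hX : #|X| <= M by rewrite /M -(mul2n l.+1) addnn -mul2n mulnA in hX *.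
have cnt := many_typed jd hn2 nA nB hX.
pose W' (c : T) := [set e in W | c \in e].
have [c [e1 [e2 [k1 k2 k3]]]] : exists c (e1 e2 : {set T}), [/\ e1 \in W' c, e2 \in W' c & #|e1 :&: e2| = l.+1].
  apply: (h1 T W' X _ hn1 _ hX _ _ (leq_trans _ cnt)).
- by move=> c e; rewrite inE => /andP[/sW].
- by move=> S; rewrite inE => /and3P[/eqP].
- move=> S; rewrite inE => /and3P[/eqP s1 /eqP s2 _]; have [e eW Se] := cov S s1 s2.
  have /pred0Pn[c /andP[ce cX]] := hit e eW.
  by exists c => //; exists e => //; rewrite inE eW.
- by rewrite leq_pexp2l.
by move: k1 k2; rewrite !inE => /andP[k1 _] /andP[k2 _]; exists e1, e2.
Qed.

(** Of the q + 1 vertices outside [S], two are prescribed and q - 1 remain free. *)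
Lemma card_extensions (T : finType) (S : {set T}) c y q : c != y -> c \notin S -> y \notin S ->
  #|[set e : {set T} | [&& #|e| == #|S| + q.+1, S \subset e, c \in e & y \in e]]| * #|T| <= #|T| ^ q.
Proof.
move=> cy cS yS; set E := [set e | _].
pose Z := c |: (y |: S).
have sZ : #|Z| = #|S|.+2 by rewrite !cardsU1 !inE negb_or cy cS yS.
have hE e : e \in E -> Z \subset e /\ #|e :\: Z| + 1 = q.
  rewrite inE => /and4P[/eqP se Se ce ye].
  have Ze : Z \subset e by rewrite !subUset !sub1set ce ye.
  split=> //; have := cardsID Z e; rewrite (setIidPr Ze) sZ se; clear; lia.
case: q E hE => [|q] E hE.
  have -> : E = set0 by apply/setP => e; rewrite in_set0; apply/negP => /hE[_]; rewrite addn1.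
  by rewrite cards0.
rewrite expnSr leq_mul2r; apply/orP; right.
have inj : {in E &, injective (fun e => e :\: Z)}.
  move=> e e' /hE[h _] /hE[h' _] /= E'; rewrite -(setID e Z) -(setID e' Z) E'.
  by rewrite (setIidPr h) (setIidPr h').
rewrite -(card_in_imset inj); apply: (leq_trans _ (bin_le_expn _ _)).
rewrite -card_draws; apply: subset_leq_card; apply/subsetP => _ /imsetP[e /hE[_ h] ->].
by rewrite inE -eqSS -[X in X == _]addn1 h.
Qed.

(* Most edges of W through a d-set S have exactly one vertex c in a bounded set
   hitting W and avoid e_ c outside c; by pigeonhole many of them share c. *)
Lemma pair_avoiding l d q : l < d -> d + q.+1 = l.+1.*2 ->
  exists n0, forall (T : finType) (X : {set T}) (W : {set {set T}}) (e_ : T -> {set T}),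
  n0 <= #|T| -> #|T| <= 4 * #|X| -> #|T| <= 4 * #|~: X| ->
  (forall e, e \in W -> #|e| = l.+1.*2 /\ e \subset X) ->
  (forall c, c \in X -> e_ c \in W /\ c \notin e_ c) ->
  (forall S : {set T}, #|S| = d -> S \subset X ->
     'C(#|X| - d.+1, q) < #|[set e in W | S \subset e]|) ->
  (exists e1 e2 e3 : {set T}, [/\ [&& e1 \in W, e2 \in W & e3 \in W],
     #|e1 :&: e2| = l.+1, [disjoint e1 & e3] & [disjoint e2 & e3]]) \/ three_disjoint W.
Proof.
move=> ld dq; pose M := 4 * l.+1.
have [n1 h1] := cover_pair l d (8 ^ d * (d`! * d`!)).
pose N := M + M * l.+1.*2.
exists (maxn 1 (maxn n1 (8 * (N + d + q.+1) + (8 ^ q * q`! * (M * (M * l.+1.*2))).+1))).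
move=> T X W e_; rewrite !geq_max => /and3P[T0 hn1 hn2] nX nX' hW he deg.
have hn3 : 8 * (N + d) <= #|T| by apply: leq_trans hn2; apply: leq_trans (leq_addr _ _); rewrite leq_mul2l leq_addr orbT.
have hn4 : 8 ^ q * q`! * (M * (M * l.+1.*2)) < #|T| by apply: leq_trans hn2; rewrite leq_addl.
have hn5 : #|T| <= 8 * (#|X| - d.+1 - q).
  have : 8 * (d + q.+1) <= #|T| by apply: leq_trans hn2; apply: leq_trans (leq_addr _ _); rewrite leq_mul2l -addnA leq_addl orbT.
  move: nX; clear; set b := #|_|; set t := #|_|; lia.
have sW e : e \in W -> #|e| = l.+1.*2 by case/hW.
have [h3|[X0 hX0 hit]] := three_or_hit sW; first by right.
left; have {}hX0 : #|X0| <= M by rewrite /M -(mul2n l.+1) addnn -mul2n mulnA in hX0 *.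
pose Y := \bigcup_(c in X0 :&: X) e_ c.
have hY : #|Y| <= M * l.+1.*2.
  apply: leq_trans (card_bigcup_le (a := l.+1.*2) _) _ => [c|].
    by rewrite inE => /andP[_ /he[/sW-> _]].
  rewrite leq_mul2r cardsE; apply/orP; right; apply: leq_trans hX0; apply: subset_leq_card; exact: subsetIl.
have hXY : #|X0 :|: Y| <= N.
  by apply: leq_trans (leq_card_setU _ _).1 _; apply: leq_add.
have cnt := many_typed (leqnn d) hn3 nX nX' hXY.
pose W' (c : T) := [set e in W | [&& c \in X, c \in e & [disjoint e & e_ c]]].
have [c [e1 [e2 [k1 k2 k3]]]] : exists c (e1 e2 : {set T}), [/\ e1 \in W' c, e2 \in W' c & #|e1 :&: e2| = l.+1].
  apply: (h1 T W' X0 _ hn1 _ hX0 _ _ (leq_trans _ cnt)).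
- by move=> c e; rewrite inE => /and4P[/sW].
- by move=> S; rewrite inE => /and3P[/eqP].
- move=> S; rewrite inE => /and3P[/eqP s1 /eqP s2 dS].
  have SX : S \subset X.
    by apply/setIidPl/eqP; rewrite eqEcard subsetIl s1 s2 /=.
  (* Edges through [S] with one vertex c in [X0] and another in [Y] have two vertices in bounded
     sets, so there are only order n^(q-1) of them, while the assumed degree has order n^q. *)
  pose B := \bigcup_(cy in [set cy : T * T | [&& cy.1 \in X0, cy.2 \in Y & cy.1 != cy.2]])
     [set e : {set T} | [&& #|e| == #|S| + q.+1, S \subset e, cy.1 \in e & cy.2 \in e]].
  have [/exists_inP[c cX /exists_inP[e h Se]]|none] :=
    boolP [exists c in X0, exists e in W' c, S \subset e]; first by exists c => //; exists e.
  have sub : [set e in W | S \subset e] \subset B.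
    apply/subsetP => e; rewrite inE => /andP[eW Se].
    have /pred0Pn[c /andP[/= ce cX0]] := hit e eW.
    have cX : c \in X by have [_ /subsetP] := hW e eW; apply.
    have [] := he c cX => _ cec.
    have : ~~ [disjoint e & e_ c].
      apply: contra none => dj; apply/exists_inP; exists c => //; apply/exists_inP; exists e => //.
      by rewrite inE eW cX ce.
    case/pred0Pn => y /= /andP[ye yec]; apply/bigcupP; exists (c, y); rewrite inE /= ?cX0 /=.
      apply/andP; split; last by apply/eqP => /= E; rewrite -E (negbTE cec) in yec.
      by apply/bigcupP; exists c => //; rewrite inE cX0.
    by rewrite (sW e eW) s1 dq eqxx Se ce ye.
  have Bn : #|B| * #|T| <= M * (M * l.+1.*2) * #|T| ^ q.
    apply: (@leq_trans (M * (M * l.+1.*2) * (#|T| ^ q %/ #|T|) * #|T|)); last first.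
      by rewrite -mulnA leq_mul2l leq_trunc_div orbT.
    rewrite leq_mul2r; apply/orP; right.
    apply: leq_trans (card_bigcup_le (a := #|T| ^ q %/ #|T|) _) _ => [[c y]|].
      rewrite inE /= => /and3P[cX yY cy]; rewrite leq_divRL //.
      have nS z : z \in X0 :|: Y -> z \notin S by move=> zXY; rewrite (disjointFl dS).
      by apply: card_extensions; rewrite ?nS // inE ?cX ?yY ?orbT.
    rewrite leq_mul2r; apply/orP; right; apply: leq_trans (leq_mul hX0 hY).
    rewrite cardsE -cardsX; apply: subset_leq_card; apply/subsetP => cy.
    by rewrite !inE => /and3P[-> -> _].
  have lt := leq_trans (deg S s1 SX) (subset_leq_card sub).
  have lb := expn_le_bin (#|X| - d.+1) q.
  have : #|T| * #|T| ^ q <= 8 ^ q * q`! * (M * (M * l.+1.*2)) * #|T| ^ q.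
    rewrite -mulnA; apply: leq_trans (leq_mul (leqnn _) Bn).
    rewrite mulnC mulnA leq_mul2r; apply/orP; right.
    apply: (@leq_trans ((8 * (#|X| - d.+1 - q)) ^ q)).
      by case: (q) hn5 => // q' hn5; rewrite leq_exp2r.
    rewrite expnMn -mulnA leq_mul2l; apply/orP; right; apply: leq_trans lb _.
    by rewrite mulnC leq_mul2l (ltnW lt) orbT.
  by rewrite leq_mul2r expn_eq0 -[#|T| == 0]negbK -lt0n T0 /= leqNgt hn4.
- by rewrite leq_pexp2l.
move: k1 k2; rewrite !inE => /and4P[k1 cX _ d1] /and4P[k2 _ _ d2].
exists e1, e2, (e_ c); split=> //; rewrite k1 k2 /=; by have [] := he c cX.
Qed.

(** * Wrong edges forced by degrees above the extremal value *)

Section DegreeExcess.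
Variables (T : finType) (k : nat).
Implicit Types (A S e : {set T}) (H : {set {set T}}).

Definition parity_class A (pi : bool) := [set e : {set T} | (#|e| == k) && (odd #|e :&: A| == pi)].

Lemma Bodd_parity A : Bodd k A = parity_class A true.
Proof. by apply/setP => e; rewrite !inE eqb_id. Qed.

Lemma Beven_parity A : Beven k A = parity_class A false.
Proof. by apply/setP => e; rewrite !inE eqbF_neg. Qed.

Lemma perm_of_types A S S' : #|S| = #|S'| -> #|S :&: A| = #|S' :&: A| ->
  exists s : {perm T}, s @: A = A /\ s @: S' = S.
Proof.
move=> eS eSA.
pose c (Y : {set T}) x := (x \in A, x \in Y).
have cc Y z : #|[set x | c Y x == z]| =
    if z.1 then (if z.2 then #|Y :&: A| else #|A| - #|Y :&: A|)
    else (if z.2 then #|Y| - #|Y :&: A| else #|~: A| - (#|Y| - #|Y :&: A|)).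
  case: z => [[] []] /=; rewrite /c -?cardsD.
  - by apply: eq_card => x; rewrite !inE xpair_eqE !eqb_id andbC.
  - by rewrite setIC -cardsD; apply: eq_card => x; rewrite !inE xpair_eqE eqb_id eqbF_neg andbC.
  - by apply: eq_card => x; rewrite !inE xpair_eqE eqb_id eqbF_neg.
  - have -> : #|Y :\: A| = #|~: A :&: Y| by apply: eq_card => x; rewrite !inE.
    by rewrite -cardsD; apply: eq_card => x; rewrite !inE xpair_eqE !eqbF_neg andbC.
have [z|s hs] := @colouring_perm T _ (c S') (c S); first by rewrite !cc eS eSA.
have im (Y Z : {set T}) : (forall x, (s x \in Z) = (x \in Y)) -> s @: Y = Z.
  move=> h; apply/setP => x; rewrite -[x](permKV s) mem_imset ?h //; exact: perm_inj.
by exists s; split; apply: im => x; have [] := hs x.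
Qed.

(** A permutation preserving [A] carries [S'] to [S]. By symmetry the degrees are equal: they depend
    only on the type of the set. *)
Lemma degree_parity_class A pi S S' : #|S| = #|S'| -> #|S :&: A| = #|S' :&: A| ->
  degree (parity_class A pi) S' <= degree (parity_class A pi) S.
Proof.
move=> eS eSA; have [s [sA sS]] := perm_of_types eS eSA.
have inj : injective (fun e : {set T} => s @: e) by apply: imset_inj; exact: perm_inj.
rewrite /degree -(card_imset _ inj); apply: subset_leq_card; apply/subsetP => _ /imsetP[e + ->].
rewrite !inE => /andP[/andP[/eqP he pe] Se].
have -> : (s @: e) :&: A = s @: (e :&: A).
  by rewrite -{1}sA imsetI // => ? ? _ _; apply: perm_inj.
by rewrite !card_imset ?he ?pe ?eqxx /= -?sS ?imsetS //; exact: perm_inj.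
Qed.

Lemma exceeding_edge H F d S : bar_delta #|T| k d < min_degree d H -> d <= #|T| ->
  F \in Hext T k -> #|S| = d -> degree F S <= min_degree d F ->
  exists e, [/\ e \in H, S \subset e & e \notin F].
Proof.
move=> hH dT hF sS hS.
have lt : degree F S < degree H S.
  apply: leq_ltn_trans hS _; apply: leq_ltn_trans (min_degree_le_bar_delta dT hF) _.
  by apply: leq_trans hH _; apply: min_degree_le.
have /subsetPn[e] : ~~ ([set e in H | S \subset e] \subset [set e in F | S \subset e]).
  by apply: contraL lt => /subset_leq_card; rewrite -leqNgt.
by rewrite !inE => /andP[eH Se]; rewrite Se andbT => ?; exists e.
Qed.

(** The type is that of a d-set of minimum degree in the parity class. All sets of this type share
    that degree, which is at most [bar_delta], so [H] has an edge outside the class at each of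
    them. *)
Lemma covered_by_wrong H A pi d : kgraph k H -> bar_delta #|T| k d < min_degree d H -> d <= #|T| ->
  parity_class A pi \in Hext T k ->
  exists2 j, j <= d & (exists2 S : {set T}, #|S| = d & #|S :&: A| = j) /\
   forall S : {set T}, #|S| = d -> #|S :&: A| = j -> exists2 e, e \in wrong H A pi & S \subset e.
Proof.
move=> kH hH dT hF; have [S0 s0 e0] := exists_min_degree (parity_class A pi) dT.
exists #|S0 :&: A|; first by rewrite -s0 subset_leq_card ?subsetIl.
split; first by exists S0.
move=> S sS sSA; have [|e [eH Se]] := exceeding_edge hH dT hF sS.
  by rewrite -e0; apply: degree_parity_class; rewrite ?sS.
by rewrite inE kH // eqxx /= => ne; exists e => //; rewrite inE eH.
Qed.

End DegreeExcess.

Lemma half_odd m : odd m./2 = (1 < m %% 4).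
Proof. by move: (divn_eq m 4) (ltn_mod m 4); clear; set q := m %/ 4; set u := m %% 4; lia. Qed.

Section Multiples.
Variables (T : finType) (r m : nat).
Hypotheses (r_gt0 : 0 < r) (hT : #|T| = r * m).

Lemma dvd_double : (r + r %| #|T|) = ~~ odd m.
Proof. by rewrite hT addnn -muln2 dvdn_pmul2l // dvdn2. Qed.

Lemma div_double : #|T| %/ (r + r) = m./2.
Proof. by rewrite hT addnn -muln2 divnMl // divn2. Qed.

Lemma parity_class_Hext_even (A : {set T}) pi : ~~ odd m -> odd #|A| != (pi && (1 < m %% 4)) ->
  parity_class (r + r) A pi \in Hext T (r + r).
Proof.
move=> em hA; rewrite /Hext dvd_double em div_double inE.
case: pi hA => /= hA; last first.
  apply/orP; right; apply/imsetP; exists A; last by rewrite Beven_parity.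
  by rewrite inE; case: odd hA.
apply/orP; left; apply/imsetP; exists A; last by rewrite Bodd_parity.
by rewrite inE /odd_diff half_odd; move: hA; case: odd; case: (1 < _).
Qed.

Lemma parity_class_Hext_odd (A : {set T}) : odd m -> parity_class (r + r) A true \in Hext T (r + r).
Proof.
move=> om; rewrite /Hext dvd_double om /= addnn doubleK hT dvdn_mulr // inE.
by apply/orP; left; apply/imsetP; exists A; rewrite // Bodd_parity.
Qed.

(** For k = 2r, 4 divides k exactly when r is even, and n / k rounds down to [m./2]; the hypothesis
    merges the two cases in the definition of [Hext]. *)
Lemma Bprime_Hext (A : {set T}) v : odd m -> v \in A -> (odd #|A| (+) (1 < m %% 4)) = ~~ odd r ->
  Bprime (r + r) A v \in Hext T (r + r).
Proof.
move=> om vA h; rewrite /Hext dvd_double om /= addnn doubleK hT dvdn_mulr // -hT inE.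
apply/orP; right; rewrite inE; apply/existsP; exists A; apply/existsP; exists v.
rewrite vA eqxx -addnn div_double /odd_diff half_odd addbC h addnn -muln2.
rewrite -[4]/(2 * 2) dvdn_pmul2r // dvdn2 dvdn_mull //=.
by case: (odd r).
Qed.

End Multiples.

Lemma even_configuration r1 d : r1 < d -> d <= r1.+1 + r1.+1 ->
  exists n0, forall (T : finType) (H : {set {set T}}) (A : {set T}) pi m,
  n0 <= #|T| -> #|T| <= 4 * #|A| -> #|T| <= 4 * #|~: A| -> kgraph (r1.+1 + r1.+1) H ->
  #|T| = r1.+1 * m -> ~~ odd m -> odd #|A| != (pi && (1 < m %% 4)) ->
  bar_delta #|T| (r1.+1 + r1.+1) d < min_degree d H ->
  pair_in H A pi r1 \/ three_in H A pi.
Proof.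
move=> rd dk; have [n0 hn] := pair_of_cover rd; exists (maxn d n0) => T H A pi m.
rewrite geq_max => /andP[dT n0T] nA nB kH hT em hA hH.
have [j jd [_ cov]] := covered_by_wrong kH hH dT (parity_class_Hext_even (ltn0Sn r1) hT em hA).
apply: (hn T A (wrong H A pi) j) => // e; rewrite inE => /andP[/kH-> _]; by rewrite addnn.
Qed.

(** An edge with a vertex in [A] and one outside contains two r-sets that differ by exchanging these
    vertices, hence have different parities. *)
Lemma wrong_one_sided (T : finType) (H : {set {set T}}) (A e : {set T}) pi r1 p :
  kgraph (r1.+1 + r1.+1) H -> e \in wrong H A pi ->
  (forall S : {set T}, S \subset e -> #|S| = r1.+1 -> odd #|S :&: A| = p) ->
  (e \subset A /\ odd r1.+1 = p) \/ (e \subset ~: A /\ p = false).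
Proof.
rewrite inE => kH /andP[/kH se _] hp.
have [S Se sS] : exists2 S : {set T}, S \subset e & #|S| = r1.+1.
  by apply: exists_subset; rewrite se leq_addr.
have [eA|/subsetPn[b be bA]] := boolP (e \subset A).
  by left; split=> //; rewrite -(hp S) // -sS (setIidPl (subset_trans Se eA)).
have [eA|/subsetPn[a ae]] := boolP (e \subset ~: A).
  right; split=> //; rewrite -(hp S) //.
  suff -> : S :&: A = set0 by rewrite cards0.
  by apply/eqP; rewrite setI_eq0 disjoints_subset (subset_trans Se eA).
rewrite inE negbK => aA.
have ab : a != b by apply: contraNneq bA => <-.
have [|U Ue sU] := @exists_subset _ (e :\: [set a; b]) r1.
  have := cardsID [set a; b] e; have : #|e :&: [set a; b]| <= 2.
    by apply: leq_trans (subset_leq_card (subsetIr _ _)) _; rewrite cards2 ab.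
  rewrite se; clear; lia.
have nU c : c \in [set a; b] -> c \notin U.
  by move=> h; apply/negP => /(subsetP Ue); rewrite inE h.
have aU := nU a (set21 _ _); have bU := nU b (set22 _ _).
have Ue' : U \subset e := subset_trans Ue (subsetDl _ _).
have := hp (a |: U); rewrite subUset sub1set ae Ue' cardsU1 aU sU => /(_ isT erefl).
have := hp (b |: U); rewrite subUset sub1set be Ue' cardsU1 bU sU => /(_ isT erefl).
have -> : (b |: U) :&: A = U :&: A.
  by apply/setP => z; rewrite !inE; case: eqP => // ->; rewrite (negbTE bA) !andbF.
have -> : (a |: U) :&: A = a |: (U :&: A).
  by apply/setP => z; rewrite !inE; case: eqP => // ->; rewrite aA.
by rewrite cardsU1 inE (negbTE aU) /= => ->; case: p {hp}.
Qed.

(** The surplus counts the k-subsets of [X] containing [S] and [v]; they are outside [Bodd] because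
    k is even. *)
Lemma degree_Bprime (T : finType) k (X S : {set T}) v q :
  ~~ odd k -> S \subset X -> v \in X -> v \notin S -> #|S| + q.+1 = k ->
  degree (Bodd k X) S + 'C(#|X| - #|S|.+1, q) <= degree (Bprime k X v) S.
Proof.
move=> ek SX vX vS sk; pose Z := v |: S.
have sZ : #|Z| = #|S|.+1 by rewrite cardsU1 vS.
have ZX : Z \subset X by rewrite subUset sub1set vX.
pose D := [set U : {set T} | U \subset X :\: Z & #|U| == q].
have DI U : U \in D -> U :&: Z = set0 /\ #|U :|: Z| = k.
  rewrite inE => /andP[/subsetP UX /eqP sU].
  have E : U :&: Z = set0.
    by apply/setP => z; rewrite in_set0 in_setI; apply/negP => /andP[/UX]; rewrite inE => /andP[/negbTE->].
  by split=> //; rewrite cardsU E cards0 subn0 sU sZ -sk addnC addSnnS.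
have inj : {in D &, injective (fun U => U :|: Z)}.
  move=> U V hU hV /= E; have [hU' _] := DI _ hU; have [hV' _] := DI _ hV.
  have sub (Y : {set T}) : Y :&: Z = set0 -> (Y :|: Z) :\: Z = Y.
    by move=> h; rewrite setDUl setDv setU0; apply/setDidPl; rewrite -setI_eq0 h.
  by rewrite -(sub _ hU') -(sub _ hV') E.
have -> : 'C(#|X| - #|S|.+1, q) = #|[set U :|: Z | U in D]|.
  by rewrite (card_in_imset inj) cards_draws cardsD (setIidPr ZX) sZ.
have dj : [disjoint [set e in Bodd k X | S \subset e] & [set U :|: Z | U in D]].
  rewrite -setI_eq0; apply/eqP/setP => e; rewrite in_set0; apply/negP.
  rewrite in_setI => /andP[+ /imsetP[U hU E]].
  rewrite E !inE; have [_ ->] := DI _ hU.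
  have /setIidPl-> : U :|: Z \subset X.
    move: hU; rewrite inE subUset ZX andbT => /andP[/subset_trans h _]; apply: h; exact: subsetDl.
  by have [_ ->] := DI _ hU; rewrite (negbTE ek) andbF.
have -> : #|[set e in Bodd k X | S \subset e]| + #|[set U :|: Z | U in D]| =
    #|[set e in Bodd k X | S \subset e] :|: [set U :|: Z | U in D]|.
  by rewrite cardsU (disjoint_setI0 dj) cards0 subn0.
apply: subset_leq_card; apply/subsetP => e; rewrite in_setU => /orP[|/imsetP[U hU ->]].
  by rewrite !inE => /andP[-> ->].
rewrite /Bprime in_set in_setU; apply/andP; split; last first.
  by apply: subset_trans (subsetUr _ _); apply: subsetUr.
apply/orP; right; have [_ sU] := DI _ hU; rewrite inE sU eqxx subUset ZX andbT /=.
move: hU; rewrite !inE eqxx orbT andbT => /andP[/subset_trans h _]; apply: h; exact: subsetDl.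
Qed.

(* If no wrong edge has a half of the target parity, all wrong edges lie on one
   side of the partition, and so do the d-sets of minimum degree in Bodd. With X
   that side, Bprime X v is in Hext for all v in X, and comparing degrees with it
   gives a wrong edge outside X, or for each v one inside X avoiding v. *)
Lemma odd_configuration r1 d : r1 < d -> d < r1.+1 + r1.+1 ->
  exists n0, forall (T : finType) (H : {set {set T}}) (A : {set T}) m,
  n0 <= #|T| -> #|T| <= 4 * #|A| -> #|T| <= 4 * #|~: A| -> kgraph (r1.+1 + r1.+1) H ->
  #|T| = r1.+1 * m -> odd m ->
  bar_delta #|T| (r1.+1 + r1.+1) d < min_degree d H ->
  half_in H A true r1 (target A m) \/ pair_disjoint_in H A true r1 \/ three_in H A true.
Proof.
move=> rd dk; set k := r1.+1 + r1.+1; have kE : k = r1.+1.*2 by rewrite /k addnn.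
have ek : ~~ odd k by rewrite kE odd_double.
pose q := k - d.+1; have dq : d + q.+1 = k by rewrite /q; move: dk; rewrite -/k; clear; lia.
have d0 : 0 < d by apply: leq_trans rd.
have [n1 h1] := pair_of_cover rd; have [n2 h2] := pair_avoiding rd (etrans dq kE).
exists (maxn d (maxn n1 n2)) => T H A m; rewrite !geq_max => /and3P[dT hn1 hn2] nA nB kH hT om hH.
set W := wrong H A true.
have sW e : e \in W -> #|e| = k by rewrite inE => /andP[/kH].
have [/exists_inP[e eW /existsP[S /and3P[Se /eqP sS /eqP pS]]]|none] :=
  boolP [exists e in W, [exists S : {set T}, [&& S \subset e, #|S| == r1.+1 & odd #|S :&: A| == target A m]]].
  by left; exists e, S.
right.
have side e : e \in W -> (e \subset A /\ odd r1.+1 = ~~ target A m) \/ (e \subset ~: A /\ ~~ target A m = false).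
  move=> eW; apply: (wrong_one_sided kH eW) => S Se sS.
  move/exists_inPn/(_ e eW): none; rewrite negb_exists => /forallP/(_ S).
  by rewrite Se sS eqxx /=; case: (odd _); case: (target A m).
(* Stated for a general side [X], to be used with [A] and with its complement: for even k both
   define the same [Bodd]. *)
have finish (X : {set T}) :
    (forall S : {set T}, #|S| = d -> S \subset X -> exists2 e, e \in W & (S \subset e)) ->
    odd #|X| (+) (1 < m %% 4) = ~~ odd r1.+1 ->
    (forall e, e \in W -> e \subset X \/ e \subset ~: X) -> Bodd k X = Bodd k A ->
    #|T| <= 4 * #|X| -> #|T| <= 4 * #|~: X| -> pair_disjoint_in H A true r1 \/ three_in H A true.
  move=> cov pX sideX BX nX nX'.
  have inW F v e : F = Bprime k X v -> e \in H -> e \notin F -> e \in W.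
    move=> -> eH; rewrite in_setU negb_or BX => /andP[+ _].
    by rewrite !inE eH kH // eqxx /=; case: (odd _).
  have covX (S : {set T}) e : #|S| = d -> S \subset X -> e \in W -> S \subset e -> e \subset X.
    move=> sS SX /sideX[]// eX Se; move: d0; rewrite -sS.
    suff -> : S = set0 by rewrite cards0.
    apply/eqP; rewrite -subset0 -(setICr X) subsetI SX; exact: subset_trans Se eX.
  have [/exists_inP[e0 e0W e0X]|/exists_inPn nob] := boolP [exists e in W, e \subset ~: X].
    pose WX := [set e in W | e \subset X].
    have WXW e : e \in WX -> e \in W by rewrite inE => /andP[].
    have WXd e : e \in WX -> [disjoint e & e0].
      rewrite inE => /andP[_ eX]; rewrite disjoint_sym; apply: disjointWr eX _.
      by rewrite disjoints_subset.
    have [| |[e1 [e2 [k1 k2 k3]]]|[e1 [e2 [e3 [/and3P[k1 k2 k3] k4 k5 k6]]]]] := h1 T X WX d hn1 nX nX' _ (leqnn d).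
    - by move=> e /WXW/sW; rewrite kE.
    - move=> S sS sSX; have SX : S \subset X by apply/setIidPl/eqP; rewrite eqEcard subsetIl sS sSX /=.
      by have [e eW Se] := cov S sS SX; exists e => //; rewrite inE eW (covX S e).
    - by left; exists e1, e2, e0; rewrite (WXW e1) // (WXW e2) // e0W k3 !WXd.
    - by right; exists e1, e2, e3; rewrite !WXW.
  have allX e : e \in W -> e \subset X by move=> eW; case: (sideX e eW) => // h; have := nob e eW; rewrite h.
  (* At a d-set of minimum degree in [Bprime k X v], [H] has an edge outside [Bprime k X v]. It is
     wrong, hence inside [X], and therefore avoids [v]. *)
  have av v : v \in X -> exists S : {set T}, [/\ #|S| = d, degree (Bprime k X v) S = min_degree d (Bprime k X v)
      & exists2 e, e \in W & (S \subset e) && (v \notin e)].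
    move=> vX; have BH := Bprime_Hext (ltn0Sn r1) hT om vX pX.
    have [S sS eS] := exists_min_degree (Bprime k X v) dT; exists S; split=> //.
    have [|e [eH Se eF]] := exceeding_edge hH dT BH sS; first by rewrite eS.
    have eW := inW _ v e erefl eH eF; exists e => //; rewrite Se /=.
    apply: contra eF => ve; rewrite in_setU; apply/orP; right.
    by rewrite inE sW // eqxx allX.
  pose e_ v := odflt set0 [pick e in W | v \notin e].
  have [v0 v0X] : exists v, v \in X.
    apply/set0Pn; rewrite -card_gt0; case: #|X| nX => //; rewrite muln0 leqn0 => /eqP t0.
    by move: dT d0; rewrite t0; case: (d).
  have [S0 [s0 m0 [f0 f0W /andP[Sf0 v0f]]]] := av v0 v0X.
  have S0X : S0 \subset X := subset_trans Sf0 (allX _ f0W).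
  have [| | |[e1 [e2 [e3 h]]]|[e1 [e2 [e3 h]]]] := h2 T X W e_ hn2 nX nX'.
  - by move=> e eW; rewrite -kE sW // allX.
  - move=> c cX; rewrite /e_; case: pickP => [e /andP[]//|/=].
    by have [S [_ _ [e eW /andP[_ ce]]]] := av c cX => /(_ e); rewrite eW ce.
  (* In [Bodd] the sets [S] and [S0] have the same degree, so wrong edges at [S] must exceed the
     surplus that [Bprime] has at [S0]. *)
  - move=> S sS SX.
    have : degree (Bprime k X v0) S0 < degree H S.
      rewrite m0; apply: leq_ltn_trans (min_degree_le_bar_delta dT (Bprime_Hext (ltn0Sn r1) hT om v0X pX)) _.
      by apply: leq_trans hH _; apply: min_degree_le.
    have v0S : v0 \notin S0 by apply: contra v0f; apply: (subsetP Sf0).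
    have hB := degree_Bprime ek S0X v0X v0S (etrans (congr1 (addn^~ _) s0) dq).
    have hP : degree (Bodd k X) S <= degree (Bodd k X) S0.
      rewrite Bodd_parity; apply: degree_parity_class; rewrite ?s0 ?sS //.
      by rewrite (setIidPl SX) (setIidPl S0X) sS s0.
    have hH' : degree H S <= degree (Bodd k X) S + #|[set e in W | S \subset e]|.
      rewrite BX; apply: leq_trans (leq_card_setU _ _).1; apply: subset_leq_card.
      apply/subsetP => e; rewrite !inE => /andP[eH ->]; rewrite !andbT kH // eqxx eH /=.
      by case: (odd _).
    rewrite s0 in hB; move: hB hP hH'; clear; lia.
  - by left; exists e1, e2, e3.
  - by right; exists e1, e2, e3.
have [j jd [[S0 s0 sj] cov]] := covered_by_wrong kH hH dT (parity_class_Hext_odd (ltn0Sn r1) hT A om).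
have [e0 e0W Se0] := cov S0 s0 sj.
have oT : odd #|T| = odd r1.+1 by rewrite hT oddM om andbT.
case: (side e0 e0W) => [[e0A pr]|[e0A pr]].
  apply: (finish A) => //.
  - move=> S sS SA; apply: cov => //; rewrite (setIidPl SA) sS -s0 -sj.
    by rewrite (setIidPl (subset_trans Se0 e0A)).
  - by rewrite -/(target A m) -[target A m]negbK -pr.
  - by move=> e /side[[]|[]]; [left|right].
apply: (finish (~: A)).
- move=> S sS SA; apply: cov => //; rewrite -sj.
  have z (Y : {set T}) : Y \subset ~: A -> #|Y :&: A| = 0.
    by move=> h; apply/eqP; rewrite cards_eq0 setI_eq0 disjoints_subset.
  by rewrite !z // (subset_trans Se0 e0A).
- move: oT pr; rewrite -(cardsC A) oddD /target.
  by case: (odd #|A|); case: (odd #|~: A|); case: (1 < _); case: (odd _).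
- by move=> e /side[[]|[]]; rewrite setCK; [right|left].
- apply/setP => e; rewrite !inE; case: eqP => //= se.
  have := cardsID A e; rewrite se => E; have := congr1 odd E; rewrite oddD (negbTE ek).
  rewrite -setDE; by case: (odd _); case: (odd _).
- by [].
- by rewrite setCK.
Qed.

Local Open Scope ring_scope.

(** * From closeness and degrees to densities *)

Section Counting.
Variables (R : realFieldType) (T : finType).
Hypothesis T_gt0 : (0 < #|T|)%N.
Local Notation n := #|T|.
Local Notation Pr := (@prob R T).
Implicit Types (e : {set T}) (G H F : {set {set T}}) (t U : seq T).

Lemma card_link G (x : T) j :
  #|[set e : {set T} | [&& x \notin e, x |: e \in G & #|e| == j]]| =
  #|[set e in G | (#|e| == j.+1) && (x \in e)]|.
Proof.
have inj : {in [set e : {set T} | [&& x \notin e, x |: e \in G & #|e| == j]] &, injective (fun e => x |: e)}.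
  by move=> e e'; rewrite !inE => /and3P[h _ _] /and3P[h' _ _] E; rewrite -(setU1K h) -(setU1K h') E.
rewrite -(card_in_imset inj); apply: eq_card => e; apply/imsetP/idP => [[e' + ->]|].
  by rewrite !inE => /and3P[h -> /eqP s]; rewrite cardsU1 h s add1n !eqxx.
rewrite inE => /and3P[eG se xe]; exists (e :\ x); last by rewrite setD1K.
by rewrite inE setD11 setD1K //= eG; move: se; rewrite (cardsD1 x e) xe add1n eqSS.
Qed.

Lemma Pr_sets j G :
  Pr j (fun t => uniq t && ([set x in t] \in G)) =
  j`!%:R * #|[set e in G | #|e| == j]|%:R / n%:R ^+ j.
Proof.
elim: j G => [|j IH] G.
  rewrite /prob EE0 /= fact0 mul1r expr0 divr1.
  have -> : [set x in Nil T] = set0 by apply/setP => x; rewrite !inE.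
  have [h|h] := boolP (set0 \in G).
    rewrite (_ : [set e in G | _] = [set set0]) ?cards1 //.
    by apply/setP => e; rewrite !inE cards_eq0; case: eqP => [->|]; rewrite ?h ?andbF.
  rewrite (_ : [set e in G | _] = set0) ?cards0 //.
  by apply/setP => e; rewrite !inE cards_eq0; case: eqP => [->|]; rewrite ?(negbTE h) ?andbF.
rewrite /prob EES.
have E x : EE j (fun t => (uniq (x :: t) && ([set z in x :: t] \in G))%:R) =
    j`!%:R * #|[set e in G | (#|e| == j.+1) && (x \in e)]|%:R / n%:R ^+ j :> R.
  rewrite -card_link; transitivity (Pr j (fun t => uniq t && ([set z in t] \in
     [set e : {set T} | (x \notin e) && (x |: e \in G)]))).
    apply: EE_eq => t _; congr (_%:R); congr nat_of_bool.
    have -> : [set z in x :: t] = x |: [set z in t] by apply/setP => z; rewrite !inE.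
    by rewrite /= !inE; case: (x \in t); case: (uniq t).
  rewrite IH; congr (_ * (_%:R) / _); apply: eq_card => e; by rewrite !inE andbA.
rewrite (eq_bigr _ (fun x _ => E x)) -mulr_suml -mulr_sumr -natr_sum exprS invfM.
have -> : (\sum_x #|[set e in G | (#|e| == j.+1) && (x \in e)]|)%N = (j.+1 * #|[set e in G | #|e| == j.+1]|)%N.
  rewrite mulnC -sum_nat_const.
  rewrite (eq_bigr (fun x => \sum_(e in [set e in G | #|e| == j.+1]) (x \in e : nat))%N); last first.
    move=> x _; rewrite -sum1_card [RHS]big_mkcond [LHS]big_mkcond; apply: eq_bigr => e _.
    by rewrite !inE; case: (e \in G); case: (#|e| == _); case: (x \in e).
  rewrite exchange_big /=; apply: eq_bigr => e; rewrite inE => /andP[_ /eqP <-].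
  by rewrite -sum1_card [RHS]big_mkcond.
rewrite factS !natrM; set a := n%:R^-1; set b := _^-1; by rewrite /=; ring.
Qed.

Lemma par_set A U : uniq U -> odd #|[set x in U] :&: A| = par A U.
Proof.
move=> uU; rewrite /par -size_filter -(card_uniqP (filter_uniq (mem A) uU)); congr odd.
by apply: eq_card => x; rewrite mem_filter in_setI inE andbC.
Qed.

Lemma Pr_edge k H U j : kgraph k H -> uniq U -> (size U + j = k)%N ->
  Pr j (fun t => edge H (U ++ t)) = j`!%:R * (degree H [set x in U])%:R / n%:R ^+ j.
Proof.
move=> kH uU sk; pose Z := [set x in U].
have sZ : #|Z| = size U by rewrite cardsE; apply/card_uniqP.
pose G := [set e : {set T} | [disjoint e & Z] && (e :|: Z \in H)].
rewrite -[degree H _]/(degree H Z) (_ : degree H Z = #|[set e in G | #|e| == j]|); last first.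
  have sub e : e \in [set e in G | #|e| == j] -> (e :|: Z) :\: Z = e.
    rewrite !inE => /andP[/andP[dj _] _]; rewrite setDUl setDv setU0; exact/setDidPl.
  have inj : {in [set e in G | #|e| == j] &, injective (fun e => e :|: Z)}.
    by move=> e e' h h' /= E; rewrite -(sub _ h) -(sub _ h') E.
  rewrite -(card_in_imset inj) /degree; apply: eq_card => e; apply/idP/imsetP => [|[e' + ->]]; last first.
    by rewrite !inE => /andP[/andP[_ ->] _]; rewrite subsetUr.
  rewrite inE => /andP[eH Ze]; have E : (e :\: Z) :|: Z = e.
    by rewrite setUC -{1}(setIidPr Ze) setID.
  exists (e :\: Z); last by rewrite E.
  rewrite !inE E eH andbT; apply/andP; split.
    by rewrite -setI_eq0; apply/eqP/setP => z; rewrite !inE; do !case: (z \in _).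
  by rewrite cardsD (setIidPr Ze) kH // sZ -sk addKn.
rewrite -Pr_sets; apply: Pr_eq => t _; rewrite /edge cat_uniq uU /= !inE.
have -> : [set x in U ++ t] = [set x in t] :|: Z by apply/setP => x; rewrite !inE mem_cat orbC.
have -> : [disjoint [set x in t] & Z] = ~~ has (mem U) t.
  apply/pred0P/hasPn => [h x xt|h x]; first by have := h x; rewrite /= !inE xt /= => ->.
  by rewrite /= !inE; apply/negP => /andP[/h/negP].
by case: (uniq t); case: (has _ t); rewrite ?andbF.
Qed.

Lemma density_parity_class k A y U j : nearly_half A y -> 0 < y -> (100 * k%:R <= y * n%:R) ->
  uniq U -> (size U + j.+1 = k)%N ->
  1/2 - y - 4 * k%:R * y <= Pr j.+1 (fun t => edge (parity_class k A true) (U ++ t)).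
Proof.
move=> hA y0 hn uU sk.
have [h1 _] := andP (Pr_par T_gt0 j (~~ par A U) hA).
have hZ : #|[set z in U]|%:R <= y * n%:R.
  apply: le_trans hn; rewrite -natrM ler_nat; apply: leq_trans (_ : k <= _)%N; last by rewrite leq_pmull.
  by rewrite cardsE; apply: leq_trans (card_size _) _; rewrite -sk leq_addr.
have j3 : (j.+1 <= 3 * k)%N by rewrite -sk; clear; lia.
have h2 := Pr_nfresh T_gt0 y0 hn j3 hZ.
have h3 : Pr j.+1 (fun t => par A t == ~~ par A U) <=
   Pr j.+1 (fun t => edge (parity_class k A true) (U ++ t)) + Pr j.+1 (fun t => ~~ fresh [set z in U] t).
  apply: Pr_or => // t st /eqP pt; have [ft|//] := boolP (fresh _ t); last by rewrite orbT.
  rewrite orbF /edge.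
  have [ut /hasPn ht] := andP ft.
  have uUt : uniq (U ++ t).
    by rewrite cat_uniq uU ut andbT; apply/hasPn => x /ht; rewrite /= inE.
  rewrite uUt inE par_set // par_cat pt /=; apply/andP; split; last by case: (par A U).
  by rewrite cardsE (card_uniqP uUt) size_cat st sk.
by move: h1 h2 h3; set a := Pr _ _; set b := Pr _ _; set c := Pr _ _; lra.
Qed.

(** For d-sets the degree exceeds the minimum degree of a nearly balanced member of [Hext], whose
    density is about 1/2; smaller sets follow by averaging over their extensions to d-sets. *)
Lemma density_of_degree k d H A y : kgraph k H -> (d < k)%N -> nearly_half A y -> 0 < y ->
  100 * k%:R <= y * n%:R -> parity_class k A true \in Hext T k ->
  (bar_delta n k d < min_degree d H)%N ->
  forall U, uniq U -> (size U <= d)%N ->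
  1/2 - y - 8 * k%:R * y <= Pr (k - size U) (fun t => edge H (U ++ t)).
Proof.
move=> kH dk hA y0 hn hF hH U uU sU.
have kF : kgraph k (parity_class k A true) by move=> e; rewrite inE => /andP[/eqP].
pose j := (k - d.+1)%N; have kj : (d + j.+1 = k)%N by rewrite /j; move: dk; clear; lia.
have -> : (k - size U = (d - size U) + j.+1)%N by move: kj sU; clear; lia.
have base V : uniq V -> size V = d -> 1/2 - y - 4 * k%:R * y <= Pr j.+1 (fun t => edge H (V ++ t)).
  move=> uV sV.
  have dT : (d <= n)%N by rewrite -sV -(card_uniqP uV) max_card.
  have [S0 s0 eS0] := exists_min_degree (parity_class k A true) dT.
  have sz0 : (size (enum S0) + j.+1 = k)%N by rewrite -cardE s0.
  apply: le_trans (density_parity_class hA y0 hn (enum_uniq (mem S0)) sz0) _.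
  rewrite !(@Pr_edge k) ?sV ?enum_uniq // ler_pM2r; last by rewrite invr_gt0 exprn_gt0 // ltr0n.
  rewrite ler_pM2l ?ltr0n ?fact_gt0 // ler_nat set_enum eS0.
  apply: leq_trans (min_degree_le_bar_delta dT hF) _; apply: leq_trans (ltnW hH) _.
  by apply: min_degree_le; rewrite cardsE (card_uniqP uV).
rewrite Pr_cat.
have hZ : #|[set z in U]|%:R <= y * n%:R.
  apply: le_trans hn; rewrite -natrM ler_nat; apply: leq_trans (_ : k <= _)%N; last by rewrite leq_pmull.
  by rewrite cardsE; apply: leq_trans (card_size _) _; move: sU dk; clear; lia.
have j3 : (d - size U <= 3 * k)%N by move: dk; clear; lia.
have h2 := Pr_nfresh T_gt0 y0 hn j3 hZ.
suff : 1/2 - y - 4 * k%:R * y <= EE (d - size U) (fun s => Pr j.+1 (fun t => edge H (U ++ (s ++ t)))) +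
   Pr (d - size U) (fun t => ~~ fresh [set z in U] t).
  by move: h2; set a := Pr _ _; set b := EE _ _; lra.
rewrite -EED; apply: EE_geC => // s ss.
have [fs|_] := boolP (fresh _ s); last first.
  have := Pr_ge0 R T_gt0 j.+1 (fun t => edge H (U ++ (s ++ t))); set a := Pr _ _.
  have : 0 <= k%:R * y by rewrite mulr_ge0 // ltW.
  rewrite /= -mulrA; move: y0; clear; set b := k%:R * y; lra.
rewrite addr0; have [us /hasPn hs] := andP fs.
rewrite (@Pr_eq R T _ _ (fun t => edge H ((U ++ s) ++ t))) => [|t _]; last by rewrite catA.
apply: base; last by rewrite size_cat ss subnKC.
by rewrite cat_uniq uU us andbT; apply/hasPn => x /hs; rewrite /= inE.
Qed.

(* Vertices in more wrong than right edges change sides. *)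
Lemma move_vertices H A1 pi r1 (y dl rho : R) : let r := r1.+1 in
  nearly_half A1 y -> Pr (r + r) (miss H A1 pi) <= dl -> Pr (r + r) (wedge H A1 pi) <= dl ->
  (forall v, 1/2 - rho <= Pr (r1 + r) (fun t => edge H (v :: t))) -> rho <= 1/4 ->
  exists A, [/\ nearly_half A (y + 8 * dl),
    Pr (r + r) (miss H A pi) <= dl + (r + r)%:R * (8 * dl) &
    forall v, 1/4 - rho / 2 - (r + r)%:R * (8 * dl) <= Pr (r1 + r) (fun t => redge H A pi (v :: t))].
Proof.
move=> r hA hm hw hd hrho.
pose f v := Pr (r1 + r) (fun t => redge H A1 pi (v :: t)).
pose g v := Pr (r1 + r) (fun t => wedge H A1 pi (v :: t)).
pose B := [set v | f v < g v].
have n0 : (0 : R) < n%:R by rewrite ltr0n.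
have fg v : 1/2 - rho <= f v + g v.
  apply: le_trans (hd v) _; apply: Pr_or => // t _ h; rewrite /redge /wedge h /=.
  by case: (_ == pi).
(* A vertex of [B] satisfies f v + g v >= 1/4 and f v < g v, hence g v >= 1/8. *)
have hB : #|B|%:R / n%:R <= 8 * dl.
  have : Pr (r + r) (wedge H A1 pi) = (\sum_v g v) / n%:R by rewrite /prob EES.
  move=> E; rewrite E in hw.
  suff : #|B|%:R / n%:R <= 8 * ((\sum_v g v) / n%:R).
    by move=> h; apply: le_trans h _; rewrite ler_pM2l.
  rewrite mulrA ler_pM2r ?invr_gt0 // mulr_sumr -sum1_card natr_sum big_mkcond /=.
  apply: ler_sum => v _; rewrite inE; have := fg v; have := Pr_ge0 R T_gt0 (r1 + r) (fun t => wedge H A1 pi (v :: t)).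
  by rewrite -/(g v); case: ifP => h; move: h hrho; set a := f v; set b := g v; lra.
pose A := [set v | (v \in A1) (+) (v \in B)].
have parA t : ~~ has (mem B) t -> par A t = par A1 t.
  move=> /hasPn h; congr odd; apply: eq_in_count => v /h; rewrite /= !inE => /negbTE->.
  by rewrite addbF.
have hit j : (j <= r + r)%N -> Pr j (has (mem B)) <= (r + r)%:R * (8 * dl).
  move=> jr; apply: le_trans (Pr_hit R T_gt0 B j) _; apply: ler_pM => //; last by rewrite ler_nat.
  by rewrite divr_ge0.
exists A; split.
- rewrite !nearly_half.unlock in hA *.
  have c1 : (#|A| <= #|A1| + #|B|)%N.
    apply: leq_trans (leq_card_setU _ _).1; apply: subset_leq_card.
    by apply/subsetP => v; rewrite !inE; case: (v \in A1); case: (_ < _).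
  have c2 : (#|A1| <= #|A| + #|B|)%N.
    apply: leq_trans (leq_card_setU _ _).1; apply: subset_leq_card.
    by apply/subsetP => v; rewrite !inE; case: (v \in A1); case: (_ < _).
  have d1 : #|A|%:R / n%:R <= #|A1|%:R / n%:R + #|B|%:R / n%:R :> R.
    by rewrite -mulrDl ler_pM2r ?invr_gt0 // -natrD ler_nat.
  have d2 : #|A1|%:R / n%:R <= #|A|%:R / n%:R + #|B|%:R / n%:R :> R.
    by rewrite -mulrDl ler_pM2r ?invr_gt0 // -natrD ler_nat.
  move: hA hB d1 d2; clear; set a := #|A|%:R / _; set b := #|B|%:R / _; set a1 := #|A1|%:R / _.
  by move=> /andP[h1 h2] h3 h4 h5; apply/andP; split; lra.
- apply: le_trans (lerD hm (hit _ (leqnn _))); apply: Pr_or => // t _.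
  have [_|nh] := boolP (has _ t); first by rewrite orbT.
  by rewrite orbF /miss parA.
- move=> v.
  have h1 : 1/4 - rho / 2 <= Num.max (f v) (g v).
    have := fg v; rewrite le_max; case: (leP (f v) (g v)) => h.
      by move=> h'; apply/orP; right; lra.
    by move=> h'; apply/orP; left; lra.
  suff : Num.max (f v) (g v) <= Pr (r1 + r) (fun t => redge H A pi (v :: t)) + Pr (r1 + r) (has (mem B)).
    have := hit (r1 + r)%N (leqnSn _); move: h1; clear.
    set a := Num.max _ _; set b := prob _ _ _; set c := prob _ _ _; set d := (_ * _); lra.
  have parv t : ~~ has (mem B) t -> par A (v :: t) = (v \in B) (+) par A1 (v :: t).
    move=> h; have EA : (v \in A) = (v \in A1) (+) (v \in B) by rewrite in_set.
    have := parA t h; rewrite /par /= !oddD !oddb EA => ->.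
    by rewrite addbA [(v \in B) (+) _]addbC.
  have vB : (v \in B) = (f v < g v) by rewrite inE.
  rewrite /Num.max; case: ifP => fg'; rewrite fg' in vB; apply: Pr_or => // t _.
    have [_|nh] := boolP (has _ t); first by rewrite orbT.
    by rewrite orbF /wedge /redge parv // vB => /andP[-> /=]; case: (par A1 _); case: (pi).
  have [_|nh] := boolP (has _ t); first by rewrite orbT.
  by rewrite orbF /redge parv // vB.
Qed.

End Counting.

Section Close.
Variables (R : realFieldType) (T : finType).
Hypothesis T_gt0 : (0 < #|T|)%N.
Local Notation n := #|T|.
Local Notation Pr := (@prob R T).

Lemma nearly_half_of_card (A : {set T}) (y : R) : (n <= 2 * #|A| + 2)%N -> (2 * #|A| <= n + 2)%N ->
  1 <= y * n%:R -> nearly_half A y.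
Proof.
move=> h1 h2 hy; rewrite nearly_half.unlock.
have n0 : (0 : R) < n%:R by rewrite ltr0n.
have {}h1 : n%:R <= 2 * #|A|%:R + 2 :> R by rewrite -natrM -natrD ler_nat.
have {}h2 : 2 * #|A|%:R <= n%:R + 2 :> R by rewrite -natrM -natrD ler_nat.
rewrite ler_pdivlMr // ler_pdivrMr // mulrBl mulrDl.
move: h1 h2 hy; set w := y * _; set a := #|A|%:R; set b := n%:R; lra.
Qed.

Lemma card_of_nearly_half (A : {set T}) (x : R) : x <= 1/4 -> nearly_half A x ->
  (n <= 4 * #|A|)%N /\ (n <= 4 * #|~: A|)%N.
Proof.
move=> hx; rewrite nearly_half.unlock.
have n0 : (0 : R) < n%:R by rewrite ltr0n.
rewrite ler_pdivlMr // ler_pdivrMr // mulrBl mulrDl => /andP[h1 h2].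
have h3 : x * n%:R <= 1/4 * n%:R by rewrite ler_pM2r.
have h4 : n%:R = #|A|%:R + #|~: A|%:R :> R by rewrite -natrD cardsC.
by split; rewrite -(ler_nat R) natrM; move: h1 h2 h3 h4; set w := x * _; set a := #|A|%:R;
  set b := #|T|%:R; set c := #|~: A|%:R; lra.
Qed.

Lemma nearly_halfW (A : {set T}) (x y : R) : y <= x -> nearly_half A y -> nearly_half A x.
Proof. by rewrite !nearly_half.unlock => h /andP[h1 h2]; apply/andP; split; lra. Qed.

Lemma close_parity_class k H A0 pi (eps : R) : eps_close k eps H (parity_class k A0 pi) ->
  exists A : {set T}, [/\ #|A| = #|A0|, Pr k (miss H A pi) <= k`!%:R * eps & Pr k (wedge H A pi) <= k`!%:R * eps].
Proof.
case=> s /=; set H'' := [set _ | e in _] => hc; exists (s @: A0).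
have s_inj : injective s := @perm_inj _ s.
have E : H'' = parity_class k (s @: A0) pi.
  by apply: (imset_Bpar (injF_bij s_inj) k A0 (fun a => odd a == pi)).
rewrite E in hc; pose D := (H :\: parity_class k (s @: A0) pi) :|: (parity_class k (s @: A0) pi :\: H).
have hD : Pr k (fun t => uniq t && ([set x in t] \in D)) <= k`!%:R * eps.
  have n0 : (0 : R) < n%:R ^+ k by rewrite exprn_gt0 // ltr0n.
  rewrite Pr_sets // -mulrA ler_pM2l ?ltr0n ?fact_gt0 // ler_pdivrMr //.
  apply: le_trans hc; rewrite ler_nat; apply: subset_leq_card.
  by apply/subsetP => e; rewrite inE => /andP[].
have inP t : uniq t -> size t = k -> ([set x in t] \in parity_class k (s @: A0) pi) = (par (s @: A0) t == pi).
  by move=> ut st; rewrite inE par_set // cardsE (card_uniqP ut) st eqxx.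
split; first by rewrite card_imset.
- apply: le_trans hD; apply: Pr_sub => // t st /and3P[ut pt nt].
  by rewrite ut /D in_setU !in_setD inP // pt (negbTE nt).
- apply: le_trans hD; apply: Pr_sub => // t st /andP[/andP[ut pt] nt].
  by rewrite ut /D in_setU !in_setD inP // pt (negbTE nt).
Qed.

(** This partition serves only to bound [bar_delta] from below and need not be the one that [H] is
    close to. Its first part has n./2 or one more vertices, whichever has the parity that [Hext]
    asks for. *)
Lemma exists_balanced_Hext r m : (0 < r)%N -> n = (r * m)%N -> (2 <= n)%N ->
  exists A : {set T}, [/\ (n <= 2 * #|A| + 2)%N, (2 * #|A| <= n + 2)%N & parity_class (r + r) A true \in Hext T (r + r)].
Proof.
move=> r0 hT n2; pose b := ~~ (1 < m %% 4)%N.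
pose a := (n./2 + (odd n./2 != b))%N.
have [a1 a2] : (n./2 <= a /\ a <= (n./2).+1)%N.
  by rewrite /a; case: (_ != b); rewrite /= ?addn1 ?addn0.
have := odd_double_half n; rewrite -addnn => hn.
have bn : (odd n <= 1)%N by case: (odd n).
have [|A _ sA] := @exists_subset _ [set: T] a.
  by rewrite cardsT; move: n2 a2 hn bn; clear; lia.
exists A; rewrite sA; split; [move: a1 hn bn; clear; lia | move: a2 hn bn; clear; lia |].
have [om|em] := boolP (odd m); first exact: (parity_class_Hext_odd r0 hT).
apply: (parity_class_Hext_even r0 hT) => //; rewrite sA /a oddD /b /=.
by move: (odd n./2) (1 < m %% 4)%N => [] [].
Qed.

End Close.

Lemma ltn_exp16 a : exists n2, forall n N, (n2 <= n)%N -> (n <= a * N)%N -> (n ^ 16 < 2 ^ N)%N.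
Proof.
have sq q : (q * q <= 2 ^ q.+1)%N.
  elim: q => // q IH; rewrite expnS; have := ltn_expl q (isT : 1 < 2)%N.
  by move: IH; rewrite expnS; set w := (2 ^ q)%N; clear; lia.
exists (a * (16 * (32 * a).+2))%N.+1 => n N n2 nN.
have a0 : (0 < a)%N by case: (a) n2 nN => // n2 nN; have := leq_trans n2 nN; rewrite mul0n.
pose q := (N %/ 16)%N.
have hN : (16 * (32 * a).+2 < N)%N by rewrite -(ltn_pmul2l a0); apply: leq_trans nN.
have hq : (32 * a < q.-1)%N by rewrite /q; move: hN; clear; lia.
apply: (@leq_ltn_trans ((a * N) ^ 16)); first by rewrite leq_exp2r.
apply: (@leq_trans ((2 ^ q) ^ 16)); last by rewrite -expnM leq_pexp2l // leq_divM.
rewrite ltn_exp2r //.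
have h1 := sq q.-1; have q0 : q.-1.+1 = q by move: hq; clear; lia.
rewrite q0 in h1; apply: leq_trans h1.
have hN2 : (N <= 16 * q.+1)%N by rewrite /q; clear; lia.
apply: leq_ltn_trans (_ : _ <= a * (16 * q.+1))%N _; first by rewrite leq_mul2l hN2 orbT.
apply: (@leq_trans (32 * a * q.-1 + q.-1)%N); last by rewrite -mulSnr leq_mul2r hq orbT.
by move: hq q0; case: (q) => // p /= hp _; move: hp; clear; nia.
Qed.

(** As [R] need not be archimedean, x is taken as the reciprocal of an explicit natural number;
    lower bounds on n in terms of x are then bounds by natural numbers. *)
Lemma exists_scale (R : realFieldType) r1 : exists2 M : nat, (0 < M)%N &
  let x : R := 1 / M%:R in
  [/\ 80 * r1.+1%:R * x <= rok_cst R r1,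
      100 * x <= (1 / (10 * r1.+1%:R)) ^+ (r1.+1 + (r1 + r1.+1)) &
      4 * fact_cst R r1 * x <= rok_cst R r1 * level R r1 r1].
Proof.
have [K K0 EK] : exists2 K : nat, (0 < K)%N & fact_cst R r1 = K%:R.
  by exists ((r1.+1 + r1.+1)`!)%N; rewrite ?fact_gt0.
rewrite /level /rok_cst EK; set r := r1.+1.
pose M1 := (80 * r * (64 * K))%N; pose M2 := (100 * (10 * r) ^ (r + (r1 + r)))%N.
pose M3 := (4 * K * (64 * K * (8 * (20 * K) ^ r1)))%N.
have M0 : (0 < M1 + M2 + M3)%N.
  by apply/ltn_addr/ltn_addr; rewrite /M1 muln_gt0 [(0 < 64 * K)%N]muln_gt0 K0.
exists (M1 + M2 + M3)%N => //=.
have key (a b : nat) (z : R) : (0 < b)%N -> z = 1 / b%:R -> (a * b <= M1 + M2 + M3)%N ->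
    a%:R * (1 / (M1 + M2 + M3)%:R) <= z.
  move=> b0 -> h; rewrite !div1r ler_pdivrMr ?ltr0n // mulrC ler_pdivlMr ?ltr0n //.
  by rewrite -natrM ler_nat.
split.
- rewrite -natrM; apply: (key _ (64 * K)%N); rewrite ?muln_gt0 ?K0 //.
    by rewrite natrM.
  by rewrite -/M1 -addnA leq_addr.
- apply: (key 100%N ((10 * r) ^ (r + (r1 + r)))%N); rewrite ?expn_gt0 ?muln_gt0 //.
    by rewrite natrX natrM expr_div_n expr1n.
  by rewrite -/M2 addnAC leq_addl.
- rewrite -natrM; apply: (key _ (64 * K * (8 * (20 * K) ^ r1))%N).
  + by rewrite !muln_gt0 expn_gt0 muln_gt0 K0.
  + rewrite !natrM natrX natrM expr_div_n expr1n.
    have k0 : K%:R != 0 :> R by rewrite pnatr_eq0 -lt0n.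
    have k1 : (20 * K%:R) ^+ r1 != 0 :> R by rewrite expf_neq0 // mulf_neq0 // pnatr_eq0.
    by field; rewrite k0 k1.
  + by rewrite -/M3 leq_addl.
Qed.

Lemma hamilton_of_close (R : realFieldType) (r1 d : nat) : (2 <= r1)%N -> (r1 < d)%N -> (d < r1.+1 + r1.+1)%N ->
  exists (eps : R) (n2 : nat), 0 < eps /\ forall (T : finType) (H : {set {set T}}) (A : {set T}) pi m,
    kgraph (r1.+1 + r1.+1) H -> (n2 <= #|T|)%N -> #|T| = (r1.+1 * m)%N ->
    (bar_delta #|T| (r1.+1 + r1.+1) d < min_degree d H)%N -> balanced A ->
    eps_close (r1.+1 + r1.+1) eps H (parity_class (r1.+1 + r1.+1) A pi) ->
    has_hamilton_cycle (r1.+1 + r1.+1) r1.+1 H.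
Proof.
set r := r1.+1 => r12 rd dk; pose k := (r + r)%N.
have [M M0 [x1 x2 x3]] := exists_scale R r1.
set x : R := 1 / M%:R in x1 x2 x3; rewrite -/r in x1 x2 x3.
(* With 9 * k * y = x, the losses y + 8 * k * y in [density_of_degree] are at most x. *)
pose y : R := x / (9 * k%:R).
(* Closeness [eps] becomes density dl = k! * eps on tuples, and [move_vertices] raises it to dl + 8
   * k * dl, at most 16 * k * dl = x^3. *)
pose eps : R := x ^+ 3 / (16 * k%:R * k`!%:R).
have [n1 ev] := even_configuration rd (ltnW dk).
have [n3 od] := odd_configuration rd dk.
have [n4 hexp] := ltn_exp16 (4 * r).
have k6 : (6 <= k)%N by rewrite /k /r; move: r12; clear; lia.
have kR : (6 : R) <= k%:R by rewrite (ler_nat _ 6).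
have x0 : 0 < x by rewrite divr_gt0 // ltr0n.
have xs : x <= 1/8.
  have := x1; have := c_small R r1; have : (3 : R) <= r%:R by rewrite (ler_nat _ 3).
  move: x0; clear; set c := rok_cst _ _; set u := r%:R; nra.
have y0 : 0 < y by rewrite divr_gt0 // mulr_gt0 //; lra.
have f0 : (0 : R) < k`!%:R by rewrite ltr0n fact_gt0.
have ky : 9 * (k%:R * y) = x by rewrite /y; field; move: kR; clear; lra.
pose dl := k`!%:R * eps.
have kdl : 16 * (k%:R * dl) = x ^+ 3.
  by rewrite /dl /eps; field; rewrite gt_eqF //=; move: kR; clear; lra.
have x3' : x ^+ 3 <= x * (1/64).
  rewrite exprS ler_pM2l // expr2; move: x0 xs; clear; nra.
have dl0 : 0 <= dl.
  have : 0 < x ^+ 3 by rewrite exprn_gt0.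
  by move: kR kdl; clear; set z := x ^+ 3; nra.
(* The bound 900 * k * k * M is what 100 * k <= y * n amounts to. *)
exists eps, (maxn (maxn n1 n3) (maxn n4 (900 * k * k * M))); split.
  by rewrite divr_gt0 ?exprn_gt0 // !mulr_gt0 //; lra.
move=> T H A0 pi m kH; rewrite !geq_max => /andP[/andP[hn1 hn3] /andP[hn4 hn5]] hT hH bA hc.
have T0 : (0 < #|T|)%N by apply: leq_trans hn5; rewrite !muln_gt0 M0; move: k6; clear; lia.
have hny : 100 * k%:R <= y * #|T|%:R.
  rewrite /y mulrAC ler_pdivlMr; last by rewrite mulr_gt0 //; lra.
  rewrite /x div1r mulrC [X in _ <= X]mulrC ler_pdivlMr ?ltr0n // -!natrM ler_nat.
  by apply: leq_trans hn5; rewrite leq_eqVlt; apply/orP; left; apply/eqP; ring.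
have hny1 : 1 <= y * #|T|%:R by apply: le_trans hny; lra.
have n2 : (2 <= #|T|)%N by apply: leq_trans hn5; rewrite -[2%N]/(2 * 1 * 1 * 1)%N; move: k6 M0; clear; nia.
have yx : y <= x / 2 by move: ky kR y0; clear; nra.
have yz : y <= k%:R * y by move: kR y0; clear; nra.
have [A1 [cA1 hm hw]] := close_parity_class T0 hc.
have hA1 : nearly_half A1 y.
  case/andP: bA => b1 b2; have := cardsC A0; rewrite -cA1 in b1 *; rewrite -cA1 in b2 * => cT.
  by apply: nearly_half_of_card => //; move: b1 b2 cT; clear; lia.
have [A' [c1 c2 hF]] := exists_balanced_Hext (ltn0Sn r1) hT n2.
have hA' : nearly_half A' y by apply: nearly_half_of_card.
have dens U : uniq U -> (size U <= d)%N -> 1/2 - x <= prob R (k - size U) (fun t => edge H (U ++ t)).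
  move=> uU sU; apply: le_trans (density_of_degree T0 kH dk hA' y0 hny hF hH uU sU).
  by rewrite -mulrA; move: ky yz; clear; set z := k%:R * y; lra.
have hv v : 1/2 - x <= prob R (r1 + r) (fun t => edge H (v :: t)).
  by have := dens [:: v] isT (leq_ltn_trans (leq0n _) rd); rewrite /k /= /r subn1.
have x14 : x <= 1/4 by move: xs; clear; lra.
have [A [a1 a2 a3]] := move_vertices T0 hA1 hm hw hv x14.
rewrite -/k -/dl in a2 a3.
have st : setting H A pi r1 m x.
  split=> //.
  - apply: nearly_halfW a1; rewrite -/dl; move: yx kdl x3' kR x0 dl0; clear; set z := x ^+ 3; nra.
  - apply: le_trans a2 _; move: kdl kR dl0; clear; set z := x ^+ 3; nra.
  - move=> U uU /andP[_ sU]; have -> : (r - size U + r = k - size U)%N by rewrite addnBAC.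
    by apply: dens => //; apply: leq_trans sU _.
  - move=> v; apply: le_trans (a3 v); move: kdl x3' x0; clear; set z := x ^+ 3; lra.
  - apply: le_trans (_ : 100 * k%:R <= _); first by rewrite ler_pM2l // ler_nat leq_addr.
    apply: le_trans hny _; rewrite ler_pM2r ?ltr0n //; move: yx x0; clear; lra.
  - by move=> N; apply: hexp.
have [nA nB] := card_of_nearly_half T0 x14 (st_A st).
have [om|em] := boolP (odd m).
  have [p1|p0] := boolP pi; last by apply: (hc_right st); rewrite om p0.
  rewrite p1 in st; apply: (hc_odd st kH om isT).
  exact: od.
have [E|ne] := eqVneq (odd #|A|) (pi && (1 < m %% 4)%N).
  by apply: (hc_right st); rewrite (negbTE em) E.
apply: (hc_even st kH em ne).
exact: (ev T H A pi m).
Qed.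

Local Close Scope ring_scope.

Theorem theorem1p6 (R : realFieldType) (k d : nat)
    (hk : 6 <= k) (hkeven : ~~ odd k) (hd1 : k./2 <= d) (hd2 : d <= k.-1) :
  exists (eps : R) (n2 : nat), (0 < eps)%R /\
    forall (T : finType) (H : {set {set T}}),
      kgraph k H ->
      n2 <= #|T| ->
      k./2 %| #|T| ->
      bar_delta #|T| k d < min_degree d H ->
      (exists2 A : {set T}, balanced A &
         eps_close k eps H (Bodd k A) \/ eps_close k eps H (Beven k A)) ->
      has_hamilton_cycle k k./2 H.
Proof.
have kE : k = k./2 + k./2 by rewrite addnn -[LHS]odd_double_half (negbTE hkeven).
have [r1 rE] : exists r1, k./2 = r1.+1.
  by exists (k./2).-1; rewrite prednK // half_gt0; apply: leq_trans hk.
rewrite rE in kE hd1 *.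
have r12 : 2 <= r1 by move: hk; rewrite kE; clear; lia.
have dk : d < r1.+1 + r1.+1 by move: hd2; rewrite kE; clear; lia.
have [eps [n2 [eps0 h]]] := hamilton_of_close R r12 hd1 dk.
exists eps, n2; split=> // T H; rewrite kE => kH hn /dvdnP[m hm] hH [A bA hc].
rewrite mulnC in hm; case: hc; rewrite ?Bodd_parity ?Beven_parity => hc.
  exact: (h T H A true m).
exact: (h T H A false m).
Qed.
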